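(* Let $\Lambda$ be a finite $k$-graph with no sources or sinks, and let $r\in(0,\infty)^k$ satisfy $\max\{r_i^{-1}\ln\rho(A_i):1\le i\le k\}=1$. Suppose that $\bigcup\{C:C\in\mathcal{C}\}=\Lambda^0$, that all the graphs $\{\Lambda_C:C\in\mathcal{C}\}$ are coordinatewise irreducible, and that for all components $C,D\in\mathcal{C}$, $$C\Lambda^{\mathbb{N}e_j}D\neq\emptyset\text{ for some }j\ \Longrightarrow\ C\Lambda^{\mathbb{N}e_i}D\neq\emptyset\text{ for }1\le i\le k.$$ Let $\mathcal{C}_{\mathrm{mincrit}}$ be the set of minimal critical components of $\Lambda$, let $H'$ be the hereditary closure of $G:=\bigcup\{C:C\in\mathcal{C}_{\mathrm{mincrit}}\}$, and set $H:=H'\setminus G$. Then: (1) $H$ is hereditary; (2) $\mathcal{C}_{\mathrm{mincrit}}$ is the set of all critical components in the graph $\Lambda\setminus H$, and each $C\in\mathcal{C}_{\mathrm{mincrit}}$ is hereditary in $\Lambda\setminus H$; (3) every KMS$_1$ state of $(\mathcal{T}C^*(\Lambda),\alpha^r)$ factors through a KMS$_1$ state of $(\mathcal{T}C^*(\Lambda\setminus H),\alpha^r)$.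
   Context: $\mathbb{N}=\{0,1,2,\dots\}$. A $k$-graph is a countable category $\Lambda$ with a functor $d:\Lambda\to\mathbb{N}^k$ such that whenever $d(\lambda)=m+n$ there are unique $\mu,\nu\in\Lambda$ with $d(\mu)=m$, $d(\nu)=n$, $\lambda=\mu\nu$. $\Lambda^n:=d^{-1}(n)$; $\Lambda^0$ (the vertices) is identified with the objects. The maps $s,r:\Lambda\to\Lambda^0$ are domain and codomain (the letter $r$ also denotes the vector $r\in(0,\infty)^k$). For $V\subset\Lambda^0$, $E\subset\Lambda$: $VE=\{\lambda\in E:r(\lambda)\in V\}$, $EV=\{\lambda\in E:s(\lambda)\in V\}$, $vE=\{v\}E$, $Ev=E\{v\}$. $e_1,\dots,e_k$ are the generators of $\mathbb{N}^k$, and $\Lambda^{\mathbb{N}e_j}=\bigcup_{n\in\mathbb{N}}\Lambda^{ne_j}$. $\Lambda$ is finite if every $\Lambda^n$ is finite; it has no sources (sinks) if $v\Lambda^n\ne\emptyset$ ($\Lambda^nv\neq\emptyset$) for all $v\in\Lambda^0$, $n\in\mathbb{N}^k$. The vertex matrix $A_i$ is the $\Lambda^0\times\Lambda^0$ matrix $A_i(v,w)=|v\Lambda^{e_i}w|$; for $C\subset\Lambda^0$, $A_{C,i}$ is its $C\times C$ block; $\rho$ is the spectral radius. A square matrix $A$ is irreducible if for all $i,j$ there is $m\in\mathbb{N}$ with $A^m(i,j)\ne0$. Strongly connected components are the classes of the relation $v\sim w\iff v\Lambda w\neq\emptyset$ and $w\Lambda v\ne\emptyset$; a class $\{v\}$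 with $v\Lambda v=\{v\}$ is trivial; $\mathcal{C}$ is the set of nontrivial strongly connected components. For $C\in\mathcal{C}$, $\Lambda_C:=C\Lambda C$ is a $k$-graph; it is coordinatewise irreducible if all $A_{C,i}$ ($1\le i\le k$) are irreducible. $H\subset\Lambda^0$ is hereditary if $v\in H$ and $v\Lambda w\ne\emptyset$ imply $w\in H$; the hereditary closure of a set is the smallest hereditary set containing it. If $H$ is hereditary, $\Lambda\setminus H:=\{\lambda\in\Lambda:s(\lambda)\notin H\}$ is a $k$-graph with vertex set $\Lambda^0\setminus H$. $C\in\mathcal{C}$ is critical (with respect to $r$) if for some $j$ we have $r_j=\ln\rho(A_j)=\ln\rho(A_{C,j})$ and $A_{C,j}$ is irreducible. Components are partially ordered by $C\le D\iff C\Lambda D\neq\emptyset$; a critical component is minimal critical if it is minimal, in this order, among the critical components. A Toeplitz–Cuntz–Krieger $\Lambda$-family is a collection of partial isometries $\{T_\lambda:\lambda\in\Lambda\}$ in a $C^*$-algebra such that (T1) $\{Q_v:=T_v:v\in\Lambda^0\}$ are mutually orthogonal projections; (T2) $T_\lambda T_\mu=T_{\lambda\mu}$ if $s(\lambda)=r(\mu)$; (T3) $T_\lambda^*T_\mu=\sum_{(\alpha,\beta)\in\Lambda^{\min}(\lambda,\mu)}T_\alpha T_\beta^*$, where $\Lambda^{\min}(\lambda,\mu)=\{(\alpha,\beta):\lambda\alpha=\mu\beta\in\Lambda^{d(\lambda)\vee d(\mu)}\}$. $\mathcal{T}C^*(\Lambda)$ is generated by a universal such family $\{t_\lambda\}$,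 with $q_v:=t_v$. The dynamics $\alpha^r:\mathbb{R}\to\operatorname{Aut}\mathcal{T}C^*(\Lambda)$ is determined by $\alpha^r_t(t_\lambda)=e^{it\,r\cdot d(\lambda)}t_\lambda$, and similarly on $\mathcal{T}C^*(\Lambda\setminus H)$. A state $\phi$ is a KMS$_\beta$ state ($\beta\in(0,\infty)$) for $\alpha$ if $\phi(ab)=\phi(b\alpha_{i\beta}(a))$ for all analytic $a,b$. For $H$ hereditary, $q_H:\mathcal{T}C^*(\Lambda)\to\mathcal{T}C^*(\Lambda\setminus H)$ is the surjection with $q_H(t_\lambda)=t_\lambda$ if $s(\lambda)\notin H$ and $q_H(t_\lambda)=0$ if $s(\lambda)\in H$; a state $\psi$ factors through a state $\phi$ of $\mathcal{T}C^*(\Lambda\setminus H)$ if $\psi=\phi\circ q_H$. *)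

(* Defs.v *)
From HB Require Import structures.
From mathcomp Require Export all_boot all_order all_algebra finmap.
From mathcomp Require Export all_classical all_reals all_analysis.
From mathcomp Require Export complex.
Set Implicit Arguments.
Unset Strict Implicit.
Unset Printing Implicit Defensive.
Export Order.TTheory GRing.Theory Num.Theory.
Export numFieldNormedType.Exports.
Global Open Scope ring_scope.

(** * k-graphs

   A category is given by its countable set [mor] of morphisms, its objects
   [vtx], and a composition that is total but meaningful only on composable
   pairs ([src l = rng m]); [src] is the domain and [rng] the codomain.
   Unique factorization forces the degree-0 morphisms to be exactly the
   identities [idp v], so that Lambda^0 is identified with [vtx].  Only k-graphs
   with finitely many vertices are considered, as is the case for every finite
   k-graph; finiteness of all the other Lambda^n is [finite_kgraph] below. *)
Record kgraph (k : nat) := KGraph {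
  vtx : finType;
  mor : countType;
  src : mor -> vtx;
  rng : mor -> vtx;
  idp : vtx -> mor;
  compose : mor -> mor -> mor;
  deg : mor -> {ffun 'I_k -> nat};
  src_idp : forall v, src (idp v) = v;
  rng_idp : forall v, rng (idp v) = v;
  src_comp : forall l m, src l = rng m -> src (compose l m) = src m;
  rng_comp : forall l m, src l = rng m -> rng (compose l m) = rng l;
  comp_idl : forall l, compose (idp (rng l)) l = l;
  comp_idr : forall l, compose l (idp (src l)) = l;
  compA : forall l m n, src l = rng m -> src m = rng n ->
    compose l (compose m n) = compose (compose l m) n;
  deg_idp : forall v, deg (idp v) = 0;
  deg_comp : forall l m, src l = rng m -> deg (compose l m) = deg l + deg m;
  factorization : forall l m n, deg l = m + n ->
    exists! p : mor * mor,
      [/\ deg p.1 = m, deg p.2 = n, src p.1 = rng p.2 & l = compose p.1 p.2]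
}.
Arguments src {k L} : rename.
Arguments rng {k L} : rename.
Arguments idp {k L} : rename.
Arguments compose {k L} : rename.
Arguments deg {k L} : rename.

Definition egen {k : nat} (j : 'I_k) : {ffun 'I_k -> nat} :=
  [ffun i => (i == j) : nat].

Definition deg_join {k : nat} (m n : {ffun 'I_k -> nat}) : {ffun 'I_k -> nat} :=
  [ffun i => maxn (m i) (n i)].

Section KGraph.
Variables (k : nat) (L : kgraph k).

Definition finite_kgraph :=
  forall n : {ffun 'I_k -> nat}, finite_set [set l : mor L | deg l = n]%classic.

Definition no_sources := forall (v : vtx L) (n : {ffun 'I_k -> nat}),
  exists l : mor L, rng l = v /\ deg l = n.

Definition no_sinks := forall (v : vtx L) (n : {ffun 'I_k -> nat}),
  exists l : mor L, src l = v /\ deg l = n.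

(* C Lambda D <> 0 *)
Definition linked (C D : {set vtx L}) : bool :=
  `[< exists l : mor L, rng l \in C /\ src l \in D >].

(* C Lambda^{N e_j} D <> 0 *)
Definition linked_in (j : 'I_k) (C D : {set vtx L}) : Prop :=
  exists (l : mor L) (n : nat),
    [/\ rng l \in C, src l \in D & deg l = egen j *+ n].

Definition scc (v : vtx L) : {set vtx L} :=
  [set w | linked [set v] [set w] && linked [set w] [set v]].

Definition trivial_component (C : {set vtx L}) : Prop :=
  exists v, C = [set v] /\
    forall l : mor L, rng l = v -> src l = v -> l = idp v.

(* the set of nontrivial strongly connected components *)
Definition components : {set {set vtx L}} :=
  [set C in [set scc v | v : vtx L] | ~~ `[< trivial_component C >]].

Definition hereditary (H : {set vtx L}) : bool :=
  [forall v, forall w,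
    (v \in H) ==> linked [set v] [set w] ==> (w \in H)].

Definition hereditary_closure (G : {set vtx L}) : {set vtx L} :=
  (\bigcap_(K : {set vtx L} | hereditary K && (G \subset K)) K)%SET.

(* Lambda^min(l, m) *)
Definition Lmin (l m : mor L) : set (mor L * mor L) :=
  [set p | [/\ src l = rng p.1, src m = rng p.2, compose l p.1 = compose m p.2
             & deg (compose l p.1) = deg_join (deg l) (deg m)]]%classic.

End KGraph.

(** * Vertex matrices and critical components *)
Section Matrices.
Variable R : realType.

Definition spectral_radius (n : nat) (A : 'M[R]_n) : R :=
  sup [set Normc.normc z | z in
         [set z : R[i] | eigenvalue (map_mx (real_complex R) A) z]]%classic.

Definition irreducible_mx (n : nat) (A : 'M[R]_n) : Prop :=
  forall i j, exists m : nat, (A ^+ m) i j != 0.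

Variables (k : nat) (L : kgraph k).

Definition vertex_mx (i : 'I_k) : 'M[R]_#|vtx L| :=
  \matrix_(a, b)
    #|` fset_set [set l : mor L | [/\ rng l = enum_val a, src l = enum_val b
                                     & deg l = egen i]]%classic|%:R.

(* the block A_{C,i} *)
Definition vertex_block (C : {set vtx L}) (i : 'I_k) : 'M[R]_#|C| :=
  mxsub (fun a => enum_rank (enum_val a)) (fun b => enum_rank (enum_val b))
    (vertex_mx i).

Definition coordinatewise_irreducible (C : {set vtx L}) : Prop :=
  forall i, irreducible_mx (vertex_block C i).

Variable r : 'I_k -> R.

(* [ln 0 = 0] in the library, where [- oo] would be meant; neither can
   equal [r j] when [0 < r j]. *)
Definition is_critical (C : {set vtx L}) : Prop :=
  exists j, [/\ r j = ln (spectral_radius (vertex_mx j)),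
    ln (spectral_radius (vertex_mx j)) =
      ln (spectral_radius (vertex_block C j))
    & irreducible_mx (vertex_block C j)].

Definition critical_components : {set {set vtx L}} :=
  [set C in components L | `[< is_critical C >]].

Definition min_critical_components : {set {set vtx L}} :=
  [set C in critical_components |
    [forall D in critical_components, linked D C ==> (D == C)]].

End Matrices.
Arguments vertex_mx R {k} L i.
Arguments vertex_block R {k L} C i.
Arguments coordinatewise_irreducible R {k L} C.
Arguments critical_components {R k} L r.
Arguments min_critical_components {R k} L r.

(** * The k-graph Lambda \ H, for H hereditary *)
Section Remove.
Variables (k : nat) (L : kgraph k) (H : {set vtx L}).
Hypothesis hH : hereditary H.

Let V : finType := {v : vtx L | v \notin H}.
Let P : countType := {l : mor L | src l \notin H}.

Lemma rng_notin (l : mor L) : src l \notin H -> rng l \notin H.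
Proof.
apply: contra => rH; move/forallP/(_ (rng l))/forallP/(_ (src l)): hH.
rewrite rH implyTb => /implyP; apply.
by apply/asboolP; exists l; rewrite !inE.
Qed.

Lemma remove_idp_subproof (v : V) : src (idp (val v) : mor L) \notin H.
Proof. by rewrite src_idp; apply: (valP v). Qed.

Definition remove_src (l : P) : V := Sub (src (val l)) (valP l).
Definition remove_rng (l : P) : V := Sub (rng (val l)) (rng_notin (valP l)).
Definition remove_idp (v : V) : P := Sub (idp (val v)) (remove_idp_subproof v).
(* the default value [l] is used only when [l] and [m] are not composable *)
Definition remove_comp (l m : P) : P := insubd l (compose (val l) (val m)).
Definition remove_deg (l : P) := deg (val l).

Lemma remove_composable (l m : P) :
  remove_src l = remove_rng m -> src (val l) = rng (val m).
Proof. by move/(congr1 val). Qed.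

Lemma remove_comp_val (l m : P) :
  remove_src l = remove_rng m ->
  val (remove_comp l m) = compose (val l) (val m).
Proof.
move=> /remove_composable e; rewrite /remove_comp val_insubd src_comp //.
by rewrite (valP m).
Qed.

Lemma remove_srcE (l : P) : val (remove_src l) = src (val l). Proof. by []. Qed.
Lemma remove_rngE (l : P) : val (remove_rng l) = rng (val l). Proof. by []. Qed.

Lemma remove_src_comp l m : remove_src l = remove_rng m ->
  remove_src (remove_comp l m) = remove_src m.
Proof.
move=> e; apply: val_inj; rewrite !remove_srcE remove_comp_val // src_comp //.
exact: remove_composable e.
Qed.

Lemma remove_rng_comp l m : remove_src l = remove_rng m ->
  remove_rng (remove_comp l m) = remove_rng l.
Proof.
move=> e; apply: val_inj; rewrite !remove_rngE remove_comp_val // rng_comp //.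
exact: remove_composable e.
Qed.

Lemma remove_src_idp v : remove_src (remove_idp v) = v.
Proof. by apply: val_inj; rewrite /= src_idp. Qed.

Lemma remove_rng_idp v : remove_rng (remove_idp v) = v.
Proof. by apply: val_inj; rewrite /= rng_idp. Qed.

Lemma remove_comp_idl l : remove_comp (remove_idp (remove_rng l)) l = l.
Proof.
by apply: val_inj; rewrite remove_comp_val ?remove_src_idp //= comp_idl.
Qed.

Lemma remove_comp_idr l : remove_comp l (remove_idp (remove_src l)) = l.
Proof.
by apply: val_inj; rewrite remove_comp_val ?remove_rng_idp //= comp_idr.
Qed.

Lemma remove_compA l m n :
  remove_src l = remove_rng m -> remove_src m = remove_rng n ->
  remove_comp l (remove_comp m n) = remove_comp (remove_comp l m) n.
Proof.
move=> e1 e2; apply: val_inj.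
rewrite !remove_comp_val ?remove_rng_comp ?remove_src_comp //.
by apply: compA; [exact: remove_composable e1|exact: remove_composable e2].
Qed.

Lemma remove_deg_idp v : remove_deg (remove_idp v) = 0.
Proof. exact: deg_idp. Qed.

Lemma remove_deg_comp l m : remove_src l = remove_rng m ->
  remove_deg (remove_comp l m) = remove_deg l + remove_deg m.
Proof.
move=> e; rewrite /remove_deg remove_comp_val // deg_comp //.
exact: remove_composable e.
Qed.

Lemma remove_factorization l m n : remove_deg l = m + n ->
  exists! p : P * P, [/\ remove_deg p.1 = m, remove_deg p.2 = n,
    remove_src p.1 = remove_rng p.2 & l = remove_comp p.1 p.2].
Proof.
move=> /factorization [[a b] [/= [da db sab le] uniq]].
have bH : src b \notin H.
  by rewrite -(src_comp sab) -le; apply: (valP l).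
have aH : src a \notin H by rewrite sab; apply: rng_notin.
exists (exist _ a aH, exist _ b bH); split.
  have e : remove_src (exist _ a aH) = remove_rng (exist _ b bH).
    exact: val_inj.
  by split=> //=; apply: val_inj; rewrite remove_comp_val.
move=> [a' b'] /= [da' db' sab' le'].
have e : (a, b) = (val a', val b').
  apply: uniq; split=> //=; first exact: remove_composable sab'.
  by rewrite le' remove_comp_val.
by case: e => ea eb; congr pair; apply: val_inj.
Qed.

Definition kgraph_remove : kgraph k :=
  KGraph remove_src_idp remove_rng_idp remove_src_comp remove_rng_comp
    remove_comp_idl remove_comp_idr remove_compA remove_deg_idp
    remove_deg_comp remove_factorization.

End Remove.

(** * C*-algebras

   Not necessarily unital; complex scalars are [R[i]], in which the library's
   norms take their (real, nonnegative) values. *)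
HB.mixin Record CompleteNormedModule_isCStarAlgebra (R : realType) A
    of CompleteNormedModule (R[i] : numFieldType) A := {
  amul : A -> A -> A;
  adj : A -> A;
  amulA : forall a b c, amul a (amul b c) = amul (amul a b) c;
  amulDl : forall a b c, amul (a + b) c = amul a c + amul b c;
  amulDr : forall a b c, amul a (b + c) = amul a b + amul a c;
  amulZl : forall (x : R[i]) a b, amul (x *: a) b = x *: amul a b;
  amulZr : forall (x : R[i]) a b, amul a (x *: b) = x *: amul a b;
  adjK : forall a, adj (adj a) = a;
  adjD : forall a b, adj (a + b) = adj a + adj b;
  adjZ : forall (x : R[i]) a, adj (x *: a) = (x^*)%C *: adj a;
  adjM : forall a b, adj (amul a b) = amul (adj b) (adj a);
  norm_amul : forall a b, `|amul a b| <= `|a| * `|b|;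
  norm_cstar : forall a, `|amul (adj a) a| = `|a| ^+ 2
}.

#[short(type="cstarAlgType")]
HB.structure Definition CStarAlgebra (R : realType) :=
  { A of CompleteNormedModule (R[i] : numFieldType) A
       & CompleteNormedModule_isCStarAlgebra R A }.

Declare Scope cstar_scope.
Delimit Scope cstar_scope with A.
Notation "a ** b" := (amul a b)
  (at level 40, left associativity) : cstar_scope.
Notation "a ^#" := (adj a) (at level 2, format "a ^#") : cstar_scope.
Global Open Scope cstar_scope.

Section CStar.
Variable R : realType.

Definition is_star_hom (A B : cstarAlgType R) (f : A -> B) : Prop :=
  [/\ forall a b, f (a + b) = f a + f b,
      forall (x : R[i]) a, f (x *: a) = x *: f a,
      forall a b, f (a ** b) = f a ** f b
    & forall a, f (a^#) = (f a)^#].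

(* [T] generates [A] as a C*-algebra. *)
Definition generates (I : Type) (A : cstarAlgType R) (T : I -> A) : Prop :=
  forall S : set A,
    S 0 -> (forall i, S (T i)) ->
    (forall a b, S a -> S b -> S (a + b)) ->
    (forall (x : R[i]) a, S a -> S (x *: a)) ->
    (forall a b, S a -> S b -> S (a ** b)) ->
    (forall a, S a -> S (a^#)) ->
    closed S ->
    forall a, S a.

Section States.
Variable A : cstarAlgType R.

(* If the set is unbounded its [sup] is [0] by the library's convention, so
   [fnorm phi = 1] does say that [phi] is bounded. *)
Definition fnorm (phi : A -> R[i]) : R :=
  sup [set Normc.normc (phi a) | a in [set a : A | `|a| <= 1]]%classic.

Definition is_state (phi : A -> R[i]) : Prop :=
  [/\ forall a b, phi (a + b) = phi a + phi b,
      forall (x : R[i]) a, phi (x *: a) = x * phi a,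
      forall a, 0 <= phi (a^# ** a)
    & fnorm phi = 1].

Definition is_action (alpha : R -> A -> A) : Prop :=
  [/\ forall t, is_star_hom (alpha t),
      forall a, alpha 0 a = a,
      forall s t a, alpha (s + t) a = alpha s (alpha t a)
    & forall a, continuous (fun t : R => alpha t a)].

(* [F] is an entire function extending [t |-> alpha_t(a)]. *)
Definition analytic_extension (alpha : R -> A -> A) (a : A)
    (F : (R[i] : numFieldType)^o -> A) : Prop :=
  (forall z, derivable F z 1) /\
  (forall t : R, F (t%:C)%C = alpha t a).

Definition analytic (alpha : R -> A -> A) (a : A) : Prop :=
  exists F, analytic_extension alpha a F.

(* [F (beta *i)] is alpha_{i beta}(a). *)
Definition is_KMS_state (alpha : R -> A -> A) (beta : R) (phi : A -> R[i])
    : Prop :=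
  is_state phi /\
  forall a b F, analytic_extension alpha a F -> analytic alpha b ->
    phi (a ** b) = phi (b ** F (0 +i* beta)%C).

End States.

(** * Toeplitz algebras of k-graphs *)
Section Toeplitz.
Variables (k : nat) (L : kgraph k).

Definition is_TCK_family (A : cstarAlgType R) (T : mor L -> A) : Prop :=
  [/\ forall l, T l ** (T l)^# ** T l = T l,
      [/\ forall v, (T (idp v))^# = T (idp v),
          forall v, T (idp v) ** T (idp v) = T (idp v)
        & forall v w, v != w -> T (idp v) ** T (idp w) = 0],
      forall l m, src l = rng m -> T l ** T m = T (compose l m)
    & forall l m, (T l)^# ** T m =
        \sum_(p \in Lmin l m) (T p.1 ** (T p.2)^#)].

(* [A] with the family [t] is the Toeplitz algebra TC*(L). *)
Definition is_toeplitz_algebra (A : cstarAlgType R) (t : mor L -> A) : Prop :=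
  [/\ is_TCK_family t,
      generates t
    & forall (B : cstarAlgType R) (T : mor L -> B), is_TCK_family T ->
        exists pi : A -> B, is_star_hom pi /\ forall l, pi (t l) = T l].

(* [alpha] is the dynamics alpha^r on TC*(L). *)
Definition is_toeplitz_dynamics (A : cstarAlgType R) (t : mor L -> A)
    (r : 'I_k -> R) (alpha : R -> A -> A) : Prop :=
  is_action alpha /\
  forall s l, let x := s * \sum_i r i * (deg l i)%:R in
    alpha s (t l) = (cos x +i* sin x)%C *: t l.

End Toeplitz.

(* [q] is the surjection q_H from TC*(L) onto TC*(L \ H). *)
Definition is_toeplitz_quotient (k : nat) (L : kgraph k) (H : {set vtx L})
    (hH : hereditary H) (A B : cstarAlgType R) (t : mor L -> A)
    (u : mor (kgraph_remove hH) -> B) (q : A -> B) : Prop :=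
  [/\ is_star_hom q,
      forall b, exists a, q a = b,
      forall l : mor (kgraph_remove hH), q (t (val l)) = u l
    & forall l : mor L, src l \in H -> q (t l) = 0].

End CStar.

(* Main.v *)
(* Let m_v = phi(q_v) for a KMS_1 state phi. The KMS condition gives
   phi(t_l t_l^* ) = exp(- r.d(l)) m_{s(l)}, whence A_i m <= exp(r_i) m for each
   colour i. On a critical component C with index j, A_{C,j} is irreducible of
   spectral radius exp(r_j), so the restriction of m to C satisfies this with
   equality, and m vanishes at the sources outside C of the edges of colour j
   with range in C; by the linking hypothesis it then vanishes on everything
   reached from C outside C, in particular on H.

   The ideal I generated by the q_v, v in H, has an approximate unit of
   projections, the complements of products of projections 1 - t_l t_l^* with
   s(l) in H. This makes A / I a C*-algebra without any functional calculus,
   and the universal property of TC*(L \ H) maps it to A / I, so ker q is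
   contained in I, on which phi vanishes. Hence phi = psi o q.

   That psi satisfies the KMS condition for all analytic a, which need not lift
   to analytic elements, is obtained from homogeneous elements
   h = u_l u_m^* of frequency x: z |-> exp(i x z) psi(F(z) h) is entire and, by
   invariance of psi, constant on the real line, so its values at 0 and i agree
   by the identity theorem. *)
From HB Require Import structures.
Require Import Defs.
From mathcomp Require Import ring lra.
Set Implicit Arguments.
Unset Strict Implicit.
Unset Printing Implicit Defensive.
Local Open Scope classical_set_scope.

(** * C*-algebras, star-homomorphisms and states *)

(** A minimal critical component never reaches another one, so the paths out of it end in it or in
    $H$. Removing a hereditary set, or restricting to a set that is hereditary in what remains, cuts
    a diagonal block out of a block triangular matrix. Hence
    $\rho(A_{C,j})\le\rho(A_{\Lambda\setminus H,j})\le\rho(A_j)$, and criticality squeezes this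
    chain. In (3), equality on $C$ is known for the colour $j$ only, while a path may leave $C$
    through an edge of another colour; the linking hypothesis deals with this. Finiteness of
    $\Lambda^0$ makes the Toeplitz algebras unital, so that boundedness of positive functionals and
    of star-homomorphisms both follow from one square root, that of $1-x$ with $x$ self-adjoint and
    $\|x\|<1$. The KMS identity is linear and continuous in $b$, so it may be tested on the
    $t_\lambda t_\mu^*$; in $a$ it cannot be extended by density, as $\alpha_i$ is in general
    unbounded. This is why an argument about entire functions is needed. *)

Section CStarBasics.
Variables (R : realType) (A : cstarAlgType R).
Implicit Types a b c : A.

Lemma amul0l a : 0 ** a = 0.
Proof. by have := amulZl (0 : R[i]) (0:A) a; rewrite !scale0r. Qed.

Lemma amul0r a : a ** 0 = 0.
Proof. by have := amulZr (0 : R[i]) a (0:A); rewrite !scale0r. Qed.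

Lemma amulNl a b : (- a) ** b = - (a ** b).
Proof. by rewrite -scaleN1r amulZl scaleN1r. Qed.

Lemma amulNr a b : a ** (- b) = - (a ** b).
Proof. by rewrite -scaleN1r amulZr scaleN1r. Qed.

Lemma amulBl a b c : (a - b) ** c = a ** c - b ** c.
Proof. by rewrite amulDl amulNl. Qed.

Lemma amulBr a b c : a ** (b - c) = a ** b - a ** c.
Proof. by rewrite amulDr amulNr. Qed.

Lemma adj0 : (0 : A)^# = 0.
Proof. by have := adjZ (0 : R[i]) (0:A); rewrite rmorph0 !scale0r. Qed.

Lemma adjN a : (- a)^# = - a^#.
Proof. by rewrite -scaleN1r adjZ rmorphN rmorph1 scaleN1r. Qed.

Lemma adjB a b : (a - b)^# = a^# - b^#.
Proof. by rewrite adjD adjN. Qed.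

Lemma norm_adj_le a : `|a| <= `|a^#|.
Proof.
have [->|a0] := eqVneq a 0; first by rewrite normr0 normr_ge0.
have := norm_amul a^# a; rewrite norm_cstar expr2 ler_pM2r //.
by rewrite normr_gt0.
Qed.

Lemma norm_adj a : `|a^#| = `|a|.
Proof. by apply/eqP; rewrite eq_le norm_adj_le -{2}[a]adjK norm_adj_le. Qed.

Lemma adj_sum (I : Type) (s : seq I) (P : pred I) (F : I -> A) :
  (\sum_(i <- s | P i) F i)^# = \sum_(i <- s | P i) (F i)^#.
Proof. by apply: (big_morph adj adjD adj0). Qed.

Lemma amul_suml (I : Type) (s : seq I) (P : pred I) (F : I -> A) a :
  (\sum_(i <- s | P i) F i) ** a = \sum_(i <- s | P i) (F i ** a).
Proof.
by apply: (big_morph (fun x => x ** a)) => [x y|]; rewrite ?amulDl ?amul0l.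
Qed.

Lemma amul_sumr (I : Type) (s : seq I) (P : pred I) (F : I -> A) a :
  a ** (\sum_(i <- s | P i) F i) = \sum_(i <- s | P i) (a ** F i).
Proof.
by apply: (big_morph (fun x => a ** x)) => [x y|]; rewrite ?amulDr ?amul0r.
Qed.

Lemma norm_proj_le1 (p : A) : p^# = p -> p ** p = p -> `|p| <= 1.
Proof.
move=> ps pp; have := norm_cstar p; rewrite ps pp expr2.
have [-> _|p0] := eqVneq `|p| 0; first exact: ler01.
move/eqP; rewrite -{1}[ `|p| ]mulr1 => /eqP /(mulfI p0) <-.
by [].
Qed.

End CStarBasics.

Section BoundedContinuous.
Variables (K : numFieldType) (V W : normedModType K).

Lemma lipschitz_continuous (f : V -> W) (M : K) :
  (forall x y, `|f x - f y| <= M * `|x - y|) -> continuous f.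
Proof.
move=> fM x; apply/cvgrPdist_lt => e e0.
have M0 : 0 <= `|M| by [].
near=> y.
apply: (le_lt_trans (fM x y)).
(* [K] may be the complex numbers, where [M] need not be comparable with its modulus; for [x != y]
   the hypothesis itself makes [M] nonnegative. *)
apply: (@le_lt_trans _ _ ((`|M| + 1) * `|x - y|)).
  have [->|xy] := eqVneq (`|x - y|) 0; first by rewrite !mulr0.
  have xy0 : 0 < `|x - y| by rewrite lt_def xy normr_ge0.
  have : 0 <= M * `|x - y| by apply: le_trans (fM x y).
  rewrite pmulr_lge0 // => M0'.
  by rewrite ler_pM2r // ger0_norm // lerDl ler01.
rewrite -ltr_pdivlMl ?ltr_wpDl //.
near: y; apply: cvgr_dist_lt; rewrite // mulr_gt0 ?invr_gt0 ?ltr_wpDl //.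
Unshelve. all: by end_near. Qed.

End BoundedContinuous.

Section CStarContinuity.
Variables (R : realType) (A : cstarAlgType R).
Implicit Types a b c : A.

Lemma amull_continuous c : continuous (fun a => c ** a).
Proof.
apply: (@lipschitz_continuous _ _ _ _ `|c|) => x y.
by rewrite -amulBr norm_amul.
Qed.

Lemma amulr_continuous c : continuous (fun a => a ** c).
Proof.
apply: (@lipschitz_continuous _ _ _ _ `|c|) => x y.
by rewrite -amulBl mulrC norm_amul.
Qed.

Lemma adj_continuous : continuous (@adj R A).
Proof.
apply: (@lipschitz_continuous _ _ _ _ 1) => x y.
by rewrite -adjB norm_adj mul1r.
Qed.

End CStarContinuity.

Section RealNorm.
Variables (R : realType).

Lemma complex_gt0P (e : R[i]) : 0 < e -> exists2 d : R, 0 < d & e = (d%:C)%C.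
Proof.
case: e => a b; rewrite ltcE /= => /andP[/eqP -> a0]; exists a => //.
Qed.

Lemma complex_ge0P (e : R[i]) : 0 <= e -> exists2 d : R, 0 <= d & e = (d%:C)%C.
Proof.
case: e => a b; rewrite lecE /= => /andP[/eqP -> a0]; exists a => //.
Qed.

Variable (V : normedModType R[i]).
Implicit Types a b : V.

(** Norms here are complex numbers; their real parts live in a totally ordered field, where [lra]
    and [nra] apply. *)
Definition rnorm a : R := complex.Re `|a|.

Lemma rnormE a : `|a| = ((rnorm a)%:C)%C.
Proof. by rewrite RRe_real // normr_real. Qed.

Lemma rnorm_ge0 a : 0 <= rnorm a.
Proof. by rewrite -lecR -rnormE normr_ge0. Qed.

Lemma rnormD a b : rnorm (a + b) <= rnorm a + rnorm b.
Proof. by rewrite -lecR rmorphD /= -!rnormE ler_normD. Qed.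

Lemma rdistC a b : rnorm (a - b) = rnorm (b - a).
Proof. by rewrite /rnorm distrC. Qed.

Lemma rnormZ (x : R[i]) a : rnorm (x *: a) = Normc.normc x * rnorm a.
Proof. by apply: complexI; rewrite -rnormE normrZ rmorphM /= -rnormE;
  case: x. Qed.

Lemma rnorm0 : rnorm (0 : V) = 0.
Proof. by rewrite /rnorm normr0. Qed.

Lemma rnorm0_eq0 a : rnorm a = 0 -> a = 0.
Proof. by move=> a0; apply/eqP; rewrite -normr_eq0 rnormE a0. Qed.

Lemma rcvgP (u : nat -> V) l : (u @ \oo --> l) <->
  (forall e : R, 0 < e -> exists N, forall n, (N <= n)%N ->
    rnorm (l - u n) < e).
Proof.
split=> [/cvgrPdist_lt ul e e0|ul].
  have e0' : 0 < (e%:C)%C by rewrite ltcR.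
  have [N _ NP] := ul _ e0'; exists N => n Nn.
  by have := NP n Nn; rewrite /= rnormE ltcR.
apply/cvgrPdist_lt => e /complex_gt0P[d d0 ->].
have [N NP] := ul _ d0; exists N => // n Nn /=.
by rewrite rnormE ltcR; exact: NP.
Qed.

Lemma rnorm_eq0_le a : (forall e : R, 0 < e -> rnorm a <= e) -> a = 0.
Proof.
move=> H; apply: rnorm0_eq0; apply/eqP; rewrite eq_le rnorm_ge0 andbT.
by apply/ler_addgt0Pr => e e0; rewrite add0r H.
Qed.

Lemma exprn_lt_eventually (c e : R) : 0 <= c -> c < 1 -> 0 < e ->
  exists N, forall n, (N <= n)%N -> c ^+ n < e.
Proof.
move=> c0 c1 e0.
have : (fun n => c ^+ n) @ \oo --> (0 : R).
  by apply: cvg_expr; rewrite ger0_norm.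
move=> /cvgrPdist_lt /(_ e e0) [N _ NP]; exists N => n Nn.
by have := NP n Nn; rewrite /= sub0r normrN ger0_norm // exprn_ge0.
Qed.

End RealNorm.

Section Complete.
Variables (R : realType) (V : completeNormedModType R[i]).

Lemma geometric_cauchy (u : nat -> V) (c M : R) : 0 <= c -> c < 1 ->
  (forall n, rnorm (u n.+1 - u n) <= M * c ^+ n) ->
  forall n m, (n <= m)%N -> rnorm (u m - u n) <= M / (1 - c) * c ^+ n.
Proof.
move=> c0 c1 uM.
have M0 : 0 <= M.
  by have := uM 0%N; rewrite expr0 mulr1; apply: le_trans; rewrite rnorm_ge0.
have c1' : 0 < 1 - c by rewrite subr_gt0.
(* Keeping the subtracted [c ^+ (n + k)] makes the induction close: each step adds exactly one term
   of the geometric sum. *)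
have H n k : rnorm (u (n + k)%N - u n) <= M / (1 - c) * (c ^+ n - c ^+ (n + k)).
  elim: k => [|k IH]; first by rewrite addn0 !subrr rnorm0 mulr0.
  rewrite addnS -(subrK (u (n + k)%N) (u (n + k).+1)) -addrA.
  apply: (le_trans (rnormD _ _)).
  apply: (le_trans (lerD (uM _) IH)).
  rewrite exprS.
  have -> : M * c ^+ (n + k) = M / (1 - c) * ((1 - c) * c ^+ (n + k)).
    by field; rewrite gt_eqF.
  by rewrite -mulrDr le_eqVlt; apply/orP; left; apply/eqP; congr (_ * _); ring.
move=> n m nm; rewrite -(subnKC nm); apply: (le_trans (H _ _)).
apply: ler_wpM2l; first by apply: divr_ge0 => //; exact: ltW.
by rewrite lerBlDr lerDl exprn_ge0.
Qed.

Lemma geometric_cvg (u : nat -> V) (c M : R) : 0 <= c -> c < 1 ->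
  (forall n, rnorm (u n.+1 - u n) <= M * c ^+ n) ->
  exists l : V, u @ \oo --> l.
Proof.
move=> c0 c1 uM.
suff : cvg (u @ \oo) by move=> /cvg_ex[l ul]; exists l.
apply: cauchy_cvg; apply: cauchy_exP => e /complex_gt0P[d d0 ->].
set K := M / (1 - c).
have K0 : 0 < `|K| + 1 by rewrite ltr_wpDl.
have [N NP] := exprn_lt_eventually c0 c1 (divr_gt0 d0 K0).
exists (u N), N => // n /= Nn.
rewrite -ball_normE /= rnormE ltcR rdistC.
apply: (le_lt_trans (geometric_cauchy c0 c1 uM Nn)).
apply: (@le_lt_trans _ _ ((`|K| + 1) * c ^+ N)).
  by rewrite ler_wpM2r ?exprn_ge0 // (le_trans (ler_norm K)) // lerDl.
by rewrite mulrC -ltr_pdivlMr // NP.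
Qed.

End Complete.

Lemma closed_equalizer (K : numFieldType) (V : topologicalType)
    (W : normedModType K) (f g : V -> W) :
  continuous f -> continuous g -> closed [set x | f x = g x].
Proof.
move=> cf cg.
have -> : [set x | f x = g x] = (fun x => f x - g x) @^-1` [set 0].
  by apply/seteqP; split=> x /=; [move->; rewrite subrr|move/eqP;
    rewrite subr_eq0 => /eqP].
apply: closed_comp.
  by move=> x _; apply: continuousB; [exact: cf|exact: cg].
by apply: accessible_closed_set1; apply: hausdorff_accessible;
  exact: norm_hausdorff.
Qed.

Section Sqrt.
Variables (R : realType) (A : cstarAlgType R).
Implicit Types a b c h x y : A.

Lemma rnormM a b : rnorm (a ** b) <= rnorm a * rnorm b.
Proof. by rewrite -lecR rmorphM /= -!rnormE norm_amul. Qed.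

Lemma rnorm_cstar a : rnorm (a^# ** a) = rnorm a ^+ 2.
Proof. by apply: complexI; rewrite rmorphXn /= -!rnormE norm_cstar. Qed.

Lemma rnorm_adj a : rnorm a^# = rnorm a.
Proof. by rewrite /rnorm norm_adj. Qed.

Lemma rnorm_half a : rnorm (2^-1 *: a) = 2^-1 * rnorm a.
Proof.
rewrite rnormZ; congr (_ * _).
have -> : (2^-1 : R[i]) = ((2^-1 : R)%:C)%C by rewrite fmorphV rmorph_nat.
by rewrite /= expr0n /= addr0 sqrtr_sqr ger0_norm // invr_ge0.
Qed.

Definition sqrt_step x y : A := 2^-1 *: (x + y ** y).

(* [y] is [1 - sqrt (1 - x)]: the contraction [sqrt_step x] maps the ball of
   radius [c] to itself, as [(c + c ^ 2) / 2 <= c]. *)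
Lemma sqrt_fixpoint x (c : R) : c < 1 -> rnorm x <= c -> x^# = x ->
  exists y, [/\ y^# = y, y ** y = 2 *: y - x &
    forall h, h ** x = x ** h -> h ** y = y ** h].
Proof.
move=> c1 xc xs.
have c0 : 0 <= c := le_trans (rnorm_ge0 x) xc.
pose u n := iter n (sqrt_step x) 0.
have uc n : rnorm (u n) <= c.
  elim: n => [|n IH]; first by rewrite rnorm0.
  rewrite /= rnorm_half; apply: (@le_trans _ _ (2^-1 * (c + c ^+ 2)));
    last by nra.
  rewrite ler_wpM2l ?invr_ge0 //; apply: (le_trans (rnormD _ _));
    apply: lerD => //.
  apply: (le_trans (rnormM _ _)); rewrite expr2.
  by apply: ler_pM => //; exact: rnorm_ge0.
have step a b : rnorm a <= c -> rnorm b <= c ->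
    rnorm (sqrt_step x a - sqrt_step x b) <= c * rnorm (a - b).
  move=> ac bc; rewrite /sqrt_step -scalerBr rnorm_half.
  have -> : x + a ** a - (x + b ** b) = a ** (a - b) + (a - b) ** b.
    by rewrite opprD addrACA subrr add0r amulBr amulBl addrA subrK.
  have := rnormD (a ** (a - b)) ((a - b) ** b).
  have := rnormM a (a - b); have := rnormM (a - b) b.
  have := rnorm_ge0 (a - b); nra.
have [y uy] : exists y : A, u @ \oo --> y.
  apply: (@geometric_cvg _ _ u c (rnorm (u 1%N - u 0%N)) c0 c1).
  elim=> [|n IH]; first by rewrite expr0 mulr1.
  apply: (le_trans (step _ _ (uc n.+1) (uc n))).
  by rewrite exprS mulrCA ler_wpM2l.
have yc : rnorm y <= c.
  apply/ler_addgt0Pr => e e0;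
    move/rcvgP : uy => /(_ e e0)[N /(_ N (leqnn N)) yN].
  rewrite -(subrK (u N) y) addrC; apply: (le_trans (rnormD _ _)).
  by apply: lerD => //; apply: ltW.
have yfix : y = sqrt_step x y.
  apply/eqP; rewrite -subr_eq0; apply/eqP; apply: rnorm_eq0_le => e e0.
  have e20 : 0 < e / 2 by lra.
  move/rcvgP : uy => /(_ _ e20)[N yN].
  have h0 := rnormD (y - u N.+1) (u N.+1 - sqrt_step x y).
  rewrite subrKA in h0.
  have h1 := yN _ (leqnSn N); have h2 := yN _ (leqnn N).
  have h3 : rnorm (u N.+1 - sqrt_step x y) <= c * rnorm (y - u N).
    by rewrite (rdistC y); exact: step.
  have h4 := rnorm_ge0 (y - u N).
  have h5 : c * rnorm (y - u N) <= rnorm (y - u N) by rewrite ler_piMl // ltW.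
  lra.
(* The iterates from [0] are self-adjoint and commute with whatever commutes with [x]; both
   conditions are closed and pass to the limit. *)
have lim (f g : A -> A) : continuous f -> continuous g ->
    (forall n, f (u n) = g (u n)) -> f y = g y.
  move=> cf cg fg.
  apply: (closed_cvg (fun z => f z = g z) (closed_equalizer cf cg) _ y uy).
  by exists 0%N => // n _ /=.
exists y; split.
- apply: (lim _ id); [exact: adj_continuous|by move=> z|].
  elim=> [|n IH]; first by rewrite adj0.
  rewrite /= /sqrt_step adjZ adjD adjM IH xs; congr (_ *: _).
  have -> : (2^-1 : R[i]) = ((2^-1 : R)%:C)%C by rewrite fmorphV rmorph_nat.
  by rewrite conjc_real.
- rewrite {3}yfix /sqrt_step scalerA divff ?scale1r;
  first by rewrite addrC addKr.
  by rewrite pnatr_eq0.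
- move=> h hx.
  apply: (lim (fun z => h ** z) (fun z => z ** h)).
  + exact: amull_continuous.
  + exact: amulr_continuous.
  elim=> [|n IH]; first by rewrite amul0l amul0r.
  rewrite /= /sqrt_step amulZr amulZl amulDr amulDl hx; congr (_ *: (_ + _)).
  by rewrite amulA IH -amulA IH amulA.
Qed.

End Sqrt.

Definition is_unit_elt (R : realType) (A : cstarAlgType R) (e : A) : Prop :=
  forall a, e ** a = a /\ a ** e = a.

Section Unital.
Variables (R : realType) (A : cstarAlgType R) (e : A).
Hypothesis e1 : is_unit_elt e.
Implicit Types a b h x y : A.

Lemma unit_adj : e^# = e.
Proof.
have h := (e1 e^#).2; rewrite -h.
by have := congr1 (@adj R A) h; rewrite adjM adjK.
Qed.

Lemma rnorm_unit_le1 : rnorm e <= 1.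
Proof. by rewrite -lecR -rnormE; apply: norm_proj_le1;
  [exact: unit_adj|exact: (e1 e).1]. Qed.

Lemma sqrt_one_minus x : x^# = x -> rnorm x < 1 ->
  exists k, [/\ k^# = k, k ** k = e - x &
    forall h, h ** x = x ** h -> h ** k = k ** h].
Proof.
move=> xs x1; have [y [ys yy yc]] := sqrt_fixpoint x1 (lexx _) xs.
exists (e - y); split.
- by rewrite adjB ys unit_adj.
- rewrite amulBl !amulBr (e1 e).1 (e1 y).1 (e1 y).2 yy.
  by rewrite scaler_nat mulr2n opprB (addrAC _ (- x)) addrK subrKA.
- by move=> h hx; rewrite amulBl amulBr (e1 h).1 (e1 h).2 yc.
Qed.

Variables (B : cstarAlgType R) (f : A -> B).
Hypothesis fhom : is_star_hom f.

Let fD a b : f (a + b) = f a + f b. Proof. by case: fhom. Qed.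
Let fZ (x : R[i]) a : f (x *: a) = x *: f a. Proof. by case: fhom. Qed.
Let fM a b : f (a ** b) = f a ** f b. Proof. by case: fhom. Qed.
Let fA a : f (a^#) = (f a)^#. Proof. by case: fhom. Qed.

(* [h + i sqrt (1 - h ^ 2)] is unitary, and [h] is its real part. *)
Lemma starhom_selfadj_le1 h : h^# = h -> rnorm h < 1 -> rnorm (f h) <= 1.
Proof.
move=> hs h1.
have xs : (h ** h)^# = h ** h by rewrite adjM hs.
have x1 : rnorm (h ** h) < 1.
  rewrite -{1}hs rnorm_cstar; have := rnorm_ge0 h; nra.
have [k [ks kk kc]] := sqrt_one_minus xs x1.
have hk : h ** k = k ** h by apply: kc; rewrite amulA.
pose u := h + 'i%C *: k.
have us : u^# = h - 'i%C *: k.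
  rewrite /u adjD adjZ hs ks -scaleNr; congr (_ + _ *: _).
  by simpc.
have uu : u^# ** u = e.
  rewrite us /u amulBl !amulDr !amulZl !amulZr hk scalerA.
  rewrite -expr2 sqr_i scaleN1r kk opprD opprK.
  by rewrite addrA addrK addrC subrK.
have fu : rnorm (f u) <= 1.
  rewrite -(@ler_pXn2r _ 2) ?nnegrE ?rnorm_ge0 // expr1n -rnorm_cstar -fA -fM
    uu.
  rewrite -lecR -rnormE norm_proj_le1 // -?fA -?fM ?unit_adj //.
  by rewrite (e1 e).1.
have -> : f h = 2^-1 *: (f u + (f u)^#).
  rewrite -fA -fD us /u addrACA subrr addr0 -mulr2n -[h *+ 2]scaler_nat fZ
    scalerA.
  by rewrite mulVf ?scale1r // pnatr_eq0.
rewrite rnorm_half; have := rnormD (f u) (f u)^#; rewrite rnorm_adj; lra.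
Qed.

(** Rescaling reduces self-adjoint elements to norm below 1, the margin [d] covering also norm 0.
    The general case is the self-adjoint one for [a^# ** a], by the C*-identity in both algebras. *)
Lemma starhom_contractive a : rnorm (f a) <= rnorm a.
Proof.
have sa h : h^# = h -> rnorm (f h) <= rnorm h.
  move=> hs; apply/ler_addgt0Pr => d d0.
  set M := rnorm h + d.
  have M0 : 0 < M by apply: ltr_wpDl; rewrite ?rnorm_ge0.
  pose h' := ((M^-1)%:C)%C *: h.
  have nM (V : cstarAlgType R) (v : V) : rnorm (((M^-1)%:C)%C *: v) =
    M^-1 * rnorm v.
    by rewrite rnormZ /= expr0n /= addr0 sqrtr_sqr ger0_norm // invr_ge0 ltW.
  have : rnorm (f h') <= 1.
    apply: starhom_selfadj_le1; first by rewrite /h' adjZ hs conjc_real.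
    by rewrite nM mulrC ltr_pdivrMr // mul1r ltrDl.
  by rewrite /h' fZ nM mulrC ler_pdivrMr // mul1r.
rewrite -(@ler_pXn2r _ 2) ?nnegrE ?rnorm_ge0 // -!rnorm_cstar -fA -fM.
by apply: sa; rewrite adjM adjK.
Qed.

Lemma starhom_continuous : continuous f.
Proof.
apply: (@lipschitz_continuous _ _ _ _ 1) => x y; rewrite mul1r.
have -> : f x - f y = f (x - y) by rewrite -[- f y]scaleN1r -fZ -fD scaleN1r.
by rewrite !rnormE lecR starhom_contractive.
Qed.

End Unital.

Section PositiveFunctional.
Variables (R : realType) (A : cstarAlgType R) (phi : A -> R[i]).
Hypothesis phiD : forall a b, phi (a + b) = phi a + phi b.
Hypothesis phiZ : forall (x : R[i]) a, phi (x *: a) = x * phi a.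
Hypothesis phi_ge0 : forall a, 0 <= phi (a^# ** a).
Implicit Types a b h x y p : A.

Lemma functionalN a : phi (- a) = - phi a.
Proof. by rewrite -scaleN1r phiZ mulN1r. Qed.

Lemma functionalB a b : phi (a - b) = phi a - phi b.
Proof. by rewrite phiD functionalN. Qed.

Lemma functional0 : phi 0 = 0.
Proof. by have := phiZ 0 0; rewrite scale0r mul0r. Qed.

(* Degenerate Cauchy-Schwarz: [phi ((p + s x^#)^# (p + s x^#)) >= 0] has no
   constant term in [s], so its linear part vanishes for real and imaginary
   [s]. *)
Lemma functional_null_proj p x : p^# = p -> p ** p = p -> phi p = 0 ->
  phi (x ** p) = 0.
Proof.
move=> ps pp p0.
set M := phi (x ** x^#); set c := phi (x ** p); set d := phi (p ** x^#).
have key (s : R[i]) : 0 <= s * s^*%C * M + s^*%C * c + s * d.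
  have := phi_ge0 (p + s *: x^#).
  rewrite adjD adjZ adjK ps amulDl !amulDr !amulZl !amulZr pp !phiD !phiZ p0.
  by rewrite add0r -/M -/c -/d [X in _ <= X](_ : _ =
    s * s^*%C * M + s^*%C * c + s * d) //; ring.
have M0 : 0 <= M by have := phi_ge0 x^#; rewrite adjK.
have [m m0 Mm] := complex_ge0P M0.
have lin (w : R[i]) : (forall t : R,
  0 <= ((t ^+ 2 * m)%:C)%C + (t%:C)%C * w) -> w = 0.
  case: w => a b H.
  have b0 : b = 0.
    by have := H 1; rewrite lecE /= => /andP[/eqP + _]; lra.
  have H' t : 0 <= t ^+ 2 * m + t * a.
    have := H t; rewrite b0 lecE /= => /andP[_].
    by rewrite ?(mulr0, mul0r, subr0, oppr0, addr0).
  have a0 : a = 0; last by rewrite b0 a0.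
  have [//|a0] := eqVneq a 0.
  have m1 : 0 < m + 1 by lra.
  (* At this point the quadratic takes the negative value [- a ^+ 2 / (m + 1) ^+ 2]; the [+ 1]
     allows for [m = 0]. *)
  have := H' (- a / (m + 1)).
  have -> : (- a / (m + 1)) ^+ 2 * m + - a / (m + 1) * a =
    - (a ^+ 2 / (m + 1) ^+ 2).
    by field; rewrite gt_eqF.
  have a20 : 0 < a ^+ 2 by rewrite lt_def sqrf_eq0 a0 sqr_ge0.
  by rewrite oppr_ge0 leNgt divr_gt0 // exprn_gt0.
have cd : c + d = 0.
  apply: lin => t; have := key (t%:C)%C.
  rewrite conjc_real Mm rmorphM rmorphXn /= => /le_trans; apply.
  rewrite le_eqVlt; apply/orP; left; apply/eqP; ring.
have dc : 'i%C * (d - c) = 0.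
  apply: lin => t; have := key ((t%:C)%C * 'i%C).
  have -> : (((t%:C)%C * 'i%C) : R[i])^*%C = (t%:C)%C * - 'i%C by simpc.
  rewrite Mm.
  rewrite rmorphM rmorphXn /=.
  have -> : ((t%:C)%C * 'i%C * ((t%:C)%C * - 'i%C) : R[i]) =
    - (((t%:C)%C)^+2 * ('i%C ^+ 2)) by ring.
  rewrite sqr_i mulrN1 opprK => /le_trans; apply.
  rewrite le_eqVlt; apply/orP; left; apply/eqP; ring.
have i0 : ('i%C : R[i]) != 0 by rewrite eq_complex /= oner_eq0 andbF.
move/eqP : dc; rewrite mulf_eq0 (negPf i0) /= subr_eq0 => /eqP dc.
by move/eqP : cd; rewrite dc -mulr2n mulrn_eq0 /= => /eqP.
Qed.

Variable e : A.
Hypothesis e1 : is_unit_elt e.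

Lemma functional_unit_ge0 : 0 <= phi e.
Proof. by have := phi_ge0 e; rewrite (unit_adj e1) (e1 e).1. Qed.

(** If [rnorm g < 1], then [e - g] is the square of a self-adjoint element, so [phi g] is real and
    at most [phi e]. Apply this to [h / t] for [t > rnorm h] and let [t] decrease to [rnorm h]. *)
Lemma functional_selfadj h : h^# = h ->
  complex.Im (phi h) = 0 /\ complex.Re (phi h) <= complex.Re (phi e) * rnorm h.
Proof.
move=> hs; have [m m0 Em] := complex_ge0P functional_unit_ge0.
have H1 g : g^# = g -> rnorm g < 1 ->
  complex.Im (phi g) = 0 /\ complex.Re (phi g) <= m.
  move=> gs g1; have [k [ks kk _]] := sqrt_one_minus e1 gs g1.
  have := phi_ge0 k; rewrite ks kk functionalB Em subr_ge0 lecE /=.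
  by move=> /andP[/eqP <-].
have H2 (t : R) : 0 < t -> rnorm h < t ->
  complex.Im (phi h) = 0 /\ complex.Re (phi h) <= m * t.
  move=> t0 ht.
  have [||] := H1 (((t^-1)%:C)%C *: h).
  - by rewrite adjZ hs conjc_real.
  - rewrite rnormZ /= expr0n /= addr0 sqrtr_sqr ger0_norm ?invr_ge0 1?ltW //.
    by rewrite mulrC ltr_pdivrMr // mul1r.
  rewrite phiZ; case: (phi h) => a b /=.
  rewrite !mul0r subr0 addr0 => /eqP;
    rewrite mulf_eq0 invr_eq0 gt_eqF //= => /eqP b0.
  by rewrite mulrC ler_pdivrMr.
rewrite Em /=; split.
  by have [||] := H2 (rnorm h + 1) => //; have := rnorm_ge0 h; lra.
apply/ler_addgt0Pr => d d0.
have m1 : 0 < m + 1 by lra.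
have [||_] := H2 (rnorm h + d / (m + 1)).
- by apply: ltr_wpDl; rewrite ?rnorm_ge0 // divr_gt0.
- by rewrite ltrDl divr_gt0.
move/le_trans; apply; rewrite mulrDr lerD2l.
by rewrite mulrCA -{2}[d]mulr1 ler_wpM2l ?(ltW d0) // ler_pdivrMr // mul1r; lra.
Qed.

(** A scalar [s] of modulus 1 makes [phi (s *: a)] equal to the modulus of [phi a]. As [phi] is real
    on self-adjoint elements, this value comes from the self-adjoint part of [s *: a] alone, whose
    norm is at most that of [a]. *)
Lemma functional_bound a : Normc.normc (phi a) <= complex.Re (phi e) * rnorm a.
Proof.
have m0 : 0 <= complex.Re (phi e).
  by have [m m0 ->] := complex_ge0P functional_unit_ge0.
have [->|z0] := eqVneq (phi a) 0.
  by rewrite Normc.normc0 mulr_ge0 // rnorm_ge0.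
set z := phi a; set n := Normc.normc z.
have nz : `|z| = (n%:C)%C by rewrite /n; case: (z).
have n0 : n != 0 by apply: contra_neq z0 => /Normc.eq0_normc.
have ngt0 : 0 < n by rewrite lt_def n0 -lecR -nz normr_ge0.
pose s : R[i] := z^*%C * ((n^-1)%:C)%C.
have ns : Normc.normc s = 1.
  rewrite /s Normc.normcM.
  have -> : Normc.normc z^*%C = n by rewrite /n; case: (z) => u v /=;
    rewrite sqrrN.
  by rewrite /= expr0n /= addr0 sqrtr_sqr ger0_norm ?mulfV // invr_ge0 ltW.
pose b := s *: a.
have pb : phi b = (n%:C)%C.
  rewrite phiZ /s -/z mulrAC (mulrC _ z) -sqr_normc nz -rmorphXn -rmorphM /=.
  by congr (_%:C)%C; rewrite expr2 -mulrA mulfV // mulr1.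
have nb : rnorm b = rnorm a by rewrite rnormZ ns mul1r.
have half : (2^-1 : R[i]) = ((2^-1 : R)%:C)%C by rewrite fmorphV rmorph_nat.
pose h := (2^-1 : R[i]) *: (b + b^#).
pose g := ((2^-1 : R[i]) * - 'i%C) *: (b - b^#).
have hs : h^# = h by rewrite /h adjZ adjD adjK half conjc_real addrC.
have gs : g^# = g.
  rewrite /g adjZ adjB adjK half.
  have -> : (((2^-1 : R)%:C)%C * - 'i%C : R[i])^*%C = ((2^-1 : R)%:C)%C * 'i%C.
    by apply/eqP; rewrite eq_complex /=; apply/andP; split; apply/eqP; ring.
  by rewrite -opprB scalerN -scaleNr mulrN.
have bE : b = h + 'i%C *: g.
  rewrite /h /g scalerA mulrCA mulrN -expr2 sqr_i opprK mulr1 -scalerDr.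
  by rewrite addrACA subrr addr0 -mulr2n -[b *+ 2]scaler_nat scalerA mulVf
    ?scale1r // pnatr_eq0.
have [hi hr] := functional_selfadj hs; have [gi _] := functional_selfadj gs.
have nh : rnorm h <= rnorm a.
  rewrite /h rnorm_half; have := rnormD b b^#; rewrite rnorm_adj nb; lra.
have -> : n = complex.Re (phi h).
  have := pb; rewrite bE phiD phiZ.
  case: (phi h) hi => a1 b1 /= ->; case: (phi g) gi => a2 b2 /= -> [].
  by rewrite mul0r mulr0 subr0 addr0 => <-.
by apply: (le_trans hr); rewrite ler_wpM2l.
Qed.

End PositiveFunctional.

Section States.
Variables (R : realType) (A : cstarAlgType R) (e : A).
Hypothesis e1 : is_unit_elt e.

Lemma state_unit (phi : A -> R[i]) : is_state phi -> phi e = 1.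
Proof.
move=> [phiD phiZ phi0 phin].
have [m m0 Em] := complex_ge0P (functional_unit_ge0 phi0 e1).
have bnd := functional_bound phiD phiZ phi0 e1; rewrite Em /= in bnd.
rewrite Em; congr (_%:C)%C; apply/eqP; rewrite eq_le; apply/andP; split.
  rewrite -phin; apply: sup_upper_bound.
    split; first by exists (Normc.normc (phi 0)); exists 0 => //=;
      rewrite normr0 ler01.
    exists m => _ /= [a a1 <-]; apply: (le_trans (bnd a)).
    by rewrite ler_piMr // -lecR -rnormE.
  exists e; first by rewrite /= rnormE lecR rnorm_unit_le1.
  by rewrite Em /= expr0n /= addr0 sqrtr_sqr ger0_norm.
rewrite -phin; apply: ge_sup.
  by exists (Normc.normc (phi 0)); exists 0 => //=; rewrite normr0 ler01.
move=> _ /= [a a1 <-]; apply: (le_trans (bnd a)).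
by rewrite ler_piMr // -lecR -rnormE.
Qed.

Lemma state_bound (phi : A -> R[i]) a : is_state phi ->
  Normc.normc (phi a) <= rnorm a.
Proof.
move=> st; have [phiD phiZ phi0 _] := st.
by have := functional_bound phiD phiZ phi0 e1 a; rewrite state_unit //= mul1r.
Qed.

Lemma state_of_unit (phi : A -> R[i]) :
  (forall a b, phi (a + b) = phi a + phi b) ->
  (forall (x : R[i]) a, phi (x *: a) = x * phi a) ->
  (forall a, 0 <= phi (a^# ** a)) -> phi e = 1 -> is_state phi.
Proof.
move=> phiD phiZ phi0 phie; split => //.
have bnd a : Normc.normc (phi a) <= rnorm a.
  by have := functional_bound phiD phiZ phi0 e1 a; rewrite phie mul1r.
apply/eqP; rewrite eq_le; apply/andP; split.
  apply: ge_sup.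
    by exists (Normc.normc (phi 0)); exists 0 => //=; rewrite normr0 ler01.
  by move=> _ /= [a a1 <-]; apply: (le_trans (bnd a)); rewrite -lecR -rnormE.
apply: sup_upper_bound.
  split; first by exists (Normc.normc (phi 0)); exists 0 => //=;
    rewrite normr0 ler01.
  exists 1 => _ /= [a a1 <-]; apply: (le_trans (bnd a)).
  by rewrite -lecR -rnormE.
exists e; first by rewrite /= rnormE lecR rnorm_unit_le1.
by rewrite phie Normc.normc1.
Qed.

End States.

(** * Quotients by ideals with an approximate unit of projections *)

(* The complements [qproj n] of an increasing approximate unit of projections
   for the ideal [{a | a ** qproj n --> 0}]. *)
Record cquot_data (R : realType) (A : cstarAlgType R) := CquotData {
  qunit : A;
  qproj : nat -> A;
  qunitP : is_unit_elt qunit;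
  qproj_adj : forall n, (qproj n)^# = qproj n;
  qproj_le : forall n m, (n <= m)%N -> qproj n ** qproj m = qproj m;
  qproj_ideal : forall a b,
    (forall e, 0 < e -> exists n, rnorm (a ** qproj n) < e) ->
    forall e, 0 < e -> exists n, rnorm (a ** b ** qproj n) < e
}.

Section QuotientNorm.
Variables (R : realType) (A : cstarAlgType R) (D : cquot_data A).
Local Notation e1 := (@qunitP _ _ D).
Local Notation f := (qproj D).
Implicit Types a b : A.

Lemma qproj_norm n : rnorm (f n) <= 1.
Proof.
rewrite -lecR -rnormE; apply: norm_proj_le1; first exact: qproj_adj.
exact: qproj_le.
Qed.

Lemma qproj_mono a n m : (n <= m)%N -> rnorm (a ** f m) <= rnorm (a ** f n).
Proof.
move=> nm; rewrite -(qproj_le D nm) amulA; apply: (le_trans (rnormM _ _)).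
by rewrite ler_piMr ?rnorm_ge0 // qproj_norm.
Qed.

(** The projections decrease, so this infimum is the limit of [rnorm (a ** f n)], the usual formula
    for a quotient norm in terms of an approximate unit. *)
Definition qnorm a : R := inf [set rnorm (a ** f n) | n in [set: nat]].

Lemma qnorm_le a n : qnorm a <= rnorm (a ** f n).
Proof.
apply: ge_inf; last by exists n.
by exists 0 => _ /= [m _ <-]; exact: rnorm_ge0.
Qed.

Lemma qnorm_approx a (d : R) : 0 < d ->
  exists N, forall n, (N <= n)%N -> rnorm (a ** f n) < qnorm a + d.
Proof.
move=> d0.
have hi : has_inf [set rnorm (a ** f n) | n in [set: nat]].
  split; first by exists (rnorm (a ** f 0)); exists 0%N.
  by exists 0 => _ /= [m _ <-]; exact: rnorm_ge0.
have [_ /= [N _ <-] HN] := inf_adherent d0 hi.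
by exists N => n Nn; apply: le_lt_trans HN; exact: qproj_mono.
Qed.

Lemma qnorm_ge0 a : 0 <= qnorm a.
Proof.
apply: lb_le_inf; first by exists (rnorm (a ** f 0)); exists 0%N.
by move=> _ /= [m _ <-]; exact: rnorm_ge0.
Qed.

Lemma qnorm_rnorm a : qnorm a <= rnorm a.
Proof.
apply: (le_trans (qnorm_le a 0)); apply: (le_trans (rnormM _ _)).
by rewrite ler_piMr ?rnorm_ge0 // qproj_norm.
Qed.

Lemma qnormD a b : qnorm (a + b) <= qnorm a + qnorm b.
Proof.
apply/ler_addgt0Pr => d d0.
have d20 : 0 < d / 2 by rewrite divr_gt0.
have [N1 H1] := qnorm_approx a d20; have [N2 H2] := qnorm_approx b d20.
pose n := maxn N1 N2.
have h1 := H1 n (leq_maxl _ _); have h2 := H2 n (leq_maxr _ _).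
have h3 := qnorm_le (a + b) n; rewrite amulDl in h3.
have h4 := rnormD (a ** f n) (b ** f n); lra.
Qed.

Lemma qnormZ (x : R[i]) a : qnorm (x *: a) = Normc.normc x * qnorm a.
Proof.
have le (y : R[i]) b : qnorm (y *: b) <= Normc.normc y * qnorm b.
  have y0 : 0 <= Normc.normc y by case: y => u v /=; exact: sqrtr_ge0.
  apply/ler_addgt0Pr => d d0.
  have d1 : 0 < d / (Normc.normc y + 1) by apply: divr_gt0 => //; lra.
  have [N H] := qnorm_approx b d1.
  have := qnorm_le (y *: b) N; rewrite amulZl rnormZ => /le_trans; apply.
  have /ltW := H N (leqnn N) => /(ler_wpM2l y0) /le_trans; apply.
  rewrite mulrDr lerD2l mulrCA -{2}[d]mulr1 ler_wpM2l ?(ltW d0) //.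
  by rewrite ler_pdivrMr ?mul1r; lra.
apply/eqP; rewrite eq_le le /=.
have [->|x0] := eqVneq x 0; first by rewrite Normc.normc0 mul0r qnorm_ge0.
have nx : 0 < Normc.normc x.
  rewrite lt_def; apply/andP; split.
    by apply: contra_neq x0 => /Normc.eq0_normc.
  by case: (x) => u v /=; exact: sqrtr_ge0.
have := le x^-1 (x *: a); rewrite scalerA mulVf // scale1r.
by rewrite Normc.normcV mulrC ler_pdivlMr // mulrC.
Qed.

Lemma qnormN a : qnorm (- a) = qnorm a.
Proof. by rewrite -scaleN1r qnormZ /= oppr0 expr0n /= addr0 sqrrN expr1n sqrtr1
  mul1r. Qed.

Lemma qnorm0 : qnorm 0 = 0.
Proof. by apply/eqP; rewrite eq_le qnorm_ge0 andbT -(rnorm0 A) qnorm_rnorm. Qed.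

Lemma qnorm_eq0P a : qnorm a = 0 <->
  (forall d, 0 < d -> exists n, rnorm (a ** f n) < d).
Proof.
split=> [a0 d d0|H].
  have [N HN] := qnorm_approx a d0; exists N.
  by have := HN N (leqnn N); rewrite a0 add0r.
apply/eqP; rewrite eq_le qnorm_ge0 andbT; apply/ler_addgt0Pr => d d0.
rewrite add0r; have [n Hn] := H d d0.
exact: le_trans (qnorm_le a n) (ltW Hn).
Qed.

(** Here [qproj_ideal] enters: [qunit D - f n] is killed by [f n] on the right, hence lies in the
    ideal, and so do its right multiples. *)
Lemma qnorm_compl n b : qnorm ((qunit D - f n) ** b) = 0.
Proof.
apply/qnorm_eq0P; apply: qproj_ideal => d d0; exists n.
by rewrite amulBl (e1 _).1 qproj_le // subrr rnorm0.
Qed.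

(** Inserting [f N] between the factors changes the product only by an element of the ideal, and
    brings the norm of the first factor close to [qnorm a]. *)
Lemma qnormM a b : qnorm (a ** b) <= qnorm a * qnorm b.
Proof.
apply/ler_addgt0Pr => d d0.
set K := qnorm a + qnorm b + 2.
have K0 : 0 < K by have := qnorm_ge0 a; have := qnorm_ge0 b; rewrite /K; lra.
(* As [d' <= 1] and [d' * K <= d], the product [(qnorm a + d') * (qnorm b + d')] exceeds
   [qnorm a * qnorm b] by at most [d]. *)
pose d' := Num.min 1 (d / K).
have d'0 : 0 < d' by rewrite lt_min ltr01 divr_gt0.
have d'1 : d' <= 1 by rewrite ge_min lexx.
have d'K : d' * K <= d by rewrite -ler_pdivlMr // ge_min lexx orbT.
have [N HN] := qnorm_approx a d'0; have {}HN := HN N (leqnn N).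
have [M HM] := qnorm_approx b d'0; have {}HM := HM M (leqnn M).
have E : a ** b = a ** f N ** b + a ** ((qunit D - f N) ** b).
  by rewrite -amulA -amulDr amulBl (e1 _).1 addrCA subrr addr0.
have z : qnorm (a ** ((qunit D - f N) ** b)) = 0.
  have /qnorm_eq0P H := qnorm_compl N b.
  apply/qnorm_eq0P => t t0.
  have A0 : 0 < rnorm a + 1 by have := rnorm_ge0 a; lra.
  have [n Hn] := H _ (divr_gt0 t0 A0); exists n.
  rewrite -amulA; apply: (le_lt_trans (rnormM _ _)).
  move: Hn; rewrite ltr_pdivlMr // => Hn; apply: le_lt_trans Hn.
  by rewrite mulrC ler_wpM2l ?rnorm_ge0 // lerDl.
have h1 : qnorm (a ** b) <= qnorm (a ** f N ** b).
  by rewrite E (le_trans (qnormD _ _)) // z addr0.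
have h2 : qnorm (a ** f N ** b) <= rnorm (a ** f N) * rnorm (b ** f M).
  by apply: (le_trans (qnorm_le _ M)); rewrite -amulA rnormM.
have h3 : rnorm (a ** f N) * rnorm (b ** f M) <= (qnorm a + d') * (qnorm b +
  d').
  by apply: ler_pM; rewrite ?rnorm_ge0 // ltW.
have := qnorm_ge0 a; have := qnorm_ge0 b; rewrite /K in d'K; nra.
Qed.

Lemma qnorm_cstar_ge a : qnorm a ^+ 2 <= qnorm (a^# ** a).
Proof.
apply/ler_addgt0Pr => d d0.
have [N HN] := qnorm_approx (a^# ** a) d0; have {}HN := HN N (leqnn N).
have h1 : qnorm a ^+ 2 <= rnorm (a ** f N) ^+ 2.
  by rewrite ler_pXn2r ?nnegrE ?rnorm_ge0 ?qnorm_ge0 // qnorm_le.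
apply: (le_trans h1); rewrite -rnorm_cstar adjM qproj_adj -amulA.
apply: le_trans (ltW HN); apply: (le_trans (rnormM _ _)); rewrite amulA.
by rewrite ler_piMl ?rnorm_ge0 // qproj_norm.
Qed.

(** The definition of [qnorm] is one-sided; its symmetry under the adjoint is recovered from the
    C*-inequality and submultiplicativity. *)
Lemma qnorm_adj_le a : qnorm a <= qnorm a^#.
Proof.
have [->|a0] := eqVneq (qnorm a) 0; first exact: qnorm_ge0.
have ap : 0 < qnorm a by rewrite lt_def a0 qnorm_ge0.
by have := le_trans (qnorm_cstar_ge a) (qnormM _ _); rewrite expr2 ler_pM2r.
Qed.

Lemma qnorm_adj a : qnorm a^# = qnorm a.
Proof. by apply/eqP; rewrite eq_le qnorm_adj_le -{2}[a]adjK qnorm_adj_le. Qed.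

Lemma qnorm_cstar a : qnorm (a^# ** a) = qnorm a ^+ 2.
Proof.
apply/eqP; rewrite eq_le qnorm_cstar_ge andbT.
by apply: (le_trans (qnormM _ _)); rewrite qnorm_adj expr2.
Qed.

(** The set depends only on the class of [a], so [get] picks one representative per class; the
    quotient is the type of these representatives. *)
Definition qcanon a : A := get [set b | qnorm (a - b) = 0].

Lemma qcanonP a : qnorm (a - qcanon a) = 0.
Proof. by apply: (@getPex _ [set b | qnorm (a - b) = 0]); exists a;
  rewrite /= subrr qnorm0. Qed.

Lemma qnorm0_trans a b c : qnorm (a - b) = 0 -> qnorm (b - c) = 0 ->
  qnorm (a - c) = 0.
Proof.
move=> ab bc; apply/eqP; rewrite eq_le qnorm_ge0 andbT -(subrKA b).
by apply: (le_trans (qnormD _ _)); rewrite ab bc addr0.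
Qed.

Lemma qnorm0_sym a b : qnorm (a - b) = 0 -> qnorm (b - a) = 0.
Proof. by rewrite -opprB qnormN. Qed.

Lemma qcanon_eq a b : qnorm (a - b) = 0 -> qcanon a = qcanon b.
Proof.
move=> ab; congr get; apply/seteqP; split=> c /=; apply: qnorm0_trans => //.
exact: qnorm0_sym.
Qed.

Lemma qcanonK a : qcanon (qcanon a) = qcanon a.
Proof. by apply: qcanon_eq; apply: qnorm0_sym; exact: qcanonP. Qed.

End QuotientNorm.

Definition cquot (R : realType) (A : cstarAlgType R) (D : cquot_data A) : Type
  :=
  {a : A | qcanon D a == a}.

Section QuotientAlgebra.
Variables (R : realType) (A : cstarAlgType R) (D : cquot_data A).
Local Notation Q := (cquot D).

HB.instance Definition _ := Choice.on Q.

Definition qpi (a : A) : Q := exist _ (qcanon D a) (introT eqP (qcanonK D a)).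
Definition qlift (x : Q) : A := val x.

Lemma qliftK x : qpi (qlift x) = x.
Proof. by apply: val_inj => /=; apply/eqP; exact: (valP x). Qed.

Lemma qpiP a b : qpi a = qpi b <-> qnorm D (a - b) = 0.
Proof.
split=> [[ab]|/qcanon_eq ab]; last exact: val_inj.
apply: (qnorm0_trans (qcanonP D a)); rewrite ab.
by apply: qnorm0_sym; exact: qcanonP.
Qed.

Lemma qlift_pi a : qnorm D (a - qlift (qpi a)) = 0.
Proof. exact: qcanonP. Qed.

Lemma qpi_ind (P : Q -> Prop) : (forall a, P (qpi a)) -> forall x, P x.
Proof. by move=> H x; rewrite -(qliftK x). Qed.

Definition qzero : Q := qpi 0.
Definition qadd (x y : Q) : Q := qpi (qlift x + qlift y).
Definition qopp (x : Q) : Q := qpi (- qlift x).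
Definition qscale (z : R[i]) (x : Q) : Q := qpi (z *: qlift x).
Definition qmul (x y : Q) : Q := qpi (qlift x ** qlift y).
Definition qadj (x : Q) : Q := qpi (qlift x)^#.
Definition qnm (x : Q) : R[i] := ((qnorm D (qlift x))%:C)%C.

Lemma qnorm0_le a (m : R) : qnorm D a <= m -> m <= 0 -> qnorm D a = 0.
Proof. by move=> h1 h2; apply/eqP;
  rewrite eq_le qnorm_ge0 andbT (le_trans h1). Qed.

Lemma qaddE a b : qadd (qpi a) (qpi b) = qpi (a + b).
Proof.
apply/qpiP; rewrite opprD addrACA.
apply: (qnorm0_le (qnormD _ _ _)).
by rewrite !(qnorm0_sym (qlift_pi _)) addr0.
Qed.

Lemma qscaleE z a : qscale z (qpi a) = qpi (z *: a).
Proof.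
by apply/qpiP; rewrite -scalerBr qnormZ (qnorm0_sym (qlift_pi _)) mulr0.
Qed.

Lemma qoppE a : qopp (qpi a) = qpi (- a).
Proof. by apply/qpiP; rewrite -opprD qnormN;
  exact: (qnorm0_sym (qlift_pi _)). Qed.

Lemma qmulE a b : qmul (qpi a) (qpi b) = qpi (a ** b).
Proof.
apply/qpiP; set a' := qlift _; set b' := qlift _.
have -> : a' ** b' - a ** b = (a' - a) ** b' + a ** (b' - b).
  by rewrite amulBl amulBr subrKA.
apply: (qnorm0_le (qnormD _ _ _)).
apply: (le_trans (lerD (qnormM _ _ _) (qnormM _ _ _))).
by rewrite !(qnorm0_sym (qlift_pi _)) mul0r mulr0 addr0.
Qed.

Lemma qadjE a : qadj (qpi a) = qpi a^#.
Proof. by apply/qpiP; rewrite -adjB qnorm_adj;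
  exact: (qnorm0_sym (qlift_pi _)). Qed.

Lemma qnmE a : qnm (qpi a) = ((qnorm D a)%:C)%C.
Proof.
congr (_%:C)%C; apply/eqP; rewrite eq_le; apply/andP; split.
  rewrite -[X in qnorm D X <= _](subrK a) addrC;
    apply: (le_trans (qnormD _ _ _)).
  by rewrite (qnorm0_sym (qlift_pi _)) addr0.
rewrite -[X in qnorm D X <= _](subrK (qlift (qpi a))) addrC.
apply: (le_trans (qnormD _ _ _)).
by rewrite qlift_pi addr0.
Qed.

Fact qaddA : associative qadd.
Proof. by elim/qpi_ind=> a; elim/qpi_ind=> b; elim/qpi_ind=> c;
  rewrite !qaddE addrA. Qed.
Fact qaddC : commutative qadd.
Proof. by elim/qpi_ind=> a; elim/qpi_ind=> b; rewrite !qaddE addrC. Qed.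
Fact qadd0 : left_id qzero qadd.
Proof. by elim/qpi_ind=> a; rewrite /qzero !qaddE add0r. Qed.
Fact qaddN : left_inverse qzero qopp qadd.
Proof. by elim/qpi_ind=> a; rewrite qoppE qaddE addNr. Qed.

HB.instance Definition _ := GRing.isZmodule.Build Q qaddA qaddC qadd0 qaddN.

Lemma qpiD a b : qpi (a + b) = qpi a + qpi b. Proof. by rewrite -qaddE. Qed.
Lemma qpi0 : qpi 0 = 0. Proof. by []. Qed.

Fact qscaleA a b v : qscale a (qscale b v) = qscale (a * b) v.
Proof. by elim/qpi_ind: v => v; rewrite !qscaleE scalerA. Qed.
Fact qscale1 : left_id 1 qscale.
Proof. by elim/qpi_ind=> v; rewrite qscaleE scale1r. Qed.
Fact qscaleDr : right_distributive qscale +%R.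
Proof. by move=> z; elim/qpi_ind=> a; elim/qpi_ind=> b;
  rewrite -qpiD !qscaleE scalerDr qpiD. Qed.
Fact qscaleDl v : {morph qscale^~ v : a b / a + b}.
Proof. by elim/qpi_ind: v => v a b; rewrite !qscaleE scalerDl qpiD. Qed.

HB.instance Definition _ := GRing.Zmodule_isLmodule.Build R[i] Q
  qscaleA qscale1 qscaleDr qscaleDl.

Lemma qpiZ z a : qpi (z *: a) = z *: qpi a. Proof. by rewrite -qscaleE. Qed.

Fact qnmD x y : qnm (x + y) <= qnm x + qnm y.
Proof.
by elim/qpi_ind: x => a; elim/qpi_ind: y => b;
  rewrite -qpiD !qnmE -rmorphD lecR qnormD.
Qed.
Fact qnmZ (l : R[i]) x : qnm (l *: x) = `|l| * qnm x.
Proof.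
by elim/qpi_ind: x => a; rewrite -qpiZ !qnmE qnormZ rmorphM /=; congr (_ * _).
Qed.
Fact qnm0 x : qnm x = 0 -> x = 0.
Proof.
elim/qpi_ind: x => a; rewrite qnmE => /complexI a0.
by rewrite -qpi0; apply/qpiP; rewrite subr0.
Qed.

HB.instance Definition _ :=
  Lmodule_isNormed.Build (R[i] : numFieldType) Q qnmD qnmZ qnm0.

Lemma norm_qpi a : `|qpi a| = ((qnorm D a)%:C)%C. Proof. exact: qnmE. Qed.
Lemma rnorm_qpi a : rnorm (qpi a) =
  qnorm D a. Proof. by rewrite /rnorm norm_qpi. Qed.

(** [a ** f N] represents the same class as [a], and its norm approaches the quotient norm.
    Completeness of the quotient rests on such lifts. *)
Lemma qlift_small x (d : R) : rnorm x < d -> exists2 a, qpi a = x & rnorm a < d.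
Proof.
elim/qpi_ind: x => a; rewrite rnorm_qpi -subr_gt0 => ad.
have [N HN] := qnorm_approx D a ad.
have lt : rnorm (a ** qproj D N) < d.
  by rewrite (lt_le_trans (HN N (leqnn N))) // addrC subrK.
exists (a ** qproj D N) => //.
apply/qpiP; apply: qnorm0_sym; apply/qnorm_eq0P => t t0; exists N.
by rewrite amulBl -amulA qproj_le // subrr rnorm0.
Qed.

End QuotientAlgebra.

(** Choose balls of radius [2^-n] that belong to the Cauchy filter. The differences of consecutive
    centres lift with geometric bounds, the lifted series converges in [V], and the image of its sum
    is the limit of the filter. *)
Lemma open_map_complete (R : realType) (V : completeNormedModType R[i])
    (W : normedModType R[i]) (p : V -> W) :
  (forall a b, p (a + b) = p a + p b) ->
  (forall a, rnorm (p a) <= rnorm a) ->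
  (forall x (d : R), rnorm x < d -> exists2 a, p a = x & rnorm a < d) ->
  forall F : set_system W, ProperFilter F -> cauchy F -> cvg F.
Proof.
move=> pD p_le p_lift F FF /cauchyP Fc; apply/cvg_ex.
have pB a b : p (a - b) = p a - p b.
  by apply/eqP; rewrite -subr_eq opprK -pD subrK.
have half0 n : 0 < (2^-1 : R) ^+ n by rewrite exprn_gt0 // invr_gt0.
have H n : exists x : W, F (ball x (((2^-1 : R) ^+ n)%:C)%C).
  by apply: Fc; rewrite ltcR.
have [x Fx] := choice H.
have dx n : rnorm (x n.+1 - x n) < 2 * 2^-1 ^+ n.
  have [y [/= y1 y2]] := filter_ex (filterI (Fx n) (Fx n.+1)).
  move: y1 y2; rewrite -!ball_normE /= !rnormE !ltcR exprS => y1 y2.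
  have h := rnormD (x n.+1 - y) (y - x n); rewrite subrKA (rdistC y) in h.
  have := half0 n; lra.
have dH n : exists a, p a = x n.+1 - x n /\ rnorm a < 2 * 2^-1 ^+ n.
  by have [a a1 a2] := p_lift _ _ (dx n); exists a.
have [d dP] := choice dH.
have [a0 a0x] : exists a, p a = x 0%N.
  by have [|a pa _] := p_lift (x 0%N) (rnorm (x 0%N) + 1); [lra|exists a].
pose a n := a0 + \sum_(i < n) d i.
have ax n : p (a n) = x n.
  elim: n => [|n IH]; first by rewrite /a big_ord0 addr0.
  by rewrite /a big_ord_recr /= addrA pD IH (dP n).1 addrC subrK.
have [l al] : exists l : V, a @ \oo --> l.
  apply: (@geometric_cvg _ _ a 2^-1 2); rewrite ?invr_ge0 //; first by lra.
  by move=> n; rewrite /a big_ord_recr /= addrA [_ + d n]addrC addrK;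
    exact: ltW (dP n).2.
exists (p l); apply/cvg_ballP => e /complex_gt0P[t t0 ->].
have t2 : 0 < t / 2 by rewrite divr_gt0.
move/rcvgP : al => /(_ _ t2)[N1 H1].
have [N2 H2] : exists N, forall n, (N <= n)%N -> (2^-1 : R) ^+ n < t / 2.
  by apply: exprn_lt_eventually; rewrite ?invr_ge0 //; lra.
have h1 := H1 _ (leq_maxl N1 N2); have h2 := H2 _ (leq_maxr N1 N2).
apply: filterS (Fx (maxn N1 N2)) => y;
  rewrite -!ball_normE /= !rnormE !ltcR => y1.
have h := rnormD (p l - x (maxn N1 N2)) (x (maxn N1 N2) - y);
  rewrite subrKA in h.
have h3 : rnorm (p l - x (maxn N1 N2)) <= rnorm (l - a (maxn N1 N2)).
  by rewrite -ax -pB.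
lra.
Qed.

Section QuotientCStar.
Variables (R : realType) (A : cstarAlgType R) (D : cquot_data A).
Local Notation Q := (cquot D).

Fact cquot_complete (F : set_system Q) : ProperFilter F -> cauchy F -> cvg F.
Proof.
apply: (@open_map_complete R A Q (qpi D)).
- exact: qpiD.
- by move=> a; rewrite rnorm_qpi qnorm_rnorm.
- exact: qlift_small.
Qed.

HB.instance Definition _ := Uniform_isComplete.Build Q cquot_complete.

Local Notation mul := (@qmul R A D).
Local Notation star := (@qadj R A D).

Fact cq_mulA a b c : mul a (mul b c) = mul (mul a b) c.
Proof. by elim/qpi_ind: a => a; elim/qpi_ind: b => b; elim/qpi_ind: c => c;
  rewrite !qmulE amulA. Qed.
Fact cq_mulDl a b c : mul (a + b) c = mul a c + mul b c.
Proof. by elim/qpi_ind: a => a; elim/qpi_ind: b => b; elim/qpi_ind: c => c;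
  rewrite -qpiD !qmulE -qpiD amulDl. Qed.
Fact cq_mulDr a b c : mul a (b + c) = mul a b + mul a c.
Proof. by elim/qpi_ind: a => a; elim/qpi_ind: b => b; elim/qpi_ind: c => c;
  rewrite -qpiD !qmulE -qpiD amulDr. Qed.
Fact cq_mulZl (x : R[i]) a b : mul (x *: a) b = x *: mul a b.
Proof. by elim/qpi_ind: a => a; elim/qpi_ind: b => b;
  rewrite -qpiZ !qmulE -qpiZ amulZl. Qed.
Fact cq_mulZr (x : R[i]) a b : mul a (x *: b) = x *: mul a b.
Proof. by elim/qpi_ind: a => a; elim/qpi_ind: b => b;
  rewrite -qpiZ !qmulE -qpiZ amulZr. Qed.
Fact cq_adjK a : star (star a) = a.
Proof. by elim/qpi_ind: a => a; rewrite !qadjE adjK. Qed.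
Fact cq_adjD a b : star (a + b) = star a + star b.
Proof. by elim/qpi_ind: a => a; elim/qpi_ind: b => b;
  rewrite -qpiD !qadjE -qpiD adjD. Qed.
Fact cq_adjZ (x : R[i]) a : star (x *: a) = (x^*)%C *: star a.
Proof. by elim/qpi_ind: a => a; rewrite -qpiZ !qadjE -qpiZ adjZ. Qed.
Fact cq_adjM a b : star (mul a b) = mul (star b) (star a).
Proof. by elim/qpi_ind: a => a; elim/qpi_ind: b => b;
  rewrite !(qmulE, qadjE) adjM. Qed.
Fact cq_norm_mul (a b : Q) : `|mul a b| <= `|a| * `|b|.
Proof.
by elim/qpi_ind: a => a; elim/qpi_ind: b => b;
  rewrite qmulE !norm_qpi -rmorphM lecR qnormM.
Qed.
Fact cq_norm_cstar (a : Q) : `|mul (star a) a| = `|a| ^+ 2.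
Proof. by elim/qpi_ind: a => a;
  rewrite qadjE qmulE !norm_qpi -rmorphXn qnorm_cstar. Qed.

HB.instance Definition _ := CompleteNormedModule_isCStarAlgebra.Build R Q
  cq_mulA cq_mulDl cq_mulDr cq_mulZl cq_mulZr cq_adjK cq_adjD cq_adjZ cq_adjM
  cq_norm_mul cq_norm_cstar.

Definition cquot_alg : cstarAlgType R := Q.
Definition cquot_pi : A -> cquot_alg := qpi D.

Lemma cquot_pi_hom : is_star_hom cquot_pi.
Proof.
split=> [a b|x a|a b|a]; rewrite /cquot_pi.
- exact: qpiD.
- exact: qpiZ.
- by rewrite -qmulE.
- by rewrite -qadjE.
Qed.

Lemma cquot_pi_eq0 a : cquot_pi a = 0 <->
  (forall d, 0 < d -> exists n, rnorm (a ** qproj D n) < d).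
Proof.
by rewrite -(qnorm_eq0P D a) -[X in qnorm D X]subr0; exact: (qpiP D a 0).
Qed.

End QuotientCStar.

(** * Toeplitz-Cuntz-Krieger families *)

Section KGraphFacts.
Variables (k : nat) (L : kgraph k).
Implicit Types (l m a b : mor L) (v w : vtx L).

Lemma ffun_nat_addI (x y z : {ffun 'I_k -> nat}) : x + y = x + z -> y = z.
Proof.
move=> /ffunP e; apply/ffunP => i; have := e i; rewrite !ffunE => /eqP.
by rewrite eqn_add2l => /eqP.
Qed.

(** Both [(idp (rng l), l)] and [(l, idp (src l))] factor [l] in degrees [0] and [0], and the
    factorization is unique. *)
Lemma deg0_idp l : deg l = 0 -> l = idp (src l).
Proof.
move=> d0; have dl : deg l = 0 + 0 by rewrite d0 addr0.
have [p [_ pu]] := factorization dl.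
have e1 : p = (idp (rng l), l).
  by apply: pu; split; rewrite //= ?deg_idp ?src_idp ?comp_idl.
have e2 : p = (l, idp (src l)).
  by apply: pu; split; rewrite //= ?deg_idp ?rng_idp ?comp_idr.
by move: e2; rewrite e1 => -[_].
Qed.

Lemma deg_join_id (n : {ffun 'I_k -> nat}) : deg_join n n = n.
Proof. by apply/ffunP => i; rewrite ffunE maxnn. Qed.

Lemma Lmin_same_deg l m p : deg l = deg m -> Lmin l m p ->
  l = m /\ p = (idp (src l), idp (src l)).
Proof.
case: p => a b dlm [/= la mb e]; rewrite -dlm deg_join_id => d.
have a0 : deg a = 0.
  by apply: (@ffun_nat_addI (deg l)); rewrite -deg_comp // d addr0.
have b0 : deg b = 0.
  by apply: (@ffun_nat_addI (deg m)); rewrite -deg_comp // -e d dlm addr0.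
have ea : a = idp (src l) by rewrite (deg0_idp a0) la (deg0_idp a0) src_idp
  rng_idp.
have eb : b = idp (src m) by rewrite (deg0_idp b0) mb (deg0_idp b0) src_idp
  rng_idp.
have lm : l = m by move: e; rewrite ea eb !comp_idr.
by rewrite ea eb -lm.
Qed.

Lemma Lmin_id l : Lmin l l = [set (idp (src l), idp (src l))].
Proof.
apply/seteqP; split=> [p /(Lmin_same_deg (erefl _))[_ ->]|_ ->] //=.
by split; rewrite /= ?rng_idp // comp_idr deg_join_id.
Qed.

Lemma Lmin0 l m : deg l = deg m -> l != m -> Lmin l m = set0.
Proof.
move=> dlm lm; apply/seteqP; split => // p /(Lmin_same_deg dlm)[e _].
by rewrite e eqxx in lm.
Qed.

Lemma linkedP v w : reflect (exists l,
  rng l = v /\ src l = w) (linked [set v]%SET [set w]%SET).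
Proof.
apply: (iffP (asboolP _)) => -[l].
  by rewrite !inE => -[/eqP <- /eqP <-]; exists l.
by move=> [<- <-]; exists l; rewrite !inE.
Qed.

Lemma hereditaryP (H : {set vtx L}) :
  reflect (forall l, rng l \in H -> src l \in H) (hereditary H).
Proof.
apply: (iffP forallP) => [h l lH|h v].
  have /forallP/(_ (src l)) := h (rng l).
  by rewrite lH /= => /implyP; apply; apply/linkedP; exists l.
apply/forallP => w; apply/implyP => vH; apply/implyP => /linkedP[l [lv <-]].
by apply: h; rewrite lv.
Qed.

End KGraphFacts.

Section Families.
Variables (R : realType) (k : nat) (L : kgraph k) (A : cstarAlgType R).
Variable T : mor L -> A.
Hypothesis TCK : is_TCK_family T.
Implicit Types (l m n : mor L) (v w : vtx L) (a b : A).

Let Tpi l : T l ** (T l)^# ** T l = T l. Proof. by case: TCK. Qed.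
Let Tvs v : (T (idp v))^# = T (idp v). Proof. by case: TCK => _ []. Qed.
Let Tvi v : T (idp v) ** T (idp v) = T (idp v). Proof. by case: TCK =>
  _ []. Qed.
Let Tv0 v w : v != w -> T (idp v) ** T (idp w) = 0. Proof. by case: TCK =>
  _ [_ _ H] _ _; exact: H. Qed.
Let Tcomp l m : src l = rng m ->
  T l ** T m = T (compose l m). Proof. by case: TCK => _ _ H _; exact: H. Qed.
Let Tmin l m : (T l)^# ** T m = \sum_(p \in Lmin l m) (T p.1 ** (T p.2)^#).
Proof. by case: TCK. Qed.

Lemma tck_rng l : T (idp (rng l)) ** T l = T l.
Proof. by rewrite Tcomp ?src_idp // comp_idl. Qed.

Lemma tck_src l : T l ** T (idp (src l)) = T l.
Proof. by rewrite Tcomp ?rng_idp // comp_idr. Qed.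

Lemma tck_star_self l : (T l)^# ** T l = T (idp (src l)).
Proof. by rewrite Tmin Lmin_id fsbig_set1 /= Tvs Tvi. Qed.

Lemma tck_orth l m : deg l = deg m -> l != m -> (T l)^# ** T m = 0.
Proof. by move=> dlm lm; rewrite Tmin Lmin0 // fsbig_set0. Qed.

Lemma tck_comp0 l m : src l != rng m -> T l ** T m = 0.
Proof.
move=> lm; rewrite -(tck_src l) -(tck_rng m) amulA -(amulA (T l)) Tv0 //.
by rewrite amul0r amul0l.
Qed.

(* The sum in the Toeplitz-Cuntz-Krieger relation is [0] by convention when
   its support is infinite, so this needs no finiteness. *)
Lemma tck_min_ind (S : A -> Prop) l m : S 0 -> (forall a b, S a -> S b ->
  S (a + b)) ->
  (forall c d, src l = rng c -> src m = rng d -> compose l c = compose m d ->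
    S (T c ** (T d)^#)) -> S ((T l)^# ** T m).
Proof.
move=> S0 SD ST; rewrite Tmin big_seq.
apply: (big_ind S) => // -[c d]; case: finite_supportP => //= X XP _ _.
by move=> /XP[/=lc md e _]; exact: ST.
Qed.

Definition range_proj l := T l ** (T l)^#.

Lemma range_proj_adj l : (range_proj l)^# = range_proj l.
Proof. by rewrite /range_proj adjM adjK. Qed.

Lemma range_proj_idem l : range_proj l ** range_proj l = range_proj l.
Proof. by rewrite /range_proj amulA Tpi. Qed.

Lemma range_proj_idp v : range_proj (idp v) = T (idp v).
Proof. by rewrite /range_proj Tvs Tvi. Qed.

(** The product is built from terms [T (compose l c) ** (T (compose m d))^#] with
    [compose l c = compose m d], all self-adjoint; and self-adjoint elements whose product is
    self-adjoint commute. *)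
Lemma range_projC l m : range_proj l ** range_proj m =
  range_proj m ** range_proj l.
Proof.
suff sa : (range_proj l ** range_proj m)^# = range_proj l ** range_proj m.
  by rewrite -[in LHS]sa adjM !range_proj_adj.
have -> : range_proj l ** range_proj m = T l ** ((T l)^# ** T m) ** (T m)^#.
  by rewrite /range_proj !amulA.
apply: (tck_min_ind (S :=
  fun x => (T l ** x ** (T m)^#)^# = T l ** x ** (T m)^#)).
- by rewrite amul0r amul0l adj0.
- by move=> a b ha hb; rewrite amulDr amulDl adjD ha hb.
- move=> c d lc md e.
  have -> : T l ** (T c ** (T d)^#) ** (T m)^# =
    T (compose l c) ** (T (compose m d))^#.
    by rewrite -!Tcomp // adjM !amulA.
  by rewrite e -/(range_proj _) range_proj_adj.
Qed.

Lemma range_proj_rng l : T (idp (rng l)) ** range_proj l = range_proj l.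
Proof. by rewrite /range_proj amulA tck_rng. Qed.

Hypothesis gen : generates T.

Definition tck_unit : A := \sum_v T (idp v).

(** The elements fixed by this finite sum on both sides form a closed star-subalgebra that contains
    the generators. *)
Lemma tck_unitP : is_unit_elt tck_unit.
Proof.
move=> a.
apply: (gen (S := [set a | tck_unit ** a = a /\ a ** tck_unit = a])).
- by split; rewrite ?amul0l ?amul0r.
- move=> l; split.
    rewrite /tck_unit amul_suml (bigD1 (rng l)) //= tck_rng big1 ?addr0 // =>
      v vl.
    by rewrite tck_comp0 // src_idp.
  rewrite /tck_unit amul_sumr (bigD1 (src l)) //= tck_src big1 ?addr0 // =>
    v vl.
  by rewrite tck_comp0 // rng_idp eq_sym.
- by move=> x y [x1 x2] [y1 y2]; rewrite /= amulDr amulDl x1 x2 y1 y2.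
- by move=> z x [x1 x2]; rewrite /= amulZr amulZl x1 x2.
- by move=> x y [x1 x2] [y1 y2]; rewrite /= amulA x1 -amulA y2.
- have us : tck_unit^# = tck_unit.
    by rewrite /tck_unit adj_sum; apply: eq_bigr => v _; rewrite Tvs.
  by move=> x [x1 x2]; split; rewrite -{1}us -adjM ?x1 ?x2.
- have -> : [set a | tck_unit ** a = a /\ a ** tck_unit = a] =
     [set a | tck_unit ** a = id a] `&` [set a | a ** tck_unit = id a] by [].
  apply: closedI; apply: closed_equalizer; try by move=> x; exact: cvg_id.
    exact: amull_continuous.
  exact: amulr_continuous.
Qed.

(* An element [a] preserving, together with [a^#], the closed span [W] of the
   [T l ** (T m)^#] lies in [W], as [W] contains the unit. *)
Lemma tck_span (S : set A) : S 0 ->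
  (forall a b, S a -> S b -> S (a + b)) ->
  (forall (x : R[i]) a, S a -> S (x *: a)) -> closed S ->
  (forall l m, S (T l ** (T m)^#)) -> forall a, S a.
Proof.
pose subsp (U : set A) := [/\ U 0, forall a b, U a -> U b -> U (a + b),
  forall (x : R[i]) a, U a -> U (x *: a), closed U &
  forall l m, U (T l ** (T m)^#)].
move=> S0 SD SZ Sc ST a.
pose W := \bigcap_(U in subsp) U.
have W0 : W 0 by move=> U [].
have WD x y : W x -> W y -> W (x + y).
  by move=> Wx Wy U sU; have [_ UD _ _ _] := sU; apply: UD;
    [exact: Wx|exact: Wy].
have WZ z x : W x -> W (z *: x).
  by move=> Wx U sU; have [_ _ UZ _ _] := sU; apply: UZ; exact: Wx.
have Wc : closed W by apply: closed_bigI => U [].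
have WT l m : W (T l ** (T m)^#) by move=> U [].
suff H : W a by apply: H; split.
have We : W tck_unit.
  by apply: (big_ind W) => // v _; rewrite -range_proj_idp; exact: WT.
have <- : a ** tck_unit = a := (tck_unitP a).2.
(* [W] is the least closed subspace containing all [T l ** (T m)^#]; so [c] maps [W] into itself as
   soon as the preimage of [W] is another such subspace. *)
have preim c : subsp [set x | W (c ** x)] -> forall x, W x -> W (c ** x).
  by move=> sc x Wx; exact: (Wx _ sc).
have sub c : (forall l m, W (c ** (T l ** (T m)^#))) -> forall x, W x ->
  W (c ** x).
  move=> cT; apply: preim; split => //=.
  - by rewrite amul0r.
  - by move=> x y Wx Wy; rewrite amulDr; exact: WD.
  - by move=> z x Wx; rewrite amulZr; exact: WZ.
  - by apply: closed_comp => // x _; exact: amull_continuous.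
pose M := [set c | (forall x, W x -> W (c ** x)) /\ (forall x, W x ->
  W (c^# ** x))].
suff [Ma _] : M a by exact: Ma.
apply: gen => //.
- by split=> x _; rewrite ?adj0 amul0l.
- move=> n; split; apply: sub => l m.
    have [nl|nl] := eqVneq (src n) (rng l).
      by rewrite amulA Tcomp //; exact: WT.
    by rewrite amulA tck_comp0 // amul0l.
  rewrite amulA; apply: (tck_min_ind (S := fun x => W (x ** (T m)^#))).
  + by rewrite amul0l.
  + by move=> x y Wx Wy; rewrite amulDl; exact: WD.
  + move=> c d nc ld e; rewrite -amulA -adjM.
    have [md|md] := eqVneq (src m) (rng d); first by rewrite Tcomp //;
      exact: WT.
    by rewrite tck_comp0 // adj0 amul0r.
- by move=> x y [x1 x2] [y1 y2]; split=> z Wz; rewrite ?adjD amulDl; apply: WD;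
  auto.
- by move=> z x [x1 x2]; split=> y Wy; rewrite ?adjZ amulZl; apply: WZ; auto.
- by move=> x y [x1 x2] [y1 y2]; split=> z Wz; rewrite ?adjM -amulA; auto.
- by move=> x [x1 x2]; split; rewrite ?adjK.
- have -> : M = \bigcap_(x in W) ([set c | W (c ** x)] `&` [set c | W (c^# **
  x)]).
    apply/seteqP; split=> c; first by move=> [c1 c2] x Wx; split;
      [exact: c1|exact: c2].
    by move=> Hc; split=> x Wx; have [] := Hc x Wx.
  apply: closed_bigI => x _; apply: closedI; apply: closed_comp => // y _.
    exact: amulr_continuous.
  by apply: (@continuous_comp _ _ _ (@adj R A) (fun z => z ** x));
    [exact: adj_continuous|exact: amulr_continuous].
Qed.

End Families.

(** * The ideal generated by a hereditary set of vertices *)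

Section IdealOfHereditary.
Variables (R : realType) (k : nat) (L : kgraph k) (A : cstarAlgType R).
Variables (T : mor L -> A) (H : {set vtx L}).
Hypotheses (TCK : is_TCK_family T) (gen : generates T) (hH : hereditary H).
Implicit Types (l : mor L) (v w : vtx L) (a b : A).

Local Notation e := (tck_unit T).
Local Notation p := (range_proj T).

Let e1 : is_unit_elt e := tck_unitP TCK gen.

Let el a : e ** a = a. Proof. exact: (e1 a).1. Qed.
Let er a : a ** e = a. Proof. exact: (e1 a).2. Qed.
Let es : e^# = e. Proof. exact: unit_adj. Qed.

(** The countably many paths are enumerated by [unpickle]; an index that codes no path, or a path
    with source outside [H], contributes the unit. *)
Definition hproj_factor (i : nat) : A :=
  if choice.unpickle i is Some l then
    if src (l : mor L) \in H then e - p l else e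
  else e.

Definition hproj (n : nat) : A := iteri n (fun i a => a ** hproj_factor i) e.

Lemma hproj_factorP i :
  hproj_factor i = e \/ exists2 l, src l \in H & hproj_factor i = e - p l.
Proof.
rewrite /hproj_factor; case: choice.unpickle => [l|]; last by left.
by case: ifP => lH; [right; exists l|left].
Qed.

Lemma range_proj_factorC l i : p l ** hproj_factor i = hproj_factor i ** p l.
Proof.
have [->|[m _ ->]] := hproj_factorP i; first by rewrite el er.
by rewrite amulBl amulBr el er (range_projC TCK).
Qed.

Lemma hproj_factorC i j : hproj_factor i ** hproj_factor j =
  hproj_factor j ** hproj_factor i.
Proof.
have [->|[m _ ->]] := hproj_factorP i; first by rewrite el er.
by rewrite amulBl amulBr el er range_proj_factorC.
Qed.

Lemma hproj_factor_adj i : (hproj_factor i)^# = hproj_factor i.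
Proof. by have [->|[l _ ->]] := hproj_factorP i;
  rewrite // adjB es range_proj_adj. Qed.

Lemma hproj_factor_idem i : hproj_factor i ** hproj_factor i = hproj_factor i.
Proof.
have [->|[l _ ->]] := hproj_factorP i; first exact: el.
by rewrite amulBl !amulBr !el er (range_proj_idem TCK) subrr subr0.
Qed.

Lemma hprojS n : hproj n.+1 = hproj n ** hproj_factor n. Proof. by []. Qed.

Lemma hproj_commute n i : hproj n ** hproj_factor i = hproj_factor i ** hproj n.
Proof.
elim: n => [|n IH]; first by rewrite /= el er.
by rewrite hprojS -amulA (hproj_factorC n) amulA IH amulA.
Qed.

Lemma hproj_adj n : (hproj n)^# = hproj n.
Proof.
elim: n => [|n IH]; first exact: es.
by rewrite hprojS adjM IH hproj_factor_adj hproj_commute.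
Qed.

Lemma hproj_idem n : hproj n ** hproj n = hproj n.
Proof.
elim: n => [|n IH]; first exact: el.
by rewrite hprojS amulA -(amulA (hproj n)) -hproj_commute amulA IH -amulA
  hproj_factor_idem.
Qed.

Lemma hproj_le n m : (n <= m)%N -> hproj n ** hproj m = hproj m.
Proof.
move=> nm; rewrite -(subnKC nm); elim: (m - n)%N => [|j IH].
  by rewrite addn0 hproj_idem.
by rewrite addnS hprojS amulA IH.
Qed.

Lemma hproj_kill l : src l \in H -> forall n, (choice.pickle l < n)%N ->
  (T l)^# ** hproj n = 0.
Proof.
move=> lH n ln; have [TP _ _ _] := TCK.
rewrite -(hproj_le ln) hprojS hproj_commute /hproj_factor choice.pickleK lH.
rewrite !amulA amulBr er.
have -> : (T l)^# ** p l = (T l)^#.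
  by have := congr1 (@adj R A) (TP l); rewrite !adjM adjK.
by rewrite subrr !amul0l.
Qed.

(** By [hproj_mono] one small value bounds all later ones, so this says that [a ** hproj n] tends to
    [0]: [a] belongs to the closed ideal of [H]. *)
Definition hnull a := forall d : R, 0 < d -> exists n, rnorm (a ** hproj n) < d.

Lemma rnorm_hproj n : rnorm (hproj n) <= 1.
Proof. by rewrite -lecR -rnormE; apply: norm_proj_le1;
  [exact: hproj_adj|exact: hproj_idem]. Qed.

Lemma hproj_mono a n m : (n <= m)%N ->
  rnorm (a ** hproj m) <= rnorm (a ** hproj n).
Proof.
move=> nm; rewrite -(hproj_le nm) amulA; apply: (le_trans (rnormM _ _)).
by rewrite ler_piMr ?rnorm_ge0 // rnorm_hproj.
Qed.

Lemma hnullD a b : hnull a -> hnull b -> hnull (a + b).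
Proof.
move=> an bn d d0; have d2 : 0 < d / 2 by rewrite divr_gt0.
have [n an'] := an _ d2; have [m bm'] := bn _ d2.
exists (maxn n m); rewrite amulDl.
have h := rnormD (a ** hproj (maxn n m)) (b ** hproj (maxn n m)).
have h1 := hproj_mono a (leq_maxl n m); have h2 := hproj_mono b (leq_maxr n m).
lra.
Qed.

Lemma hnull0 : hnull 0.
Proof. by move=> d d0; exists 0%N; rewrite amul0l rnorm0. Qed.

Lemma hnullZ (x : R[i]) a : hnull a -> hnull (x *: a).
Proof.
move=> an d d0; set N := Normc.normc x.
have N0 : 0 <= N by rewrite /N; case: (x) => u v /=; exact: sqrtr_ge0.
have [|n an'] := an (d / (N + 1)); first by apply: divr_gt0 => //; lra.
exists n; rewrite amulZl rnormZ -/N.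
have N1 : 0 < N + 1 by lra.
move: an'; rewrite ltr_pdivlMr //; have := rnorm_ge0 (a ** hproj n); nra.
Qed.

(** If the [(T l)^#] eventually kill [b ** hproj n], so do the range projections occurring in
    [hproj m]. Thus [hproj m] acts as the unit on [b ** hproj n] for large [n], and [a ** hproj m]
    controls [a ** b ** hproj n]. *)
Lemma hnull_mulr_eventually b :
  (forall l, src l \in H -> exists N, forall n, (N <= n)%N ->
    (T l)^# ** b ** hproj n = 0) ->
  forall a, hnull a -> hnull (a ** b).
Proof.
move=> bT a an d d0.
have absorb m : exists N, forall n, (N <= n)%N ->
  hproj m ** b ** hproj n = b ** hproj n.
  elim: m => [|m [N HN]]; first by exists 0%N => n _; rewrite /= el.
  rewrite hprojS /hproj_factor; case: (choice.unpickle m) => [l|];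
    last by exists N; rewrite er.
  case: ifP => [/bT[N' HN']|_]; last by exists N; rewrite er.
  exists (maxn N N') => n; rewrite geq_max => /andP[Nn N'n].
  rewrite amulBr er !amulBl HN // /range_proj.
  have -> : hproj m ** (T l ** (T l)^#) ** b ** hproj n =
      hproj m ** T l ** ((T l)^# ** b ** hproj n) by rewrite !amulA.
  by rewrite HN' // amul0r subr0.
have M0 : 0 < rnorm b + 1 by have := rnorm_ge0 b; lra.
have [m am] := an _ (divr_gt0 d0 M0).
have [N HN] := absorb m; exists N.
rewrite -amulA -(HN N) // !amulA -amulA.
apply: (le_lt_trans (rnormM _ _)).
move: am; rewrite ltr_pdivlMr // => am.
apply: le_lt_trans am; apply: ler_wpM2l; first exact: rnorm_ge0.
apply: (le_trans (rnormM _ _)); apply: (@le_trans _ _ (rnorm b)).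
  by rewrite ler_piMr ?rnorm_ge0 // rnorm_hproj.
by rewrite lerDl.
Qed.

(** The [b] for which [b] and [b^#] both preserve null elements form a closed star-subalgebra, so
    generators suffice; there heredity of [H] enters. *)
Lemma hnull_mulr a b : hnull a -> hnull (a ** b).
Proof.
pose S := [set b | (forall a, hnull a -> hnull (a ** b)) /\
                   (forall a, hnull a -> hnull (a ** b^#))].
suff [Hb _] : S b by exact: Hb.
apply: gen => //.
- by split=> x _; rewrite ?adj0 amul0r; exact: hnull0.
- move=> n; split; apply: hnull_mulr_eventually => l lH.
    pose K := [set x | exists N, forall i, (N <= i)%N -> x ** hproj i = 0].
    suff : K ((T l)^# ** T n) by [].
    apply: (tck_min_ind TCK (S := K)).
    + by exists 0%N => i _; rewrite amul0l.
    + move=> x y [N HN] [M HM]; exists (maxn N M) => i;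
      rewrite geq_max => /andP[Ni Mi].
      by rewrite amulDl HN // HM // addr0.
    (* [rng c = src l] lies in [H], hence by heredity so does [src c = src d], and [(T d)^#] is
       eventually killed. *)
    + move=> c d lc nd e'; exists (choice.pickle d).+1 => i di.
      rewrite -amulA hproj_kill ?amul0r //.
      rewrite -(src_comp nd) -e' src_comp //.
      by move/hereditaryP : hH; apply; rewrite -lc.
  have [nl|nl] := eqVneq (src n) (rng l); last first.
    by exists 0%N => i _; rewrite -adjM (tck_comp0 TCK) // adj0 amul0l.
  have [_ _ TM _] := TCK.
  exists (choice.pickle (compose n l)).+1 => i di; rewrite -adjM TM //.
  by apply: hproj_kill => //; rewrite src_comp.
- by move=> x y [x1 x2] [y1 y2]; split=> z zn; rewrite ?adjD amulDr;
  apply: hnullD; auto.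
- by move=> z x [x1 x2]; split=> y yn; rewrite ?adjZ amulZr; apply: hnullZ;
  auto.
- by move=> x y [x1 x2] [y1 y2]; split=> z zn; rewrite ?adjM amulA; auto.
- by move=> x [x1 x2]; split; rewrite ?adjK.
- move=> x xS.
  have near (d : R) : 0 < d -> exists2 y, S y & rnorm (x - y) < d.
    move=> d0; have d0' : 0 < (d%:C)%C by rewrite ltcR.
    have [y [Sy]] := xS _ (nbhsx_ballx x _ d0').
    by rewrite -ball_normE /= rnormE ltcR => xy; exists y.
  have K (f : A -> A) : (forall y, rnorm (f x - f y) <= rnorm (x - y)) ->
      (forall y, S y -> forall a, hnull a -> hnull (a ** f y)) ->
      forall a, hnull a -> hnull (a ** f x).
    move=> fL fS z zn d d0.
    have M0 : 0 < 2 * (rnorm z + 1) by have := rnorm_ge0 z; lra.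
    have [y Sy] := near _ (divr_gt0 d0 M0); rewrite ltr_pdivlMr // => xy.
    have [n Hn] := fS y Sy z zn (d / 2) (divr_gt0 d0 (ltr0Sn _ 1)).
    exists n.
    have -> : z ** f x = z ** (f x - f y) + z ** f y by rewrite -amulDr subrK.
    rewrite amulDl; have h :=
      rnormD (z ** (f x - f y) ** hproj n) (z ** f y ** hproj n).
    have h2 : rnorm (z ** (f x - f y) ** hproj n) <= rnorm z * rnorm (x - y).
      apply: (le_trans (rnormM _ _));
        apply: (@le_trans _ _ (rnorm (z ** (f x - f y)))).
        by rewrite ler_piMr ?rnorm_ge0 // rnorm_hproj.
      by apply: (le_trans (rnormM _ _)); rewrite ler_wpM2l ?rnorm_ge0.
    have := rnorm_ge0 (x - y); have := rnorm_ge0 z; nra.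
  split; first by apply: (K id) => // y [].
  by apply: (K (@adj R A)) => [y|y []//]; rewrite -adjB rnorm_adj.
Qed.

Definition hereditary_quot : cquot_data A :=
  CquotData e1 hproj_adj hproj_le hnull_mulr.

Local Notation B := (cquot_alg hereditary_quot).
Local Notation pi := (cquot_pi hereditary_quot).

Lemma cquot_pi_hereditary l : src l \in H -> pi (T l) = 0.
Proof.
move=> lH; apply/cquot_pi_eq0 => d d0;
  exists (choice.pickle (idp (src l) : mor L)).+1.
rewrite -(tck_src TCK) -amulA.
have [_ [Ts _ _] _ _] := TCK.
by rewrite -(Ts (src l)) hproj_kill ?src_idp // amul0r rnorm0.
Qed.

Definition quot_family (l : mor (kgraph_remove hH)) : B := pi (T (val l)).

Hypothesis finL : finite_kgraph L.

(** Needed to push a star-homomorphism through the sum of the Toeplitz-Cuntz-Krieger relation, which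
    is [0] by convention on an infinite support. *)
Lemma finite_Lmin l m : finite_set (Lmin l m).
Proof.
have fD (l' : mor L) (n : {ffun 'I_k ->
  nat}) : finite_set [set c : mor L | deg l' + deg c = n].
  have [[c0 c0P]|no] := pselect (exists c : mor L, deg l' + deg c = n).
    apply: sub_finite_set (finL (deg c0)) => c /= cn.
    by apply: (@ffun_nat_addI _ (deg l')); rewrite cn.
  by rewrite (_ : [set _ | _] = set0) //; apply/seteqP; split=> // c cn;
    apply: no; exists c.
apply: sub_finite_set (finite_setX (fD l (deg_join (deg l) (deg m))) (fD m
  (deg_join (deg l) (deg m)))).
by move=> [c d] [/= lc md e'] ec; split; rewrite /= -deg_comp // -e'.
Qed.

(** Only the last relation takes an argument: pairs in [Lmin] with source in [H] contribute [0] to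
    the quotient, and the remaining ones are exactly the pairs of the smaller graph. *)
Lemma quot_family_TCK : is_TCK_family quot_family.
Proof.
have [T1 [T2 T3 T4] T5 T6] := TCK.
have [piD piZ piM piA] := cquot_pi_hom hereditary_quot.
have pi0 : pi 0 = 0 by have := piZ 0 0; rewrite !scale0r.
split.
- by move=> l; rewrite /quot_family -piA -!piM T1.
- split=> [v|v|v w vw]; rewrite /quot_family /=.
  + by rewrite -piA T2.
  + by rewrite -piM T3.
  + by rewrite -piM T4.
- move=> l m lm; rewrite /quot_family -piM T5; last exact: remove_composable lm.
  by rewrite remove_comp_val.
- move=> l m; rewrite /quot_family -piA -piM T6.
  pose F (x : mor L * mor L) := T x.1 ** (T x.2)^#.
  have -> : pi (\sum_(x \in Lmin (val l) (val m)) F x) =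
    \sum_(x \in Lmin (val l) (val m)) pi (F x).
    rewrite !fsbig_finite; try exact: finite_Lmin.
    exact: (big_morph pi piD pi0).
  pose h (x : mor (kgraph_remove hH) * mor (kgraph_remove hH)) :=
    (val x.1, val x.2).
  have hinj : set_inj (Lmin l m) h.
    by move=> [c d] [c' d'] _ _ [/val_inj -> /val_inj ->].
  rewrite -(@fsbig_widen _ _ _ _ (h @` Lmin l m)).
  + rewrite fsbig_image //; apply: eq_fsbigr => -[c d] _.
    by rewrite /F /= -piA -piM.
  + move=> _ [[c d] [/= lc md e' ed] <-]; split=> /=.
    * exact: remove_composable lc.
    * exact: remove_composable md.
    * by rewrite -!remove_comp_val // e'.
    * by move: ed; rewrite /remove_deg remove_comp_val.
  + move=> [c d] [[/= lc md e' ed] nim] /=.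
    have [cH|cH] := boolP (src c \in H).
      by rewrite /F piM cquot_pi_hereditary ?amul0l.
    have dH : src d \notin H by rewrite -(src_comp md) -e' src_comp.
    exfalso; apply: nim.
    exists (exist _ c cH, exist _ d dH) => //.
    have lc' : remove_src l = remove_rng hH (exist _ c cH) by exact: val_inj.
    have md' : remove_src m = remove_rng hH (exist _ d dH) by exact: val_inj.
    split => //=.
      by apply: val_inj; rewrite !remove_comp_val.
    by rewrite /remove_deg remove_comp_val.
Qed.

End IdealOfHereditary.

(** * The kernel of the quotient map and factorization of states *)

Section Kernel.
Variables (R : realType) (k : nat) (L : kgraph k) (H : {set vtx L}).
Variables (hH : hereditary H) (finL : finite_kgraph L).
Variables (A B : cstarAlgType R) (t : mor L -> A).
Variables (u : mor (kgraph_remove hH) -> B) (q : A -> B).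
Hypotheses (tA : is_toeplitz_algebra t) (uB : is_toeplitz_algebra u).
Hypothesis qP : is_toeplitz_quotient t u q.

Lemma toeplitz_quotient_ker a : q a = 0 -> hnull t H a.
Proof.
have [TCK gen _] := tA; have [_ _ univ] := uB.
have [qhom _ qt q0] := qP.
have [pi [pihom piE]] := univ _ _ (quot_family_TCK TCK gen hH finL).
have e1 := tck_unitP TCK gen.
set D := hereditary_quot TCK gen hH in pi pihom piE.
have comp_hom : is_star_hom (pi \o q).
  have [p1 p2 p3 p4] := pihom; have [q1 q2 q3 q4] := qhom.
  by split=> [x y|z x|x y|x] /=; rewrite ?(q1, q2, q3, q4) ?(p1, p2, p3, p4).
have D_hom := cquot_pi_hom D.
have E x : pi (q x) = cquot_pi D x.
  have [p1 p2 p3 p4] := comp_hom; have [q1 q2 q3 q4] := D_hom.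
  have pi0 (V W : cstarAlgType R) (f : V -> W) : is_star_hom f -> f 0 = 0.
    by move=> [_ fZ _ _]; have := fZ 0 0; rewrite !scale0r.
  apply: (gen [set x | (pi \o q) x = cquot_pi D x]).
  - by rewrite /= !(pi0 _ _ _ qhom, pi0 _ _ _ pihom, pi0 _ _ _ D_hom).
  - move=> l /=; have [lH|lH] := boolP (src l \in H).
      by rewrite q0 // (pi0 _ _ _ pihom) cquot_pi_hereditary.
    by rewrite -[l]/(val (exist _ l lH : mor (kgraph_remove hH))) qt piE.
  - by move=> x1 y1 /= hx hy; apply: (etrans (p1 _ _)); rewrite /= hx hy q1.
  - by move=> z x1 /= hx; apply: (etrans (p2 _ _)); rewrite /= hx q2.
  - by move=> x1 y1 /= hx hy; apply: (etrans (p3 _ _)); rewrite /= hx hy q3.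
  - by move=> x1 /= hx; apply: (etrans (p4 _)); rewrite /= hx q4.
  - apply: closed_equalizer.
      exact: (starhom_continuous e1 comp_hom).
    exact: (starhom_continuous e1 D_hom).
move=> qa; apply: (cquot_pi_eq0 D a).1; rewrite -E qa.
by have [_ fZ _ _] := pihom; have := fZ 0 0; rewrite !scale0r.
Qed.

End Kernel.

Section FactorState.
Variables (R : realType) (A B : cstarAlgType R) (q : A -> B) (e : A).
Hypotheses (e1 : is_unit_elt e) (qhom : is_star_hom q).
Hypothesis qsurj : forall b, exists a, q a = b.
Variable phi : A -> R[i].
Hypotheses (phis : is_state phi) (ker : forall a, q a = 0 -> phi a = 0).

Lemma unit_surj : is_unit_elt (q e).
Proof.
have [_ _ qM _] := qhom.
by move=> b; have [a <-] := qsurj b; rewrite -!qM (e1 a).1 (e1 a).2.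
Qed.

Lemma factor_state : exists2 psi : B ->
  R[i], is_state psi & forall a, psi (q a) = phi a.
Proof.
have [s sP] := choice qsurj.
have [qD qZ qM qA] := qhom; have [phiD phiZ phi0 _] := phis.
have E a : phi (s (q a)) = phi a.
  apply/eqP; rewrite -subr_eq0 -functionalB //; apply/eqP/ker.
  by rewrite -[- a]scaleN1r qD qZ sP scaleN1r subrr.
exists (phi \o s) => //.
apply: (state_of_unit unit_surj) => /= [x y|z x|x|].
- by rewrite -[in LHS](sP x) -[in LHS](sP y) -qD E phiD.
- by rewrite -[in LHS](sP x) -qZ E phiZ.
- by rewrite -[in X in _ <= X](sP x) -qA -qM E phi0.
- by rewrite E (state_unit e1).
Qed.

End FactorState.

Section VanishOnIdeal.
Variables (R : realType) (k : nat) (L : kgraph k) (H : {set vtx L}).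
Variables (A : cstarAlgType R) (t : mor L -> A).
Hypotheses (TCK : is_TCK_family t) (gen : generates t).
Variable phi : A -> R[i].
Hypothesis phis : is_state phi.

(** Each factor of [hproj n] differs from the unit by at most a projection on which [phi] is [0], so
    [phi (a ** hproj n) = phi a]; the left side is bounded by a norm that tends to [0]. *)
Lemma state_hnull0 : (forall l, src l \in H -> phi (range_proj t l) = 0) ->
  forall a, hnull t H a -> phi a = 0.
Proof.
move=> phip a an; have [phiD phiZ phi0 _] := phis.
have e1 := tck_unitP TCK gen.
have key n : phi (a ** hproj t H n) = phi a.
  elim: n => [|n IH]; first by rewrite (e1 a).2.
  rewrite hprojS amulA; have [->|[l lH ->]] := hproj_factorP t H n.
    by rewrite (e1 _).2.
  rewrite amulBr (e1 _).2 functionalB // IH.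
  rewrite (functional_null_proj phiD phiZ phi0) ?subr0 ?phip //.
    exact: range_proj_adj.
  exact: range_proj_idem.
apply: Normc.eq0_normc; apply/eqP; rewrite eq_le; apply/andP; split; last first.
  by case: (phi a) => x y; exact: sqrtr_ge0.
apply/ler_addgt0Pr => d d0; have [n Hn] := an _ d0.
by rewrite add0r -(key n) (le_trans (state_bound e1 _ phis)) // ltW.
Qed.

End VanishOnIdeal.

(** * Goursat's theorem and the identity theorem *)

Section Goursat.
Variable R : realType.
Implicit Types (g G : R -> R) (a b c x y s t e d l p : R).

Lemma primitive_exists g M : continuous g ->
  exists G, forall x, - M < x < M -> is_derive x 1 G (g x).
Proof.
move=> cg.
pose mu := (@lebesgue_measure R).
exists (fun x => (\int[mu]_(t in `[(- M)%R, x]) g t)%R) => x /andP[x1 x2].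
have ig : mu.-integrable `[- M, M] (EFin \o g).
  apply: continuous_compact_integrable; first exact: segment_compact.
  by apply: continuous_subspaceT; exact: cg.
have [dx ex] := continuous_FTC1_closed x2 ig x1 (cg x).
by rewrite derive1E in ex; rewrite -ex; exact: derivableP.
Qed.

Definition is_primitive M g G := forall x, - M < x < M -> is_derive x 1 G (g x).

Lemma primitive_bound M g G a b e : is_primitive M g G -> a <= b ->
  - M < a -> b < M -> (forall x, a <= x <= b -> `|g x| <= e) ->
  `|G b - G a| <= e * (b - a).
Proof.
move=> gG ab Ma bM ge.
have [||c] := @MVT_segment _ G g a b ab.
- by move=> x; rewrite in_itv /= => /andP[x1 x2]; apply: gG; lra.
- apply: derivable_within_continuous => x; rewrite in_itv /= => /andP[x1 x2].
  by apply: (@ex_derive _ _ _ _ _ _ _ (gG x _)); lra.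
- rewrite in_itv /= => ch ->.
  by rewrite normrM (ger0_norm (_ : 0 <= b - a)) ?subr_ge0 // ler_wpM2r
    ?subr_ge0 // ge.
Qed.

Lemma primitive_affine M g G a b x0 p s e : is_primitive M g G -> a <= b ->
  - M < a -> b < M ->
  (forall x, a <= x <= b -> `|g x - (p + s * (x - x0))| <= e) ->
  `|G b - G a - (p * (b - a) + s * ((b - x0) ^+ 2 - (a - x0) ^+ 2) / 2)|
    <= e * (b - a).
Proof.
move=> gG ab Ma bM ge.
pose K x := G x - (p * x + s / 2 * (x - x0) ^+ 2).
have gK : is_primitive M (fun x => g x - (p + s * (x - x0))) K.
  move=> x xM; have dG := gG x xM; apply: is_derive_eq.
  rewrite /GRing.scale /= !(mulr0, mulr1, add0r, addr0, expr1, oppr0, subr0).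
  by congr (_ - (_ + _)); field.
have := primitive_bound gK ab Ma bM ge.
suff -> : K b - K a = G b - G a - (p * (b - a) + s * ((b - x0) ^+ 2 - (a - x0)
  ^+ 2) / 2) by [].
by rewrite /K; field.
Qed.

Lemma primitive_pos_zero M g G a b x0 : is_primitive M g G -> continuous g ->
  - M < a -> b < M -> (forall x, a <= x <= b -> 0 <= g x) -> G b = G a ->
  a < x0 < b -> g x0 = 0.
Proof.
move=> gG cg Ma bM g0 GG x0ab.
have mono x y : a <= x -> x <= y -> y <= b ->
  exists2 c, x <= c <= y & G y - G x = g c * (y - x).
  move=> ax xy yb.
  have [||c] := @MVT_segment _ G g x y xy.
  - by move=> z; rewrite in_itv /= => /andP[x1 x2]; apply: gG; lra.
  - apply: derivable_within_continuous => z; rewrite in_itv /= => /andP[x1 x2].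
    by apply: (@ex_derive _ _ _ _ _ _ _ (gG z _)); lra.
  - by rewrite in_itv /= => ch e; exists c.
have [//|gx0] := eqVneq (g x0) 0; exfalso.
have gp : 0 < g x0 by rewrite lt_def gx0 g0 //; lra.
have : \forall y \near x0, g y > g x0 / 2.
  move: (cg x0) => /cvgrPdist_lt /(_ (g x0 / 2) (divr_gt0 gp (ltr0Sn _ 1))).
  by apply: filterS => y; rewrite ltr_norml => /andP[_]; lra.
move=> [d /= d0 dP].
(* On [[x0, y]] the function [g] exceeds [g x0 / 2]; this piece makes [G b - G a] positive, the
   other two being nonnegative. *)
pose y := Num.min b (x0 + d / 2).
have y1 : x0 < y by rewrite lt_min; apply/andP; split; lra.
have y2 : y <= b by rewrite ge_min lexx.
have y3 : y <= x0 + d / 2 by rewrite ge_min lexx orbT.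
have [|||c1 ch1 e1] := mono a x0; [lra|lra|lra|].
have [|||c2 ch2 e2] := mono x0 y; [lra|lra|lra|].
have [|||c3 ch3 e3] := mono y b; [lra|lra|lra|].
have h1 : 0 <= g c1 by apply: g0; lra.
have h3 : 0 <= g c3 by apply: g0; lra.
have h2 : g x0 / 2 < g c2.
  by apply: dP; rewrite /= ltr_norml; lra.
have k1 : 0 <= g c1 * (x0 - a) by apply: mulr_ge0; lra.
have k3 : 0 <= g c3 * (b - y) by apply: mulr_ge0; lra.
have k2 : 0 < g c2 * (y - x0) by apply: mulr_gt0; lra.
lra.
Qed.

Lemma nested_intervals (x h : nat -> R) : (forall n, 0 <= h n) ->
  (forall n, x n <= x n.+1) -> (forall n, x n.+1 + h n.+1 <= x n + h n) ->
  exists x0, forall n, x n <= x0 <= x n + h n.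
Proof.
move=> h0 xi xd.
have inc n m : (n <= m)%N -> x n <= x m.
  by move=> nm; rewrite -(subnKC nm); elim: (m - n)%N => [|j IH];
    rewrite ?addn0 // addnS (le_trans IH).
have dec n m : (n <= m)%N -> x m + h m <= x n + h n.
  by move=> nm; rewrite -(subnKC nm); elim: (m - n)%N => [|j IH];
    rewrite ?addn0 // addnS (le_trans (xd _)).
have ub n m : x m <= x n + h n.
  have [nm|/ltnW mn] := leqP n m;
    last by rewrite (le_trans (inc _ _ mn)) // lerDl.
  by apply: le_trans (dec _ _ nm); rewrite lerDl.
exists (sup (range x)) => n; apply/andP; split.
  apply: sup_upper_bound; last by exists n.
  by split; [exists (x 0%N), 0%N|exists (x 0%N + h 0%N) => _ [m _ <-]].
by apply: ge_sup; [exists (x 0%N), 0%N|move=> _ [m _ <-]].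
Qed.

(* [u dx - v dy] is closed, in the weak sense that [u] and [v] are
   differentiable at each point, with [u_y = - v_x]. *)
Definition closed_pair (u v : R -> R -> R) := forall x0 y0, exists a b c,
  forall e, 0 < e -> exists2 d, 0 < d & forall x y,
  `|x - x0| < d -> `|y - y0| < d ->
  `|u x y - (u x0 y0 + a * (x - x0) + b * (y - y0))| <= e * (`|x - x0| + `|y -
    y0|) /\
  `|v x y - (v x0 y0 - b * (x - x0) + c * (y - y0))| <= e * (`|x - x0| + `|y -
    y0|).

Variables (u v U V : R -> R -> R) (M : R).
Hypothesis uv : closed_pair u v.
Hypothesis uU : forall y, is_primitive M (u^~ y) (U^~ y).
Hypothesis vV : forall x, is_primitive M (v x) (V x).

(* The circulation of [u dx - v dy] around a square, [U] and [V] being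
   primitives of [u] in [x] and of [v] in [y]. *)
Definition circ a c l :=
  (U (a + l) c - U a c) - (U (a + l) (c + l) - U a (c + l))
  - (V (a + l) (c + l) - V (a + l) c) + (V a (c + l) - V a c).

(** The affine parts have zero circulation because the coefficient [b] occurs in [u] and [- b] in
    [v]. The remainder is at most [e / 4 * l] on the square, and each of the four sides has length
    [l]. *)
Lemma circ_local x0 y0 e : 0 < e -> exists2 d, 0 < d & forall a c l,
  0 <= l -> l < d -> - M < a -> a + l < M -> - M < c -> c + l < M ->
  a <= x0 <= a + l -> c <= y0 <= c + l -> `|circ a c l| <= e * l ^+ 2.
Proof.
move=> e0; have [al [be [ga H]]] := uv x0 y0.
have [d d0 dP] := H (e / 8) (divr_gt0 e0 (ltr0Sn _ 7)).
exists d => // a c l l0 ld a1 a2 c1 c2 ax cy.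
have near x y : a <= x <= a + l -> c <= y <= c + l ->
  `|u x y - (u x0 y0 + al * (x - x0) + be * (y - y0))| <= e / 4 * l /\
  `|v x y - (v x0 y0 - be * (x - x0) + ga * (y - y0))| <= e / 4 * l.
  move=> xa yc.
  have hx : `|x - x0| <= l by rewrite ler_norml; lra.
  have hy : `|y - y0| <= l by rewrite ler_norml; lra.
  have [h1 h2] := dP x y (le_lt_trans hx ld) (le_lt_trans hy ld).
  have h3 : e / 8 * (`|x - x0| + `|y - y0|) <= e / 4 * l.
    by rewrite (_ : e / 4 * l = e / 8 * (l + l)); [rewrite ler_wpM2l //;
      lra|field].
  by split; [exact: le_trans h1 h3|exact: le_trans h2 h3].
have sub (z z1 z2 w : R) : z1 = z2 -> `|z - z1| <= w ->
  `|z - z2| <= w by move=> ->.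
have la : a <= a + l by lra.
have lc : c <= c + l by lra.
have ha x : a <= x <= a + l ->
  `|u x c - (u x0 y0 + be * (c - y0) + al * (x - x0))| <= e / 4 * l.
  move=> xa; have [|h _] := near x c xa; first by lra.
  by apply: sub h; ring.
have hb x : a <= x <= a + l ->
  `|u x (c + l) - (u x0 y0 + be * (c + l - y0) + al * (x - x0))| <= e / 4 * l.
  move=> xa; have [|h _] := near x (c + l) xa; first by lra.
  by apply: sub h; ring.
have hc y : c <= y <= c + l ->
  `|v (a + l) y - (v x0 y0 - be * (a + l - x0) + ga * (y - y0))| <= e / 4 * l.
  by move=> yc; have [|_ h] := near (a + l) y _ yc; first by lra.
have hd y : c <= y <= c + l ->
  `|v a y - (v x0 y0 - be * (a - x0) + ga * (y - y0))| <= e / 4 * l.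
  by move=> yc; have [|_ h] := near a y _ yc; first by lra.
have := primitive_affine (uU c) la a1 a2 ha.
have := primitive_affine (uU (c + l)) la a1 a2 hb.
have := primitive_affine (vV (a + l)) lc c1 c2 hc.
have := primitive_affine (vV a) lc c1 c2 hd.
rewrite /circ.
set B := U (a + l) c - U a c; set T := U (a + l) (c + l) - U a (c + l).
set Ri := V (a + l) (c + l) - V (a + l) c; set Le := V a (c + l) - V a c.
rewrite !ler_norml.
set q1 := al * _ / 2; set q2 := ga * _ / 2.
have -> : (a + l - a = l)%R by ring.
have -> : (c + l - c = l)%R by ring.
move=> /andP[l1 l2] /andP[r1 r2] /andP[t1 t2] /andP[b1 b2].
have E : e / 4 * l * l = e * l ^+ 2 / 4 by field.
rewrite E in b1 b2 t1 t2 r1 r2 l1 l2.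
apply/andP; split; lra.
Qed.

Lemma circ_split a c l : circ a c l =
  circ a c (l / 2) + circ (a + l / 2) c (l / 2)
  + circ a (c + l / 2) (l / 2) + circ (a + l / 2) (c + l / 2) (l / 2).
Proof.
rewrite /circ.
have -> : a + l / 2 + l / 2 = a + l by field.
have -> : c + l / 2 + l / 2 = c + l by field.
ring.
Qed.

(** Goursat's subdivision: some quarter of a square carries at least a quarter of its circulation in
    absolute value. The chosen squares shrink to a point, where [circ_local] gives a
    contradiction. *)
Lemma circ_eq0 a c l : 0 < l -> - M < a -> a + l < M -> - M < c -> c + l < M ->
  circ a c l = 0.
Proof.
move=> l0 a1 a2 c1 c2; apply/eqP/contraT => E0.
set k := `|circ a c l|; have k0 : 0 < k by rewrite normr_gt0.
have step (s : (R * R) * R) : exists p : R * R,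
    [/\ p.1 = s.1.1 \/ p.1 = s.1.1 + s.2 / 2,
      p.2 = s.1.2 \/ p.2 = s.1.2 + s.2 / 2 &
     `|circ s.1.1 s.1.2 s.2| <= 4 * `|circ p.1 p.2 (s.2 / 2)| ].
  case: s => [[x y] h] /=.
  have [h1|h1] := leP `|circ x y h| (4 * `|circ x y (h / 2)|).
    by exists (x, y); split; [left|left|].
  have [h2|h2] := leP `|circ x y h| (4 * `|circ (x + h / 2) y (h / 2)|).
    by exists (x + h / 2, y); split; [right|left|].
  have [h3|h3] := leP `|circ x y h| (4 * `|circ x (y + h / 2) (h / 2)|).
    by exists (x, y + h / 2); split; [left|right|].
  exists (x + h / 2, y + h / 2); split; [by right|by right|rewrite /=].
  move: h1 h2 h3; rewrite (circ_split x y h).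
  set E1 := circ x y _; set E2 := circ (x + _) y _; set E3 := circ x (y + _) _.
  set E4 := circ (x + _) (y + _) _ => h1 h2 h3.
  have := ler_normD (E1 + E2 + E3) E4; have := ler_normD (E1 + E2) E3.
  have := ler_normD E1 E2; lra.
have [f fP] := choice step.
pose h n := l / 2 ^+ n.
have hS n : h n.+1 = h n / 2 by rewrite /h exprS invfM mulrA mulrAC.
have h0 n : 0 < h n by rewrite divr_gt0 // exprn_gt0.
pose s := fix s n := if n is m.+1 then f (s m, h m) else (a, c).
have [x0 x0P] : exists x0, forall n, (s n).1 <= x0 <= (s n).1 + h n.
  apply: nested_intervals => n; have h0n := h0 n; first exact: ltW.
    by have [[->|->] _ _] := fP (s n, h n); rewrite /= ?hS; lra.
  by have [[->|->] _ _] := fP (s n, h n); rewrite /= ?hS; lra.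
have [y0 y0P] : exists y0, forall n, (s n).2 <= y0 <= (s n).2 + h n.
  apply: nested_intervals => n; have h0n := h0 n; first exact: ltW.
    by have [_ [->|->] _] := fP (s n, h n); rewrite /= ?hS; lra.
  by have [_ [->|->] _] := fP (s n, h n); rewrite /= ?hS; lra.
have inside n : [/\ a <= (s n).1, (s n).1 + h n <= a + l,
  c <= (s n).2 & (s n).2 + h n <= c + l].
  elim: n => [|n [i1 i2 i3 i4]]; first by rewrite /= /h expr0 divr1.
  have h0n := h0 n; rewrite /= hS.
  by have [[->|->] [->|->] _] := fP (s n, h n); rewrite /=; split; lra.
have big n : k <= 4 ^+ n * `|circ (s n).1 (s n).2 (h n)|.
  elim: n => [|n IH]; first by rewrite expr0 mul1r /= /h expr0 divr1.
  apply: (le_trans IH); rewrite exprSr -mulrA ler_wpM2l ?exprn_ge0 // hS.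
  by have [_ _] := fP (s n, h n).
(* At stage [n] the circulation is at least [k / 4 ^+ n], while this constant bounds it by half of
   that on a square of side [l / 2 ^+ n]. *)
have e0 : 0 < k / 2 / l ^+ 2 by rewrite !divr_gt0 // exprn_gt0.
have [d d0 dP] := circ_local x0 y0 e0.
have [n hn] : exists n, h n < d.
  have : (fun n => (2^-1 : R) ^+ n) @ \oo --> (0 : R).
    by apply: cvg_expr; rewrite ger0_norm ?invr_ge0 // invf_lt1 // ltr1n.
  move=> /cvgrPdist_lt /(_ _ (divr_gt0 d0 l0)) [n _ /(_ n (leqnn n))] /=.
  rewrite sub0r normrN ger0_norm ?exprn_ge0 ?invr_ge0 // ltr_pdivlMr // => H.
  by exists n; rewrite /h mulrC -exprVn.
have [i1 i2 i3 i4] := inside n.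
have := dP (s n).1 (s n).2 (h n) (ltW (h0 n)) hn
  ltac:(lra) ltac:(lra) ltac:(lra) ltac:(lra) (x0P n) (y0P n).
have p0 : (0 : R) < 4 ^+ n by rewrite exprn_gt0.
move=> /(ler_wpM2l (ltW p0)) /(le_trans (big n)).
have -> : 4 ^+ n * (k / 2 / l ^+ 2 * h n ^+ 2) = k / 2.
  have -> : (4 : R) ^+ n = 2 ^+ n * 2 ^+ n by rewrite -exprMn; congr (_ ^+ n);
    ring.
  by rewrite /h; field; rewrite expf_neq0 //= gt_eqF.
lra.
Qed.

End Goursat.

Section ComplexDiff.
Variable R : realType.
Implicit Types (z w m c : R[i]) (f g p q : R[i] -> R[i]).
Local Notation N := (@Normc.normc R).
Local Notation Re := (@complex.Re R).
Local Notation Im := (@complex.Im R).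

Lemma normc_ge0 z : 0 <= N z.
Proof. by case: z => a b; exact: sqrtr_ge0. Qed.

Lemma normcD_le z w : N (z + w) <= N z + N w.
Proof. exact: le_normcD. Qed.

Lemma normcN_eq z : N (- z) = N z.
Proof. by case: z => a b /=; rewrite !sqrrN. Qed.

Lemma normc_conj z : N (z^*)%C = N z.
Proof. by case: z => a b /=; rewrite sqrrN. Qed.

Lemma Re_le_normc z : `|Re z| <= N z.
Proof. by case: z => a b /=;
  rewrite -sqrtr_sqr ler_wsqrtr // lerDl sqr_ge0. Qed.

Lemma Im_le_normc z : `|Im z| <= N z.
Proof. by case: z => a b /=;
  rewrite -[leLHS]sqrtr_sqr ler_wsqrtr // lerDr sqr_ge0. Qed.

Lemma normc_le_ReIm z : N z <= `|Re z| + `|Im z|.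
Proof.
case: z => a b /=.
rewrite -[leRHS]ger0_norm ?addr_ge0 // -sqrtr_sqr ler_wsqrtr //.
rewrite sqrrD !real_normK ?num_real //.
have : 0 <= `|a| * `|b| by rewrite mulr_ge0.
rewrite -mulr_natl; lra.
Qed.

Lemma normc_real (x : R) : N (x%:C)%C = `|x|.
Proof. by rewrite /= expr0n /= addr0 sqrtr_sqr. Qed.

Definition ccont f z := forall e : R, 0 < e -> exists2 d : R, 0 < d &
  forall w, N (w - z) < d -> N (f w - f z) < e.

Lemma ccont_const c z : ccont (fun=> c) z.
Proof. by move=> e e0; exists 1 => // w _; rewrite subrr Normc.normc0. Qed.

Lemma ccont_id z : ccont id z.
Proof. by move=> e e0; exists e. Qed.

Lemma ccont_near f g z (d : R) : 0 < d -> (forall w, N (w - z) < d ->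
  f w = g w) ->
  ccont f z -> ccont g z.
Proof.
move=> d0 fg cf e e0; have [d' d'0 H] := cf e e0.
exists (Num.min d d'); first by rewrite lt_min d0.
move=> w; rewrite lt_min => /andP[w1 w2].
by rewrite -!fg ?subrr ?Normc.normc0 //; exact: H.
Qed.

Lemma ccontD f g z : ccont f z -> ccont g z -> ccont (fun w => f w + g w) z.
Proof.
move=> cf cg e e0; have e2 : 0 < e / 2 by rewrite divr_gt0.
have [d1 d10 H1] := cf _ e2; have [d2 d20 H2] := cg _ e2.
exists (Num.min d1 d2); first by rewrite lt_min d10.
move=> w; rewrite lt_min => /andP[/H1 h1 /H2 h2].
have := normcD_le (f w - f z) (g w - g z); rewrite addrACA -opprD; lra.
Qed.

Lemma ccontM f g z : ccont f z -> ccont g z -> ccont (fun w => f w * g w) z.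
Proof.
move=> cf cg e e0.
set a := N (f z); set b := N (g z).
have a0 : 0 <= a := normc_ge0 _; have b0 : 0 <= b := normc_ge0 _.
have ea : 0 < e / 2 / (a + 1) by rewrite !divr_gt0 //; lra.
have eb : 0 < e / 2 / (b + 1) by rewrite !divr_gt0 //; lra.
have [d1 d10 H1] := cf _ eb; have [d2 d20 H2] := cg _ ea;
  have [d3 d30 H3] := cg 1 ltr01.
exists (Num.min d1 (Num.min d2 d3)); first by rewrite !lt_min d10 d20.
move=> w; rewrite !lt_min => /and3P[/H1 h1 /H2 h2 /H3 h3].
have -> : f w * g w - f z * g z = (f w - f z) * g w + f z * (g w - g z) by ring.
apply: (le_lt_trans (normcD_le _ _)); rewrite !Normc.normcM -/a.
have gw : N (g w) <= b + 1.
  have := normcD_le (g w - g z) (g z); rewrite subrK -/b; lra.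
have k1 : N (f w - f z) * N (g w) <= e / 2.
  move/ltW: h1; rewrite ler_pdivlMr; last by lra.
  by apply: le_trans; rewrite ler_wpM2l ?normc_ge0.
have k2 : a * N (g w - g z) < e / 2.
  move: h2; rewrite ltr_pdivlMr; last by lra.
  apply: le_lt_trans; rewrite mulrC ler_wpM2l ?normc_ge0 //; lra.
lra.
Qed.

Lemma ccont_comp_affine f c m z : ccont f (c + m * z) ->
  ccont (fun w => f (c + m * w)) z.
Proof.
move=> cf e e0; have [d d0 H] := cf e e0.
have m0 := normc_ge0 m.
exists (d / (N m + 1)); first by rewrite divr_gt0 //; lra.
move=> w; rewrite ltr_pdivlMr; last by lra.
move=> wz; apply: H.
have -> : c + m * w - (c + m * z) = m * (w - z) by ring.
apply: le_lt_trans wz; rewrite Normc.normcM mulrC ler_wpM2l ?normc_ge0 //; lra.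
Qed.

(* Complex differentiability, in Caratheodory's form. *)
Definition cdiff f z := exists2 p, ccont p z & forall w,
  f w - f z = p w * (w - z).

Lemma cdiff_ccont f z : cdiff f z -> ccont f z.
Proof.
move=> [p cp fp].
apply: (@ccont_near (fun w => f z + p w * (w + - z)) _ _ 1 ltr01).
  by move=> w _; rewrite -fp addrC subrK.
apply: ccontD; first exact: ccont_const.
apply: ccontM => //; apply: ccontD; [exact: ccont_id|exact: ccont_const].
Qed.

Lemma cdiff_ext f g z : f =1 g -> cdiff f z -> cdiff g z.
Proof. by move=> fg [p cp fp]; exists p => // w; rewrite -!fg. Qed.

Lemma cdiff_const c z : cdiff (fun=> c) z.
Proof. by exists (fun=> 0); [exact: ccont_const|move=> w;
  rewrite subrr mul0r]. Qed.

Lemma cdiffB f g z : cdiff f z -> cdiff g z -> cdiff (fun w => f w - g w) z.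
Proof.
move=> [p cp fp] [q cq gq]; exists (fun w => p w + - 1 * q w).
  by apply: ccontD => //; apply: ccontM => //; exact: ccont_const.
by move=> w; rewrite mulrDl -fp -mulrA -gq; ring.
Qed.

Lemma cdiffM f g z : cdiff f z -> cdiff g z -> cdiff (fun w => f w * g w) z.
Proof.
move=> df dg; have cg := cdiff_ccont dg.
have [p cp fp] := df; have [q cq gq] := dg.
exists (fun w => p w * g w + f z * q w).
  by apply: ccontD; apply: ccontM => //; exact: ccont_const.
by move=> w; rewrite mulrDl mulrAC -fp -mulrA -gq; ring.
Qed.

Lemma cdiff_comp_affine f c m z : cdiff f (c + m * z) ->
  cdiff (fun w => f (c + m * w)) z.
Proof.
move=> [p cp fp]; exists (fun w => p (c + m * w) * m).
  by apply: ccontM; [exact: ccont_comp_affine|exact: ccont_const].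
by move=> w; rewrite fp -mulrA; congr (_ * _); ring.
Qed.

Lemma cdiff_conj f z : cdiff f (z^*)%C -> cdiff (fun w => ((f (w^*)%C)^*)%C) z.
Proof.
move=> [p cp fp]; exists (fun w => ((p (w^*)%C)^*)%C).
  move=> e e0; have [d d0 H] := cp e e0; exists d => // w wz.
  by rewrite -rmorphB normc_conj; apply: H; rewrite -rmorphB normc_conj.
by move=> w; rewrite -rmorphB fp rmorphM rmorphB /= !conjcK.
Qed.

(* Also at a real point the extension by zero is differentiable, because [f]
   vanishes on the real line and hence has derivative 0 there. *)
Lemma cdiff_glue f : (forall z, cdiff f z) -> (forall x : R, f (x%:C)%C = 0) ->
  forall z, cdiff (fun w => if 0 < Im w then f w else 0) z.
Proof.
move=> df f0 z; set h := fun w => _.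
have [p cp fp] := df z.
have local (w : R[i]) : N (w - z) < `|Im z| -> (0 < Im w) = (0 < Im z).
  move=> wz; have := le_lt_trans (Im_le_normc (w - z)) wz.
  case: (w) => a b; case: (z) => a' b' /=.
  by move=> H; apply/idP/idP => H'; move: H; rewrite ltr_norml;
    case: (ltrgt0P b') => ? /andP[]; lra.
have [z0|z0] := eqVneq (Im z) 0; last first.
  have zp : 0 < `|Im z| by rewrite normr_gt0.
  exists (fun w => if w == z then (if 0 < Im z then p z else 0) else (h w - h
    z) / (w - z)); last first.
    move=> w; case: eqVneq => [->|wz]; first by rewrite !subrr mulr0.
    by rewrite mulfVK // subr_eq0.
  apply: (@ccont_near (fun w => if 0 < Im z then p w else 0) _ _ _ zp).
    move=> w /local lw; case: eqVneq => [->//|wz].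
    rewrite /h lw; case: ifP => _; last by rewrite subrr mul0r.
    by rewrite fp mulfK // subr_eq0.
  by case: (0 < Im z); [exact: cp|exact: ccont_const].
have fz : f z = 0 by case: (z) z0 => a b /= ->; exact: f0.
have pz : p z = 0.
  apply: Normc.eq0_normc; apply/eqP; rewrite eq_le normc_ge0 andbT.
  apply/ler_addgt0Pr => e e0; rewrite add0r; have [d d0 H] := cp e e0.
  pose w := z + ((d / 2)%:C)%C.
  have d2 : 0 < d / 2 by rewrite divr_gt0.
  have wz : w - z = ((d / 2)%:C)%C by rewrite /w addrC addKr.
  have pw : p w = 0.
    have := fp w; rewrite fz wz.
    have -> : f w = 0 by rewrite /w; case: (z) z0 => a b /= ->;
      rewrite -[X in f X]/((_%:C)%C + (_%:C)%C) -rmorphD f0.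
    rewrite subrr => /esym/eqP; rewrite mulf_eq0 => /orP[/eqP//|].
    by rewrite eq_complex /= gt_eqF.
  have := H w; rewrite wz normc_real gtr0_norm // pw sub0r normcN_eq => hh.
  by apply: ltW; apply: hh; lra.
exists (fun w => if 0 < Im w then p w else 0).
  move=> e e0; have [d d0 H] := cp e e0; exists d => // w wz.
  rewrite z0 ltxx; case: ifP => _; last by rewrite subrr Normc.normc0.
  by rewrite -[X in _ - X]pz; exact: H.
move=> w; rewrite /h z0 ltxx subr0; case: ifP => _; last by rewrite mul0r.
by rewrite -fp fz subr0.
Qed.

Lemma ccont_Re_horizontal f y : (forall z, ccont f z) ->
  continuous (fun x : R => Re (f (x +i* y)%C)) .
Proof.
move=> cf x; apply/cvgrPdist_lt => e e0.
have [d d0 H] := cf (x +i* y)%C e e0.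
exists d => // x' /= xx'.
have -> : Re (f (x +i* y)%C) - Re (f (x' +i* y)%C) =
  - Re (f (x' +i* y)%C - f (x +i* y)%C).
  by case: (f _) => a b; case: (f _) => a' b' /=; ring.
rewrite normrN; apply: (le_lt_trans (Re_le_normc _)); apply: H.
by rewrite /= subrr expr0n /= addr0 sqrtr_sqr distrC.
Qed.

Lemma ccont_Im_vertical f x : (forall z, ccont f z) ->
  continuous (fun y : R => Im (f (x +i* y)%C)) .
Proof.
move=> cf y; apply/cvgrPdist_lt => e e0.
have [d d0 H] := cf (x +i* y)%C e e0.
exists d => // y' /= yy'.
have -> : Im (f (x +i* y)%C) - Im (f (x +i* y')%C) =
  - Im (f (x +i* y')%C - f (x +i* y)%C).
  by case: (f _) => a b; case: (f _) => a' b' /=; ring.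
rewrite normrN; apply: (le_lt_trans (Im_le_normc _)); apply: H.
by rewrite /= subrr expr0n /= add0r sqrtr_sqr distrC.
Qed.

Lemma cdiff_closed_pair f : (forall z, cdiff f z) ->
  closed_pair (fun x y => Re (f (x +i* y)%C)) (fun x y => Im (f (x +i* y)%C)).
Proof.
move=> df x0 y0; have [p cp fp] := df (x0 +i* y0)%C.
set z0 := (x0 +i* y0)%C in cp fp *.
(* The Cauchy-Riemann equations: [p z0] is the derivative, so [u_x = v_y = Re (p z0)] and
   [u_y = - v_x = - Im (p z0)]. *)
exists (Re (p z0)), (- Im (p z0)), (Re (p z0)) => e e0.
have [d d0 H] := cp e e0; exists (d / 2); first by rewrite divr_gt0.
move=> x y xd yd; set w := (x +i* y)%C.
have wz : N (w - z0) <= `|x - x0| + `|y - y0| := normc_le_ReIm (w - z0).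
have small : N (p w - p z0) <= e by apply/ltW/H; lra.
have rest : N (f w - f z0 - p z0 * (w - z0)) <= e * (`|x - x0| + `|y - y0|).
  rewrite fp -mulrBl Normc.normcM; apply: ler_pM => //; exact: normc_ge0.
have hr := le_trans (Re_le_normc _) rest;
  have hi := le_trans (Im_le_normc _) rest.
split.
  apply: le_trans hr; rewrite le_eqVlt; apply/orP; left; apply/eqP; congr `|_|.
  by case: (f w) => a b; case: (f z0) => a' b'; case: (p z0) => a2 b2 /=; ring.
apply: le_trans hi; rewrite le_eqVlt; apply/orP; left; apply/eqP; congr `|_|.
by case: (f w) => a b; case: (f z0) => a' b'; case: (p z0) => a2 b2 /=; ring.
Qed.

Lemma conj_mul_ge0_Re z : Re (z * (z^*)%C) = Re z ^+ 2 + Im z ^+ 2.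
Proof. by case: z => a b /=; ring. Qed.

(* [P z * conj (P (conj z))] is holomorphic and equals [|P| ^ 2] on the real
   line; Goursat's theorem on the square [-1, 1] x [0, 2] makes its integral
   over [-1, 1] vanish. *)
Lemma cdiff_compact_support P : (forall z, cdiff P z) ->
  (forall z, 1 <= `|Re z| -> P z = 0) -> (forall z, 1 <= `|Im z| -> P z = 0) ->
  P 0 = 0.
Proof.
move=> dP Pre Pim.
pose f z := P z * ((P (z^*)%C)^*)%C.
have df z : cdiff f z by apply: cdiffM => //; exact: cdiff_conj.
have fre z : 1 <= `|Re z| -> f z = 0 by move=> h; rewrite /f Pre // mul0r.
have fim z : 1 <= `|Im z| -> f z = 0 by move=> h; rewrite /f Pim // mul0r.
have cf z : ccont f z := cdiff_ccont (df z).
have uv := cdiff_closed_pair df.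
set u := fun x y : R => _ in uv; set v := fun x y : R => _ in uv.
(* Any bound would do that keeps the square [[-1, 1] x [0, 2]] strictly inside, such as [3]. *)
have [U uU] : exists U : R -> R -> R, forall y, is_primitive 3 (u^~ y) (U^~ y).
  have H y : exists G, is_primitive 3 (u^~ y) G.
    exact: primitive_exists (ccont_Re_horizontal cf).
  by have [U HU] := choice H; exists (fun x y => U y x).
have [V vV] : exists V : R -> R -> R, forall x, is_primitive 3 (v x) (V x).
  have H x : exists G, is_primitive 3 (v x) G.
    exact: primitive_exists (ccont_Im_vertical cf).
  by have [V HV] := choice H; exists V.
have const (g G : R -> R) (a b : R) : is_primitive 3 g G -> -3 < a -> a <= b ->
  b < 3 ->
    (forall x, a <= x <= b -> g x = 0) -> G b = G a.
  move=> gG a3 ab b3 g0.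
  have := @primitive_bound R 3 g G a b 0 gG ab a3 b3.
  rewrite mul0r normr_le0 subr_eq0 => H; apply/eqP; apply: H => x xab.
  by rewrite g0 // normr0.
have := @circ_eq0 R u v U V 3 uv uU vV (-1) 0 2.
rewrite /circ add0r (_ : -1 + 2 = 1 :> R); last by ring.
(* On the top, right and left sides the real or the imaginary part has absolute value at least [1],
   so [f] vanishes there and only the real segment remains. *)
have -> : U 1 2 = U (-1) 2.
  apply: (const _ _ _ _ (uU 2)); [lra|lra|lra|move=> x _].
  by rewrite /u fim //= ger0_norm //; lra.
have -> : V 1 2 = V 1 0.
  apply: (const _ _ _ _ (vV 1)); [lra|lra|lra|move=> x _].
  by rewrite /v fre //= normr1.
have -> : V (-1) 2 = V (-1) 0.
  apply: (const _ _ _ _ (vV (-1))); [lra|lra|lra|move=> x _].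
  by rewrite /v fre //= normrN normr1.
move=> HE.
have U10 : U 1 0 = U (-1) 0 by have :=
  HE ltac:(lra) ltac:(lra) ltac:(lra) ltac:(lra) ltac:(lra); lra.
have uE x : u x 0 = Re (P (x%:C)%C) ^+ 2 + Im (P (x%:C)%C) ^+ 2.
  by rewrite /u /f conjc_real conj_mul_ge0_Re.
have u0 : u 0 0 = 0.
  apply: (primitive_pos_zero (uU 0) _ _ _ _ U10); [|lra|lra| |lra].
    exact: (ccont_Re_horizontal cf).
  by move=> x _; rewrite uE addr_ge0 ?sqr_ge0.
have : Normc.normc (P 0) = 0.
  move: u0; rewrite uE -[(0%:C)%C]/(0 : R[i]); case: (P 0) => a b /= ->;
    exact: sqrtr0.
exact: Normc.eq0_normc.
Qed.

(* With [h] the extension of [f] by zero below the real line, the product of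
   the [h ('i + w z)], for [w] a fourth root of unity, is entire with support
   in a square. *)
Lemma cdiff_real_zero f : (forall z, cdiff f z) ->
  (forall x : R, f (x%:C)%C = 0) ->
  f 'i%C = 0.
Proof.
move=> df f0.
pose h w := if 0 < Im w then f w else 0.
have dh z : cdiff h z by exact: cdiff_glue.
have h0 z : Im z <= 0 -> h z = 0 by rewrite /h leNgt => /negPf ->.
(* At [z = x + i y] the arguments have imaginary parts [1 + y], [1 + x], [1 - y], [1 - x], all
   positive only inside the square; at [0] every factor is [f 'i]. *)
pose P z := h ('i%C + 1 * z) * h ('i%C + 'i%C * z) * h ('i%C + -1 * z) * h
  ('i%C + - 'i%C * z).
have P0 : P 0 = 0.
  apply: cdiff_compact_support.
  - by move=> z; rewrite /P; do 3?[apply: cdiffM]; exact: cdiff_comp_affine.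
  - move=> [x y] /=; rewrite /P ler_normr => /orP[x1|x1].
      by rewrite (h0 ('i%C + - 'i%C * _)) ?mulr0 //=; lra.
    by rewrite (h0 ('i%C + 'i%C * _)) ?(mulr0, mul0r) //=; lra.
  - move=> [x y] /=; rewrite /P ler_normr => /orP[x1|x1].
      by rewrite (h0 ('i%C + -1 * _)) ?(mulr0, mul0r) //=; lra.
    by rewrite (h0 ('i%C + 1 * _)) ?(mulr0, mul0r) //=; lra.
move: P0; rewrite /P !mulr0 addr0.
have -> : h 'i%C = f 'i%C by rewrite /h /= ltr01.
by move=> /eqP; rewrite !mulf_eq0 !orbb => /eqP.
Qed.

End ComplexDiff.

(** * KMS states *)

Section ComplexExp.
Variable R : realType.
Implicit Types (z w : R[i]).
Local Notation N := (@Normc.normc R).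
Local Notation Re := (@complex.Re R).
Local Notation Im := (@complex.Im R).

Definition cexp z : R[i] :=
  (expR (Re z) * cos (Im z) +i* (expR (Re z) * sin (Im z)))%C.

Lemma cexpD z w : cexp (z + w) = cexp z * cexp w.
Proof.
case: z => a b; case: w => c d; rewrite /cexp /= expRD cosD sinD.
by apply/eqP; rewrite eq_complex /=; apply/andP; split; apply/eqP; ring.
Qed.

Lemma cexp0 : cexp 0 = 1.
Proof. by rewrite /cexp /= expR0 cos0 sin0 mulr0 mulr1. Qed.

Lemma cexp_real (x : R) : cexp (x%:C)%C = ((expR x)%:C)%C.
Proof. by rewrite /cexp /= cos0 sin0 mulr0 mulr1. Qed.

Lemma cexp_imag (x : R) : cexp ('i%C * (x%:C)%C) = (cos x +i* sin x)%C.
Proof.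
have -> : 'i%C * (x%:C)%C = (0 +i* x)%C :> R[i].
  by apply/eqP; rewrite eq_complex /=; apply/andP; split; apply/eqP; ring.
by rewrite /cexp /= expR0 !mul1r.
Qed.

Lemma is_derive_littleo (g : R -> R) (x dg : R) : is_derive x 1 g dg ->
  forall e : R, 0 < e -> exists2 d : R, 0 < d &
  forall s, `|s| < d -> `|g (x + s) - g x - dg * s| <= e * `|s|.
Proof.
move=> [gd <-] e e0.
have : (fun h => h^-1 *: (g (h *: 1 + x) - g x)) @ 0^' --> 'D_1 g x by exact:
  gd.
move=> /cvgrPdist_lt /(_ e e0); rewrite near_withinE => /nbhs_ballP[d /= d0 dP].
exists d => // s sd.
have [->|s0] := eqVneq s 0;
  first by rewrite addr0 subrr mulr0 subrr normr0 mulr0.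
have := dP s; rewrite -ball_normE /= sub0r normrN => /(_ sd s0).
rewrite /GRing.scale /= mulr1 (addrC s) => h.
have -> : g (x + s) - g x - 'D_1 g x * s =
  - ('D_1 g x - s^-1 * (g (x + s) - g x)) * s.
  by field.
by rewrite normrM normrN ler_wpM2r // ltW.
Qed.

Lemma cexp_near0 (e : R) : 0 < e -> exists2 d : R, 0 < d &
  forall h : R[i], N h < d -> N (cexp h - 1 - h) <= e * N h.
Proof.
move=> e0.
(* The errors of the real and imaginary parts come to [3 * (e' * n)] and [5 * (e' * n)], whence
   [e / 8]; [e' <= 1] serves the crude bounds on [expR a - 1], [sin b] and [1 + a]. *)
have [e' [e'0 e'1 e'e]] : exists e' : R, [/\ 0 < e', e' <= 1 & e' <= e / 8].
  exists (Num.min 1 (e / 8)).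
  by split; rewrite ?lt_min ?ltr01 ?divr_gt0 // ge_min lexx ?orbT.
have [d1 d10 H1] := is_derive_littleo (is_derive_expR 0) e'0.
have [d2 d20 H2] := is_derive_littleo (is_derive_cos 0) e'0.
have [d3 d30 H3] := is_derive_littleo (is_derive_sin 0) e'0.
exists (Num.min (Num.min d1 d2) (Num.min d3 e')).
  by rewrite !lt_min d10 d20 d30 e'0.
case=> a b hd.
have ha : `|a| <= N (a +i* b)%C := Re_le_normc (a +i* b)%C.
have hb : `|b| <= N (a +i* b)%C := Im_le_normc (a +i* b)%C.
set n := N _ in hd ha hb *.
move: hd; rewrite !lt_min => /andP[/andP[n1 n2] /andP[n3 n4]].
have := H1 a (le_lt_trans ha n1).
have := H2 b (le_lt_trans hb n2).
have := H3 b (le_lt_trans hb n3).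
rewrite !(add0r, expR0, cos0, sin0, oppr0, mul0r, subr0, addr0,
  mul1r) => s3 s2 s1.
have cb : `|cos b| <= 1.
  by rewrite ler_norml cos_geN1 cos_le1.
have ea : `|expR a - 1| <= 2 * `|a|.
  have -> : expR a - 1 = (expR a - 1 - a) + a by rewrite subrK.
  apply: (le_trans (ler_normD _ _)).
  have : e' * `|a| <= `|a| by rewrite ler_piMl.
  lra.
have sb : `|sin b| <= 2 * `|b|.
  have -> : sin b = (sin b - b) + b by rewrite subrK.
  apply: (le_trans (ler_normD _ _)).
  have : e' * `|b| <= `|b| by rewrite ler_piMl.
  lra.
apply: (le_trans (normc_le_ReIm _)) => /=.
have n0 : 0 <= n := normc_ge0 _.
have e'n : e' * n <= e / 8 * n by rewrite ler_wpM2r.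
have e'a : e' * `|a| <= e' * n by rewrite ler_wpM2l // ltW.
have e'b : e' * `|b| <= e' * n by rewrite ler_wpM2l // ltW.
have K1 : `|expR a * cos b - 1 - a| <= 3 * (e' * n).
  have -> : expR a * cos b - 1 - a =
    (expR a - 1 - a) * cos b + (1 + a) * (cos b - 1) by ring.
  apply: (le_trans (ler_normD _ _)); rewrite !normrM.
  have : `|expR a - 1 - a| * `|cos b| <= `|expR a - 1 - a| by rewrite ler_piMr.
  have : `|1 + a| * `|cos b - 1| <= 2 * `|cos b - 1|.
    apply: ler_wpM2r => //; apply: (le_trans (ler_normD _ _)); rewrite normr1;
      lra.
  lra.
have K2 : `|expR a * sin b - 0 - b| <= 5 * (e' * n).
  have -> : expR a * sin b - 0 - b = (expR a - 1) * sin b + (sin b - b) by ring.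
  apply: (le_trans (ler_normD _ _)); rewrite !normrM.
  have : `|expR a - 1| * `|sin b| <= (2 * e') * (2 * n).
    apply: ler_pM => //; [apply: (le_trans ea)|apply: (le_trans sb)]; lra.
  lra.
move: K2; rewrite subr0 => K2; lra.
Qed.

Lemma cdiff_cexp z : cdiff cexp z.
Proof.
exists (fun w => if w == z then cexp z else (cexp w - cexp z) / (w - z));
  last first.
  by move=> w; case: eqVneq => [->|wz];
    rewrite ?subrr ?mulr0 // mulfVK // subr_eq0.
move=> e e0; rewrite eqxx.
have K0 : 0 < N (cexp z) + 1 by have := normc_ge0 (cexp z); lra.
have [d d0 H] := cexp_near0 (divr_gt0 e0 K0); exists d => // w wz.
case: eqVneq => [_|wnz]; first by rewrite subrr Normc.normc0.
have hn : w - z != 0 by rewrite subr_eq0.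
have -> : (cexp w - cexp z) / (w - z) - cexp z =
  cexp z * (cexp (w - z) - 1 - (w - z)) / (w - z).
  have -> : cexp w = cexp z * cexp (w - z) by rewrite -cexpD addrC subrK.
  by field.
have n0 : 0 < N (w - z).
  by rewrite lt_def normc_ge0 andbT; apply: contra_neq hn => /Normc.eq0_normc.
rewrite !Normc.normcM Normc.normcV ltr_pdivrMr //.
have c0 := normc_ge0 (cexp z).
apply: (le_lt_trans (ler_wpM2l c0 (H _ wz))).
rewrite mulrA ltr_pM2r // mulrCA -{2}[e]mulr1 ltr_pM2l // ltr_pdivrMr // mul1r;
  lra.
Qed.

End ComplexExp.

Section Derivable.
Variables (R : realType) (V : normedModType R[i]).
Local Notation N := (@Normc.normc R).

Lemma cdiff_derivable_scale (f : R[i] ->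
  R[i]) (a : V) (z : (R[i] : numFieldType)^o) :
  cdiff f z -> derivable (fun w : (R[i] : numFieldType)^o => f w *: a) z 1.
Proof.
move=> [p cp fp]; apply/cvg_ex; exists (p z *: a).
apply/cvgrPdist_lt => _ /complex_gt0P[e e0 ->].
have K0 : 0 < rnorm a + 1 by have := rnorm_ge0 a; lra.
have [d d0 H] := cp _ (divr_gt0 e0 K0).
rewrite near_withinE; apply/nbhs_ballP; exists (d%:C)%C;
  first by rewrite /= ltcR.
move=> h; rewrite -ball_normE /= sub0r normrN => hd h0.
have nE (w : (R[i] : numFieldType)^o) : `|w| = ((N w)%:C)%C by case: w.
rewrite nE ltcR in hd.
rewrite -scalerBl fp scalerA /GRing.scale /= mulr1 addrK mulrCA mulVf // mulr1.
rewrite -scalerBl rnormE ltcR rnormZ -opprB normcN_eq.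
have := H (h + z); rewrite addrK => /(_ hd).
rewrite ltr_pdivlMr //; have := rnorm_ge0 a;
  have := normc_ge0 (p (h + z) - p z); nra.
Qed.

Lemma derivable_cdiff (F : (R[i] : numFieldType)^o -> V) (Psi : V ->
  R[i]) (K : R) z :
  (forall a b, Psi (a + b) = Psi a + Psi b) ->
  (forall (x : R[i]) a, Psi (x *: a) = x * Psi a) ->
  (forall a, N (Psi a) <= K * rnorm a) ->
  derivable F z 1 -> cdiff (fun w => Psi (F w)) z.
Proof.
move=> PD PZ PK dF.
have PB a b : Psi (a - b) = Psi a - Psi b by rewrite PD -scaleN1r PZ mulN1r.
exists (fun w => if w == z then Psi ('D_1 F z) else (Psi (F w) - Psi (F z)) /
  (w - z)); last first.
  by move=> w; case: eqVneq => [->|wz];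
    rewrite ?subrr ?mulr0 // mulfVK // subr_eq0.
move=> e e0; rewrite eqxx.
have K0 : 0 < `|K| + 1 by have := normr_ge0 K; lra.
have : (fun h => h^-1 *: (F (h *: 1 + z) - F z)) @ 0^' --> 'D_1 F z by exact:
  dF.
have eK : 0 < ((e / (`|K| + 1))%:C)%C by rewrite ltcR divr_gt0.
move=> /cvgrPdist_lt /(_ _ eK);
  rewrite near_withinE => /nbhs_ballP[_ /= /complex_gt0P[d d0 ->] dP].
exists d => // w wz; case: eqVneq => [_|wnz];
  first by rewrite subrr Normc.normc0.
have nE (x : (R[i] : numFieldType)^o) : `|x| = ((N x)%:C)%C by case: x.
have := dP (w - z); rewrite -ball_normE /= sub0r normrN nE ltcR => /(_ wz).
rewrite subr_eq0 => /(_ wnz).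
rewrite /GRing.scale /= mulr1 subrK rnormE ltcR ltr_pdivlMr // => h.
have -> : (Psi (F w) - Psi (F z)) / (w - z) - Psi ('D_1 F z) =
  - Psi ('D_1 F z - (w - z)^-1 *: (F w - F z)).
  by rewrite PB PZ PB opprB mulrC.
rewrite normcN_eq; apply: (le_lt_trans (PK _)).
apply: le_lt_trans h; rewrite mulrC ler_wpM2l ?rnorm_ge0 //.
by apply: (le_trans (ler_norm K)); lra.
Qed.

End Derivable.

Lemma closed_functional_eq (R : realType) (V : normedModType R[i])
    (f g : V -> R[i]) (K K' : R) :
  (forall a b, f (a - b) = f a - f b) ->
    (forall a, Normc.normc (f a) <= K * rnorm a) ->
  (forall a b, g (a - b) = g a - g b) ->
    (forall a, Normc.normc (g a) <= K' * rnorm a) ->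
  closed [set a | f a = g a].
Proof.
move=> fB fK gB gK.
have cont (h : V -> R[i]) (M : R) : (forall a b, h (a - b) = h a - h b) ->
    (forall a, Normc.normc (h a) <= M * rnorm a) ->
    continuous (h : V -> (R[i] : numFieldType)^o).
  move=> hB hM; apply: (@lipschitz_continuous _ _ _ _ (M%:C)%C) => x y.
  have nE (z : (R[i] : numFieldType)^o) : `|z| =
    ((Normc.normc z)%:C)%C by case: z.
  by rewrite -hB nE rnormE -rmorphM lecR.
exact: (@closed_equalizer _ V (R[i] : numFieldType)^o f g (cont _ _ fB fK)
  (cont _ _ gB gK)).
Qed.

Section KMS.
Variables (R : realType) (k : nat) (L : kgraph k) (r : 'I_k -> R).
Variables (A : cstarAlgType R) (t : mor L -> A) (alpha : R -> A -> A).
Hypotheses (TCK : is_TCK_family t) (gen : generates t).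
Hypothesis dyn : is_toeplitz_dynamics t r alpha.
Implicit Types (l m : mor L) (a b : A) (x s : R) (phi : A -> R[i]).
Local Notation e := (tck_unit t).

Let e1 : is_unit_elt e := tck_unitP TCK gen.
Let alpha_hom s : is_star_hom (alpha s). Proof. by case: dyn => -[]. Qed.

Definition freq l : R := \sum_i r i * (deg l i)%:R.

Definition homogeneous x a :=
  forall s, alpha s a = cexp ('i%C * ((s * x)%:C)%C) *: a.

Lemma homogeneous_gen l : homogeneous (freq l) (t l).
Proof. by move=> s; rewrite cexp_imag; case: dyn => _; exact. Qed.

Lemma homogeneous_adj x a : homogeneous x a -> homogeneous (- x) a^#.
Proof.
move=> ha s; have [_ _ _ ->] := alpha_hom s.
rewrite ha adjZ; congr (_ *: _); rewrite !cexp_imag mulrN cosN sinN.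
by simpc.
Qed.

Lemma homogeneousM x y a b : homogeneous x a -> homogeneous y b ->
  homogeneous (x + y) (a ** b).
Proof.
move=> ha hb s; have [_ _ -> _] := alpha_hom s.
by rewrite ha hb amulZl amulZr scalerA -cexpD -mulrDr -rmorphD mulrDr.
Qed.

Lemma homogeneous_span l m : homogeneous (freq l - freq m) (t l ** (t m)^#).
Proof. by apply: homogeneousM; [|apply: homogeneous_adj];
  exact: homogeneous_gen. Qed.

Lemma homogeneous_extension x a : homogeneous x a ->
  analytic_extension alpha a (fun z => cexp ('i%C * (x%:C)%C * z) *: a).
Proof.
move=> ha; split=> [z|s].
  apply: (@cdiff_derivable_scale _ _ (fun w => cexp ('i%C * (x%:C)%C * w))).
  apply: (@cdiff_ext _ (fun w => cexp (0 + 'i%C * (x%:C)%C * w))).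
    by move=> w; rewrite add0r.
  by apply: cdiff_comp_affine; exact: cdiff_cexp.
by rewrite ha -mulrA -rmorphM mulrC [x * s]mulrC mulrC.
Qed.

Lemma cexp_at_i x : cexp ('i%C * (x%:C)%C * (0 +i* 1)%C) = ((expR (- x))%:C)%C.
Proof.
rewrite -cexp_real; congr cexp; apply/eqP; rewrite eq_complex /=.
by apply/andP; split; apply/eqP; ring.
Qed.

(** A homogeneous [a] has an explicit entire extension. The KMS condition applies when [b] is some
    [t l ** (t m)^#], and both sides are linear and continuous in [b], so [b] need not be analytic
    in the end. *)
Lemma kms_homogeneous phi x a : is_KMS_state alpha 1 phi -> homogeneous x a ->
  forall b, phi (a ** b) = ((expR (- x))%:C)%C * phi (b ** a).
Proof.
move=> [phis kms] ha b; have [phiD phiZ _ _] := phis.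
apply: (tck_span TCK gen (S :=
  [set b | phi (a ** b) = ((expR (- x))%:C)%C * phi (b ** a)])).
- by rewrite /= amul0l amul0r (functional0 phiZ) mulr0.
- by move=> y z /= hy hz; rewrite amulDr amulDl !phiD hy hz mulrDr.
- by move=> c y /= hy; rewrite amulZr amulZl !phiZ hy mulrCA.
- apply: (@closed_functional_eq _ _ (fun b => phi (a ** b)) (fun b =>
  ((expR (- x))%:C)%C * phi (b ** a))
      (rnorm a) (expR (- x) * rnorm a)) => [y z|y|y z|y].
  + by rewrite amulBr (functionalB phiD phiZ).
  + by apply: (le_trans (state_bound e1 _ phis)); exact: rnormM.
  + by rewrite amulBl (functionalB phiD phiZ) mulrBr.
  + rewrite Normc.normcM normc_real ger0_norm ?expR_ge0 // -mulrA ler_wpM2l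
    ?expR_ge0 //.
    by apply: (le_trans (state_bound e1 _ phis)); rewrite mulrC rnormM.
move=> l m /=.
rewrite (kms _ _ _ (homogeneous_extension ha)).
  by rewrite /= cexp_at_i amulZr phiZ.
by eexists; exact: homogeneous_extension (homogeneous_span l m).
Qed.

Lemma kms_range_proj phi l : is_KMS_state alpha 1 phi ->
  phi (range_proj t l) = ((expR (- freq l))%:C)%C * phi (t (idp (src l))).
Proof.
move=> kms; rewrite /range_proj (kms_homogeneous kms (homogeneous_gen l)).
by rewrite (tck_star_self TCK).
Qed.

Section Converse.
Variable psi : A -> R[i].
Hypothesis psis : is_state psi.
Hypothesis psih : forall l m b, psi (t l ** (t m)^# ** b) =
  ((expR (- (freq l - freq m)))%:C)%C * psi (b ** (t l ** (t m)^#)).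

Let psiD a b : psi (a + b) = psi a + psi b. Proof. by case: psis. Qed.
Let psiZ (z : R[i]) a : psi (z *: a) = z * psi a. Proof. by case: psis. Qed.

(** For [h = t l ** (t m)^#] of frequency [x], [psih] at the unit reads [psi h = exp (- x) psi h].
    So [psi h = 0] unless [x = 0], in which case the dynamics fixes [h]. *)
Lemma kms_state_invariant s a : psi (alpha s a) = psi a.
Proof.
have [aD aZ aM aA] := alpha_hom s.
apply: (tck_span TCK gen (S := [set a | psi (alpha s a) = psi a])).
- by have := aZ 0 0; rewrite !scale0r /= => ->.
- by move=> y z /= hy hz; rewrite aD !psiD hy hz.
- by move=> c y /= hy; rewrite aZ !psiZ hy.
- apply: (@closed_functional_eq _ _ (fun b => psi (alpha s b)) psi 1 1) =>
  [y z|y|y z|y].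
  + by rewrite -[- z]scaleN1r aD aZ scaleN1r (functionalB psiD psiZ).
  + rewrite mul1r; apply: (le_trans (state_bound e1 _ psis)).
    exact: (starhom_contractive e1 (alpha_hom s)).
  + by rewrite (functionalB psiD psiZ).
  + by rewrite mul1r; exact: (state_bound e1).
move=> l m /=; rewrite homogeneous_span psiZ.
have := psih l m e; rewrite (e1 _).1 (e1 _).2.
set x := freq l - freq m => h.
have [->|x0] := eqVneq x 0; first by rewrite mulr0 mulr0 cexp0 mul1r.
suff -> : psi (t l ** (t m)^#) = 0 by rewrite mulr0.
apply/eqP; move/eqP : h; rewrite -subr_eq0 -{1}[psi _]mul1r -mulrBl mulf_eq0.
case/orP=> // /eqP/subr0_eq[]; rewrite -[X in X = _]expR0 => /expR_inj/esym/eqP.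
by rewrite oppr_eq0 (negPf x0).
Qed.

(* [z |-> exp (i x z) psi (F z ** h)] is entire and constant on the real line,
   hence takes the same value at [0] and [i]. *)
Lemma kms_of_homogeneous : is_KMS_state alpha 1 psi.
Proof.
split=> // a b F [dF FE] _.
have a0 : F 0 = a by have := FE 0; case: dyn => -[_ a0 _ _] _; rewrite a0.
apply: (tck_span TCK gen (S :=
  [set b | psi (a ** b) = psi (b ** F (0 +i* 1)%C)])).
- by rewrite /= amul0l amul0r.
- by move=> y z /= hy hz; rewrite amulDr amulDl !psiD hy hz.
- by move=> c y /= hy; rewrite amulZr amulZl !psiZ hy.
- apply: (@closed_functional_eq _ _ (fun b => psi (a ** b)) (fun b =>
  psi (b ** F (0 +i* 1)%C))
      (rnorm a) (rnorm (F (0 +i* 1)%C))) => [y z|y|y z|y].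
  + by rewrite amulBr (functionalB psiD psiZ).
  + by apply: (le_trans (state_bound e1 _ psis)); exact: rnormM.
  + by rewrite amulBl (functionalB psiD psiZ).
  + by apply: (le_trans (state_bound e1 _ psis)); rewrite mulrC rnormM.
move=> l m /=; set h := t l ** (t m)^#; set x := freq l - freq m.
have hh : homogeneous x h := homogeneous_span l m.
pose g (z : R[i]) := cexp (0 + 'i%C * (x%:C)%C * z) * psi (F z ** h) - psi (a
  ** h).
have dg z : cdiff g z.
  apply: cdiffB; last exact: cdiff_const.
  apply: cdiffM; first by apply: cdiff_comp_affine; exact: cdiff_cexp.
  apply: (@derivable_cdiff _ _ F (fun y => psi (y ** h)) (rnorm h)) => //.
  - by move=> y z'; rewrite amulDl psiD.
  - by move=> c y; rewrite amulZl psiZ.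
  - by move=> y; apply: (le_trans (state_bound e1 _ psis));
    rewrite mulrC rnormM.
have g0 (s : R) : g (s%:C)%C = 0.
  apply/eqP; rewrite /g add0r subr_eq0 FE -psiZ -amulZr -mulrA -rmorphM (mulrC
    x) -hh.
  by have [_ _ <- _] := alpha_hom s; rewrite kms_state_invariant.
have := cdiff_real_zero dg g0; rewrite /g add0r cexp_at_i => /eqP.
by rewrite subr_eq0 => /eqP <-; rewrite psih.
Qed.

End Converse.

End KMS.

(** * Subinvariant vectors of irreducible matrices *)

Section Perron.
Variables (R : realType) (n : nat).
Implicit Types (A : 'M[R]_n) (v : 'cV[R]_n).
Local Notation N := (@Normc.normc R).

Lemma normc_sum (I : finType) (F : I ->
  R[i]) : N (\sum_i F i) <= \sum_i N (F i).
Proof.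
apply: (big_ind2 (fun x y => N x <= y)) => [|x y x' y' h h'|//].
  by rewrite Normc.normc0.
by apply: (le_trans (normcD_le _ _)); apply: lerD.
Qed.

(** Pair the moduli of a left eigenvector [x] with [v]: the triangle inequality and subinvariance
    give [N z * S <= c * S], where [S] is the positive sum of the [N (x 0 j) * v j 0]. *)
Lemma eigenvalue_weight_bound A v (c : R) (z : R[i]) :
  (forall i j, 0 <= A i j) -> (forall i, 0 < v i 0) ->
  (forall i, (A *m v) i 0 <= c * v i 0) ->
  eigenvalue (map_mx (real_complex R) A) z -> N z <= c.
Proof.
move=> A0 v0 Avc /eigenvalueP[x xA x0].
pose S := \sum_j N (x 0 j) * v j 0.
have S0 : 0 < S.
  have [j xj] : exists j, x 0 j != 0.
    apply/existsP; apply: contraR x0; rewrite negb_exists => /forallP H.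
    by apply/eqP/rowP => j; rewrite mxE; apply/eqP; have := H j; rewrite negbK.
  rewrite /S (bigD1 j) //=; apply: ltr_pwDl.
    rewrite mulr_gt0 // lt_def normc_ge0 andbT.
    by apply: contra_neq xj => /Normc.eq0_normc.
  by apply: sumr_ge0 => i _; rewrite mulr_ge0 ?normc_ge0 // ltW.
have key : N z * S <= c * S.
  apply: (@le_trans _ _ (\sum_j (\sum_i N (x 0 i) * A i j) * v j 0)).
    rewrite /S mulr_sumr; apply: ler_sum => j _;
      rewrite mulrA ler_wpM2r ?(ltW (v0 _)) //.
    have := congr1 (fun y : 'rV_n => y 0 j) xA;
      rewrite !mxE -Normc.normcM => <-.
    apply: (le_trans (normc_sum _)); apply: ler_sum => i _.
    by rewrite mxE Normc.normcM normc_real ger0_norm.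
  under eq_bigr do rewrite mulr_suml.
  rewrite exchange_big /= /S mulr_sumr; apply: ler_sum => i _.
  rewrite mulrCA; under eq_bigr do rewrite -mulrA.
  rewrite -mulr_sumr ler_wpM2l ?normc_ge0 //.
  by have := Avc i; rewrite mxE.
by rewrite -(ler_pM2r S0).
Qed.

Lemma expmx_ge0 A k : (forall i j, 0 <= A i j) -> forall i j, 0 <= (A ^+ k) i j.
Proof.
move=> A0; elim: k => [|k IH] i j.
  by rewrite expr0 mxE; case: (i == j); rewrite ?ler01.
by rewrite exprS mxE; apply: sumr_ge0 => l _; rewrite mulr_ge0.
Qed.

Lemma irreducible_sum_gt0 A : (forall i j, 0 <= A i j) -> irreducible_mx A ->
  exists K, forall i j, 0 < (\sum_(k < K) A ^+ k) i j.
Proof.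
move=> A0 irr.
have H (p : 'I_n * 'I_n) : exists m, (A ^+ m) p.1 p.2 != 0 by exact: irr.
have [m mP] := choice H.
exists (\max_p m p).+1 => i j.
have lt : (m (i, j) < (\max_p m p).+1)%N by rewrite ltnS (leq_bigmax (i, j)).
rewrite summxE (bigD1 (Ordinal lt)) //=; apply: ltr_pwDl.
  by rewrite lt_def (mP (i, j)) expmx_ge0.
by apply: sumr_ge0 => k _; exact: expmx_ge0.
Qed.

(* If the inequality were strict somewhere, a positive matrix [P] commuting
   with [A] would turn it into [A (P v) <= c (P v)] with [c < rho] and
   [P v > 0], and all eigenvalues would have modulus at most [c]. *)
Lemma subinvariant_eq A v : (forall i j, 0 <= A i j) -> irreducible_mx A ->
  0 < spectral_radius A -> (forall i, 0 <= v i 0) ->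
  (forall i, (A *m v) i 0 <= spectral_radius A * v i 0) ->
  forall i, (A *m v) i 0 = spectral_radius A * v i 0.
Proof.
move=> A0 irr; set rho := spectral_radius A => rho0 v0 Av i0.
have [//|ne] := eqVneq ((A *m v) i0 0) (rho * v i0 0); exfalso.
have lt0 : (A *m v) i0 0 < rho * v i0 0 by rewrite lt_def eq_sym ne Av.
have vi0 : 0 < v i0 0.
  rewrite -(pmulr_rgt0 _ rho0); apply: le_lt_trans lt0.
  by rewrite mxE; apply: sumr_ge0 => j _; rewrite mulr_ge0.
have [K P0] := irreducible_sum_gt0 A0 irr.
set P := \sum_(k < K) _ in P0.
have PA : A *m P = P *m A.
  rewrite /P mulmx_sumr mulmx_suml; apply: eq_bigr => k _.
  by rewrite -[A *m _]/(A * _) -[_ *m A]/(_ * A) -exprS exprSr.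
have Ppos (w : 'cV[R]_n) : (forall i, 0 <= w i 0) -> 0 < w i0 0 ->
  forall i, 0 < (P *m w) i 0.
  move=> w0 wi i; rewrite mxE (bigD1 i0) //=; apply: ltr_pwDl.
    by rewrite mulr_gt0.
  by apply: sumr_ge0 => j _; rewrite mulr_ge0 // ltW.
pose v' := P *m v.
have v'0 : forall i, 0 < v' i 0 by exact: Ppos.
have lt i : (A *m v') i 0 < rho * v' i 0.
  have DE (w : 'cV[R]_n) j : (rho *: w - A *m w) j 0 =
    rho * w j 0 - (A *m w) j 0.
    by rewrite [LHS]mxE [X in X + _]mxE [X in _ + X]mxE.
  have := Ppos (rho *: v - A *m v).
  have -> : P *m (rho *: v - A *m v) = rho *: v' - A *m v'.
    by rewrite mulmxBr -scalemxAr mulmxA -PA -mulmxA.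
  move=> H; rewrite -subr_gt0 -DE; apply: H; first by move=> j;
    rewrite DE subr_ge0.
  by rewrite DE subr_gt0.
have [c c1 c2] : exists2 c, c < rho & forall i, (A *m v') i 0 <= c * v' i 0.
  pose q i := (A *m v') i 0 / v' i 0.
  case: (arg_maxP q (erefl : xpredT i0)) => j _ jP.
  exists (q j); first by rewrite ltr_pdivrMr.
  by move=> i; rewrite -ler_pdivrMr //; exact: jP.
have : rho <= c; last by rewrite leNgt c1.
rewrite /rho /spectral_radius; set S := (X in sup X).
(* An empty [S] would have [sup] equal to [0] by convention, against [rho0]. *)
have [S0|S0] := pselect (S !=set0).
  by apply: ge_sup => // _ [z zA <-];
    exact: (eigenvalue_weight_bound A0 v'0 c2).
exfalso; move: rho0; rewrite /rho /spectral_radius -/S.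
by rewrite (_ : S = set0) ?sup0 ?ltxx //; apply/seteqP; split=> // z Sz;
  apply: S0; exists z.
Qed.

End Perron.

(* Blocks of matrices over different index types are compared as functions on
   subsets of one finite type. *)
Section IndexedMatrix.
Variables (R : realType) (T : finType) (a : T -> T -> R) (X : {set T}).

Definition indexes n (f : 'I_n -> T) :=
  injective f /\ forall x, x \in X <-> exists i, f i = x.

Lemma sum_indexes (W : nmodType) n (f : 'I_n -> T) (F : T -> W) : indexes f ->
  \sum_(x in X) F x = \sum_i F (f i).
Proof.
move=> [finj fX].
rewrite -(big_imset (h := f) (A := predT) F) /=; last by move=> i j _ _;
  exact: finj.
apply: eq_bigl => x; apply/idP/imsetP => [/fX[i <-]|[i _ ->]];
  first by exists i.
by apply/fX; exists i.
Qed.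

Definition left_eigen (z : R[i]) := exists x : T -> R[i],
  (exists2 j, j \in X & x j != 0) /\
  forall j, j \in X -> \sum_(i in X) x i * ((a i j)%:C)%C = z * x j.

Lemma eigenvalue_left n (f : 'I_n -> T) (A : 'M[R]_n) z : indexes f ->
  (forall i j, A i j = a (f i) (f j)) ->
  eigenvalue (map_mx (real_complex R) A) z <-> left_eigen z.
Proof.
move=> fi Aa; have [finj fX] := fi; split.
  move=> /eigenvalueP[x xA x0].
  pose y t := if [pick i | f i == t] is Some i then x 0 i else 0.
  have yf i : y (f i) = x 0 i.
    rewrite /y; case: pickP => [j /eqP/finj -> //|/(_ i)]; by rewrite eqxx.
  exists y; split.
    have [j xj] : exists j, x 0 j != 0.
      apply/existsP; apply: contraR x0; rewrite negb_exists => /forallP H.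
      by apply/eqP/rowP => j; rewrite mxE; apply/eqP; have := H j;
        rewrite negbK.
    by exists (f j); [apply/fX; exists j|rewrite yf].
  move=> _ /fX[j <-]; rewrite (sum_indexes _ fi) yf.
  have := congr1 (fun y : 'rV_n => y 0 j) xA; rewrite !mxE => <-.
  by apply: eq_bigr => i _; rewrite yf mxE Aa.
move=> [x [[j /fX[i0 <-] xj] xe]]; apply/eigenvalueP.
exists (\row_i x (f i)).
  apply/rowP => j'; rewrite !mxE -xe; last by apply/fX; exists j'.
  by rewrite (sum_indexes _ fi); apply: eq_bigr => i _; rewrite !mxE Aa.
by apply: contraNneq xj => /rowP/(_ i0); rewrite !mxE => ->.
Qed.

Lemma indexes_enum_val : indexes (@enum_val T (mem X)).
Proof.
split; first exact: enum_val_inj.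
by move=> x; split=> [xX|[i <-]]; [exists (enum_rank_in xX x);
  rewrite enum_rankK_in|exact: enum_valP].
Qed.

Definition rad : R := sup [set Normc.normc z | z in [set z | left_eigen z]].

Lemma spectral_radius_rad n (f : 'I_n -> T) (A : 'M[R]_n) : indexes f ->
  (forall i j, A i j = a (f i) (f j)) -> spectral_radius A = rad.
Proof.
move=> fi Aa; congr sup; apply/seteqP;
  split=> _ [z /(eigenvalue_left _ fi Aa) zA <-]; exists z => //.
Qed.

Lemma irreducible_transfer n m (f : 'I_n -> T) (g : 'I_m ->
  T) (A : 'M[R]_n) (B : 'M[R]_m) :
  indexes f -> indexes g -> (forall i j, A i j = a (f i) (f j)) ->
  (forall i j, B i j = a (g i) (g j)) -> irreducible_mx A -> irreducible_mx B.
Proof.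
move=> fi gi Aa Bb irr i j.
have [_ fX] := fi; have [ginj gX] := gi.
have pre x : exists i', f i' = g x by apply/fX/gX; exists x.
have [h hP] := choice pre.
have [finj _] := fi.
have pre' x : exists i', g i' = f x by apply/gX/fX; exists x.
have [h' hP'] := choice pre'.
have hb : bijective h.
  by exists h' => l; [apply: ginj|apply: finj]; rewrite ?hP' ?hP ?hP'.
have [k kP] := irr (h i) (h j); exists k.
suff -> : (B ^+ k) i j = (A ^+ k) (h i) (h j) by [].
elim: k i j {kP} => [|k IH] i j; first by rewrite !expr0 !mxE (bij_eq hb).
rewrite !exprS !mxE (reindex h) /=; last exact: onW_bij.
by apply: eq_bigr => l _; rewrite IH Aa Bb !hP.
Qed.

Definition right_eigen (z : R[i]) := exists x : T -> R[i],
  (exists2 j, j \in X & x j != 0) /\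
  forall j, j \in X -> \sum_(i in X) ((a j i)%:C)%C * x i = z * x j.

End IndexedMatrix.

Lemma eigenvalue_tr (F : fieldType) n (A : 'M[F]_n) z : eigenvalue A^T z =
  eigenvalue A z.
Proof.
rewrite /eigenvalue /eigenspace !kermx_eq0 /row_free -mxrank_tr.
by rewrite linearB /= trmxK tr_scalar_mx.
Qed.

Section LeftRight.
Variables (R : realType) (T : finType).
Implicit Types (a : T -> T -> R) (X Y : {set T}).

Lemma left_right_eigen a X z : left_eigen a X z <-> right_eigen a X z.
Proof.
have fi := indexes_enum_val X.
pose A := \matrix_(i < #|X|, j < #|X|) a (enum_val i) (enum_val j).
have e1 := eigenvalue_left (a := a) (A := A) z fi (fun i j => mxE _ _ i j).
have e2 : eigenvalue (map_mx (real_complex R) A^T) z <-> left_eigen (fun x y =>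
  a y x) X z.
  by apply: (eigenvalue_left z fi) => i j; rewrite !mxE.
rewrite -matrix.map_trmx eigenvalue_tr in e2.
rewrite -e1 e2; split=> -[x [x0 xe]]; exists x; split=> // j jX; rewrite -xe //.
  by apply: eq_bigr => i _; rewrite mulrC.
by apply: eq_bigr => i _; rewrite mulrC.
Qed.

(** The matrix on [Y] is block triangular with [X] as a diagonal block; when the entries from [X] to
    the rest vanish, left eigenvectors extend by zero. *)
Lemma left_eigen_sub a X Y z : X \subset Y ->
  (forall i j, i \in X -> j \in Y :\: X -> a i j = 0) ->
  left_eigen a X z -> left_eigen a Y z.
Proof.
move=> XY a0 [x [[j0 j0X xj] xe]].
exists (fun i => if i \in X then x i else 0); split.
  by exists j0; rewrite ?j0X // (fintype.subsetP XY).
move=> j jY; rewrite (big_setID X) /= (finset.setIidPr XY) [X in _ + X]big1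
  ?addr0; last first.
  by move=> i; rewrite inE => /andP[/negPf -> _]; rewrite mul0r.
rewrite [LHS](eq_bigr (fun i => x i * ((a i j)%:C)%C)); last by move=> i ->.
case: ifP => jX; first exact: xe.
rewrite mulr0 big1 // => i iX; rewrite a0 ?mulr0 //.
by rewrite inE jX jY.
Qed.

(** When instead the entries from the rest to [X] vanish, it is the right eigenvectors that extend
    by zero; transposition leads back to left ones. *)
Lemma right_eigen_sub a X Y z : X \subset Y ->
  (forall i j, i \in Y :\: X -> j \in X -> a i j = 0) ->
  left_eigen a X z -> left_eigen a Y z.
Proof.
move=> XY a0 /left_right_eigen[x [[j0 j0X xj] xe]]; apply/left_right_eigen.
exists (fun i => if i \in X then x i else 0); split.
  by exists j0; rewrite ?j0X // (fintype.subsetP XY).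
move=> j jY; rewrite (big_setID X) /= (finset.setIidPr XY) [X in _ + X]big1
  ?addr0; last first.
  by move=> i; rewrite inE => /andP[/negPf -> _]; rewrite mulr0.
rewrite [LHS](eq_bigr (fun i => ((a j i)%:C)%C * x i)); last by move=> i ->.
case: ifP => jX; first exact: xe.
rewrite mulr0 big1 // => i iX; rewrite a0 ?mul0r //.
by rewrite inE jX jY.
Qed.

(** The eigenvalues are among the finitely many roots of a characteristic polynomial. A bound is
    indispensable for [rad], the [sup] of an unbounded set being [0] by convention. *)
Lemma left_eigen_bounded a X :
  exists M, forall z, left_eigen a X z -> Normc.normc z <= M.
Proof.
pose A := \matrix_(i < #|X|, j < #|X|) a (enum_val i) (enum_val j).
have fi := indexes_enum_val X.
pose p := char_poly (map_mx (real_complex R) A).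
have [s sP] : exists s : seq R[i], forall z, root p z -> z \in s.
  have p0 : p != 0 by apply: monic_neq0; exact: char_poly_monic.
  have [s sE] := closed_field_poly_normal p.
  exists s => z; rewrite sE rootZ ?lead_coef_eq0 //.
  by rewrite root_prod_XsubC.
exists (\sum_(z <- s) Normc.normc z) => z.
move=> /(eigenvalue_left (a := a) (A := A) z fi (fun i j => mxE _ _ i j)).
rewrite eigenvalue_root_char => /sP zs.
rewrite (big_rem z) //= lerDl sumr_ge0 // => w _; exact: normc_ge0.
Qed.

Lemma rad_le a X Y : (forall z, left_eigen a X z -> left_eigen a Y z) ->
  rad a X <= rad a Y.
Proof.
move=> XY; have [M MP] := left_eigen_bounded a Y.
have ub : ubound [set Normc.normc z | z in [set z | left_eigen a Y z]] M.
  by move=> _ [z /= zY <-]; exact: MP.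
rewrite /rad; set S := (X in sup X <= _); set S' := (X in _ <= sup X).
have SS : S `<=` S' by move=> _ [z zX <-]; exists z => //; exact: XY.
have [[s Ss]|S0] := pselect (S !=set0).
  apply: ge_sup; first by exists s.
  move=> y Sy; apply: sup_upper_bound; last exact: SS.
  by split; [exists s; exact: SS|exists M].
(* The [sup] of an empty set is [0], so this case asks for nonnegativity of the right side. *)
have -> : S = set0 by apply/seteqP; split=> // y Sy; apply: S0; exists y.
rewrite sup0; have [[s Ss]|S0'] := pselect (S' !=set0).
  have [z _ zs] := Ss; apply: (@le_trans _ _ s); first by rewrite -zs normc_ge0.
  by apply: sup_upper_bound => //; split; [exists s|exists M].
have -> : S' = set0 by apply/seteqP; split=> // y Sy; apply: S0'; exists y.
by rewrite sup0.
Qed.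

End LeftRight.

Local Close Scope classical_set_scope.

(** * Components and vertex matrices *)

Section Components.
Variables (k : nat) (L : kgraph k).
Implicit Types (v w x : vtx L) (C D G H : {set vtx L}) (l : mor L).

Definition lk v w := linked [set v] [set w].

Lemma lk_mor l : lk (rng l) (src l).
Proof. by apply/linkedP; exists l. Qed.

Lemma lk_refl v : lk v v.
Proof. by apply/linkedP; exists (idp v); rewrite src_idp rng_idp. Qed.

Lemma lk_trans v w x : lk v w -> lk w x -> lk v x.
Proof.
move=> /linkedP[l [<- lw]] /linkedP[m [mw <-]]; apply/linkedP.
exists (compose l m).
have e : src l = rng m by rewrite lw mw.
by rewrite src_comp // rng_comp.
Qed.

Lemma linked_lkP C D :
  reflect (exists v w, [/\ v \in C, w \in D & lk v w]) (linked C D).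
Proof.
apply: (iffP (asboolP _)) => [[l [lC lD]]|[v [w [vC wD /linkedP[l [lv lw]]]]]].
  by exists (rng l), (src l); split=> //; exact: lk_mor.
by exists l; rewrite lv lw.
Qed.

Lemma hereditary_lk H v w : hereditary H -> v \in H -> lk v w -> w \in H.
Proof. by move=> /hereditaryP hH vH /linkedP[l [lv <-]]; apply: hH;
  rewrite lv. Qed.

Lemma mem_scc v w : (w \in scc v) = lk v w && lk w v.
Proof. by rewrite inE. Qed.

Lemma scc_refl v : v \in scc v.
Proof. by rewrite mem_scc !lk_refl. Qed.

Lemma scc_eq v w : w \in scc v -> scc w = scc v.
Proof.
rewrite mem_scc => /andP[vw wv]; apply/setP => x; rewrite !mem_scc.
by apply/andP/andP => -[h1 h2]; split;
  [exact: lk_trans h1|exact: lk_trans wv|exact: lk_trans h1|exact: lk_trans vw].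
Qed.

Lemma component_scc C v : C \in components L -> v \in C -> C = scc v.
Proof. by rewrite inE => /andP[/imsetP[w _ ->] _] /scc_eq. Qed.

Lemma component_lk C v w : C \in components L -> v \in C -> w \in C -> lk v w.
Proof. by move=> cC vC; rewrite (component_scc cC vC) mem_scc => /andP[]. Qed.

Lemma component_eq C D v : C \in components L -> D \in components L ->
  v \in C -> v \in D -> C = D.
Proof. by move=> cC cD vC vD;
  rewrite (component_scc cC vC) (component_scc cD vD). Qed.

Lemma component_neq0 C : C \in components L -> exists v, v \in C.
Proof. by rewrite inE => /andP[/imsetP[w _ ->] _]; exists w;
  exact: scc_refl. Qed.

Lemma linked_component C D v w : C \in components L -> D \in components L ->
  linked C D -> v \in C -> w \in D -> lk v w.
Proof.
move=> cC cD /linked_lkP[v' [w' [vC wD vw]]] v1 w1.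
apply: lk_trans (component_lk cC v1 vC) _; apply: lk_trans vw _.
exact: component_lk cD wD w1.
Qed.

Lemma linked_trans C D E : C \in components L -> D \in components L ->
  E \in components L ->
  linked C D -> linked D E -> linked C E.
Proof.
move=> cC cD cE CD DE.
have [v vC] := component_neq0 cC; have [w wD] := component_neq0 cD.
have [x xE] := component_neq0 cE.
apply/linked_lkP; exists v, x; split=> //.
exact: lk_trans (linked_component cC cD CD vC wD) (linked_component cD cE DE wD
  xE).
Qed.

Lemma linked_refl C : C \in components L -> linked C C.
Proof.
by move=> /component_neq0[v vC]; apply/linked_lkP; exists v, v; split=> //;
  exact: lk_refl.
Qed.

Lemma linked_antisym C D : C \in components L -> D \in components L ->
  linked C D -> linked D C -> C = D.
Proof.
move=> cC cD CD DC; have [v vC] := component_neq0 cC;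
  have [w wD] := component_neq0 cD.
have wC : w \in C.
  by rewrite (component_scc cC vC) mem_scc (linked_component cC cD) //
    (linked_component cD cC).
exact: component_eq cC cD wC wD.
Qed.

Lemma hereditary_closureP G w :
  reflect (exists2 v, v \in G & lk v w) (w \in hereditary_closure G).
Proof.
apply: (iffP bigcapP) => [h|[v vG vw] K /andP[hK GK]].
  pose K := [set w | [exists v in G, lk v w]].
  have /h : hereditary K && (G \subset K).
    apply/andP; split.
      apply/hereditaryP => l; rewrite !inE => /existsP[v /andP[vG vl]].
      by apply/existsP; exists v; rewrite vG /= (lk_trans vl) ?lk_mor.
    by apply/fintype.subsetP => v vG; rewrite inE; apply/existsP; exists v;
      rewrite vG lk_refl.
  by rewrite inE => /existsP[v /andP[vG vw]]; exists v.
by apply: hereditary_lk hK _ vw; exact: (fintype.subsetP GK).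
Qed.

End Components.

(** * Components and matrices of the graph with a hereditary set removed *)

Section RemoveComponents.
Variables (k : nat) (L : kgraph k) (H : {set vtx L}) (hH : hereditary H).
Local Notation LH := (kgraph_remove hH).
Implicit Types (v w : vtx LH) (D : {set vtx LH}).

Definition up D : {set vtx L} := [set val v | v in D].

Lemma upP D (x : vtx L) : reflect (exists2 v : vtx LH,
  v \in D & x = val v) (x \in up D).
Proof. exact: imsetP. Qed.

Lemma up_inj : injective up.
Proof. exact: imset_inj val_inj. Qed.

Lemma mem_up D v : (val v \in up D) = (v \in D).
Proof. by rewrite /up mem_imset //; exact: val_inj. Qed.

Lemma up_notin D (x : vtx L) : x \in up D -> x \notin H.
Proof. by move=> /upP[v _ ->]; exact: (valP v). Qed.

Lemma lift_mor (l : mor L) : src l \notin H -> exists l' : mor LH, val l' = l.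
Proof. by move=> lH; exists (exist _ l lH). Qed.

Lemma lift_vtx (x : vtx L) : x \notin H -> exists v : vtx LH, val v = x.
Proof. by move=> xH; exists (exist _ x xH). Qed.

Lemma lk_remove v w : lk v w = lk (val v) (val w).
Proof.
apply/linkedP/linkedP => [[l [<- <-]]|[l [lv lw]]]; first by exists (val l).
have [|l' l'E] := lift_mor (l := l); first by rewrite lw (valP w).
by exists l'; split; apply: val_inj; rewrite -?lv -?lw -l'E.
Qed.

Lemma up_scc v : up (scc v) = scc (val v).
Proof.
apply/setP => x; apply/idP/idP.
  by move=> /upP[w + ->]; rewrite !mem_scc !lk_remove.
rewrite mem_scc => /andP[vx xv].
have xH : x \notin H by apply: contra (valP v) => xH;
  exact: hereditary_lk hH xH xv.
have [w wx] := lift_vtx xH; rewrite -wx mem_up mem_scc !lk_remove wx vx xv //.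
Qed.

Lemma up_set1 v : up [set v] = [set val v].
Proof. by rewrite /up imset_set1. Qed.

Lemma up_trivial D : trivial_component (up D) <-> trivial_component D.
Proof.
split=> [[x [xD xl]]|[v [vD vl]]].
  have : x \in up D by rewrite xD inE.
  move=> /upP[v vD xv]; exists v; split.
    by apply: up_inj; rewrite up_set1 -xv.
  move=> l lv lv'; apply: val_inj; rewrite /= -xv.
  by apply: xl; rewrite xv; [rewrite -lv|rewrite -lv'].
exists (val v); rewrite vD up_set1; split=> // l lv lv'.
have [|l' l'E] := lift_mor (l := l); first by rewrite lv' (valP v).
rewrite -l'E (vl l') //; apply: val_inj.
  by rewrite -lv -l'E.
by rewrite -lv' -l'E.
Qed.

Lemma up_components D : (up D \in components L) = (D \in components LH).
Proof.
rewrite !inE; congr (_ && ~~ _); last by apply: asbool_equiv_eq;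
  exact: up_trivial.
apply/imsetP/imsetP => -[x _ e].
  have : x \in up D by rewrite e scc_refl.
  by move=> /upP[v _ xv]; exists v => //; apply: up_inj; rewrite up_scc -xv.
by exists (val x) => //; rewrite e up_scc.
Qed.

Lemma up_preim (C : {set vtx L}) : (forall x, x \in C -> x \notin H) ->
  up [set v | val v \in C] = C.
Proof.
move=> CH; apply/setP => x; apply/idP/idP.
  by move=> /upP[v + ->]; rewrite inE.
by move=> xC; have [v vx] := lift_vtx (CH x xC); rewrite -vx mem_up inE vx.
Qed.

End RemoveComponents.

Section EdgeCount.
Variables (R : realType) (k : nat).

Definition ecount (L : kgraph k) (i : 'I_k) (v w : vtx L) : R :=
  (#|` fset_set [set l : mor L | [/\ rng l = v,
    src l = w & deg l = egen i]]%classic|)%:R.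

Lemma ecount_ge0 (L : kgraph k) i (v w : vtx L) : 0 <= ecount i v w.
Proof. exact: ler0n. Qed.

Lemma finite_edges (L : kgraph k) i (v w : vtx L) : finite_kgraph L ->
  finite_set [set l : mor L | [/\ rng l = v,
    src l = w & deg l = egen i]]%classic.
Proof. by move=> fL; apply: sub_finite_set (fL (egen i)) => l /= []. Qed.

Lemma ecount_neq0 (L : kgraph k) i (v w : vtx L) : finite_kgraph L ->
  ecount i v w != 0 <-> exists l : mor L, [/\ rng l = v,
    src l = w & deg l = egen i].
Proof.
move=> fL; rewrite /ecount pnatr_eq0 cardfs_eq0; split.
  by move=> /fset0Pn[l]; rewrite in_fset_set ?inE /=;
    [exists l|exact: finite_edges].
move=> [l lP]; apply/fset0Pn; exists l; rewrite in_fset_set ?inE //=.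
exact: finite_edges.
Qed.

Lemma ecount_not_lk (L : kgraph k) i (v w : vtx L) : finite_kgraph L ->
  ~~ lk v w -> ecount i v w = 0.
Proof.
move=> fL; apply: contraNeq => /(ecount_neq0 _ _ _ fL)[l [<- <- _]];
  exact: lk_mor.
Qed.

Lemma vertex_mxE (L : kgraph k) i x y :
  vertex_mx R L i x y = ecount i (enum_val x) (enum_val y).
Proof. by rewrite mxE. Qed.

Lemma vertex_blockE (L : kgraph k) (C : {set vtx L}) i x y :
  vertex_block R C i x y = ecount i (enum_val x) (enum_val y).
Proof. by rewrite mxE vertex_mxE !enum_rankK. Qed.

Lemma indexes_vtx (L : kgraph k) : indexes [set: vtx L] (@enum_val (vtx L) (mem
  (vtx L))).
Proof.
split; first exact: enum_val_inj.
by move=> x; split=> // _; exists (enum_rank x); rewrite enum_rankK.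
Qed.

Lemma rad_vertex_mx (L : kgraph k) i :
  spectral_radius (vertex_mx R L i) = rad (ecount (L := L) i) [set: vtx L].
Proof. exact: spectral_radius_rad (indexes_vtx L) (@vertex_mxE L i). Qed.

Lemma rad_vertex_block (L : kgraph k) (C : {set vtx L}) i :
  spectral_radius (vertex_block R C i) = rad (ecount (L := L) i) C.
Proof. exact: spectral_radius_rad (indexes_enum_val C) (@vertex_blockE L C i).
  Qed.

Variables (L : kgraph k) (H : {set vtx L}) (hH : hereditary H).
Hypothesis fL : finite_kgraph L.
Local Notation LH := (kgraph_remove hH).

Lemma ecount_remove i (v w : vtx LH) : ecount i v w = ecount i (val v) (val w).
Proof.
rewrite /ecount; congr (_%:R).
have e : [set l : mor L | [/\ rng l = val v,
  src l = val w & deg l = egen i]]%classic =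
    image [set l : mor LH | [/\ rng l = v, src l = w & deg l = egen i]]%classic
      (val : mor LH -> mor L).
  apply/seteqP; split=> [l /= [lv lw ld]|_ [l /= [<- <- ld] <-]] //=.
  have [|l' l'E] := lift_mor hH (l := l); first by rewrite lw (valP w).
  exists l' => //; split.
  - by apply: val_inj; rewrite /= -lv -l'E.
  - by apply: val_inj; rewrite /= -lw -l'E.
  - by rewrite -ld -l'E.
have vinj : {in [set l : mor LH | [/\ rng l = v,
  src l = w & deg l = egen i]]%classic &,
    injective (val : mor LH -> mor L)} by move=> ? ? _ _; exact: val_inj.
have ceq := inj_card_eq vinj.
apply/eqP; rewrite eq_sym e; apply/eqP/fcard_eq => //.
  by rewrite -e; exact: finite_edges.
by rewrite -(eq_finite_set ceq) -e; exact: finite_edges.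
Qed.

End EdgeCount.

Section RemoveMatrices.
Variables (R : realType) (k : nat) (L : kgraph k) (H : {set vtx L}).
Variables (hH : hereditary H) (fL : finite_kgraph L).
Local Notation LH := (kgraph_remove hH).
Local Notation a := (@ecount R k L).
Implicit Types D : {set vtx LH}.

Lemma rad_remove_mx i : spectral_radius (vertex_mx R LH i) = rad (a i) (~: H).
Proof.
apply: (@spectral_radius_rad _ _ _ _ _ (fun x => val (enum_val x : vtx LH))).
  split; first by move=> x y /val_inj/enum_val_inj.
  move=> x; rewrite inE; split=> [xH|[y <-]];
    last exact: (valP (enum_val y : vtx LH)).
  have [v vx] := lift_vtx hH xH; exists (enum_rank v).
  by rewrite enum_rankK.
by move=> x y; rewrite vertex_mxE ecount_remove.
Qed.

Lemma indexes_up D : indexes (up D) (fun x : 'I_#|D| =>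
  val (enum_val x : vtx LH)).
Proof.
split; first by move=> x y /val_inj/enum_val_inj.
move=> x; split=> [/upP[v vD ->]|[y <-]]; last by rewrite mem_up;
  exact: enum_valP.
by exists (enum_rank_in vD v); rewrite enum_rankK_in.
Qed.

Lemma remove_blockE D i x y : vertex_block R D i x y =
  a i (val (enum_val x : vtx LH)) (val (enum_val y : vtx LH)).
Proof. by rewrite vertex_blockE ecount_remove. Qed.

Lemma rad_remove_block D i : spectral_radius (vertex_block R D i) =
  rad (a i) (up D).
Proof. exact: spectral_radius_rad (indexes_up D) (@remove_blockE D i). Qed.

Lemma irreducible_remove D i :
  irreducible_mx (vertex_block R D i) <-> irreducible_mx (vertex_block R (up D)
    i).
Proof.
have vb := @vertex_blockE R k L (up D) i.
split; apply: (irreducible_transfer (a := a i) (X := up D));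
  try exact: indexes_up;
  try exact: indexes_enum_val; try exact: vb; exact: remove_blockE.
Qed.

Lemma rad_remove_le i : rad (a i) (~: H) <= rad (a i) [set: vtx L].
Proof.
apply: rad_le => z; apply: right_eigen_sub; first exact: finset.subsetT.
move=> v w; rewrite !inE => /andP[/negPn vH _] wH.
apply: ecount_not_lk => //; apply: contra wH; exact: hereditary_lk.
Qed.

Lemma rad_hereditary_le (C : {set vtx L}) i : C \subset ~: H ->
  (forall v w, v \in C -> lk v w -> w \notin H -> w \in C) ->
  rad (a i) C <= rad (a i) (~: H).
Proof.
move=> CH hC; apply: rad_le => z; apply: left_eigen_sub => // v w vC.
rewrite !inE => /andP[wC wH]; apply: ecount_not_lk => //.
by apply: contra wC => vw; exact: hC vC vw wH.
Qed.

End RemoveMatrices.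

(** * Minimal critical components, before and after the removal *)

Section MinimalCritical.
Variables (R : realType) (k : nat) (L : kgraph k) (r : 'I_k -> R).
Hypotheses (fL : finite_kgraph L) (r_gt0 : forall i, 0 < r i).
Hypothesis r_max : \big[Num.max/0]_(i < k)
      ((r i)^-1 * ln (spectral_radius (vertex_mx R L i))) = 1.

Local Notation mincrit := (min_critical_components L r).
Local Notation G := (\bigcup_(C in mincrit) C)%SET.
Local Notation H := (hereditary_closure G :\: G)%SET.
Local Notation a := (@ecount R k L).
Implicit Types C D : {set vtx L}.

Lemma ln_rho_le i : ln (rad (a i) [set: vtx L]) <= r i.
Proof.
have : (r i)^-1 * ln (rad (a i) [set: vtx L]) <= 1.
  by rewrite -r_max -rad_vertex_mx; apply: le_bigmax.
by rewrite mulrC ler_pdivrMr // mul1r.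
Qed.

Lemma critical_component C : C \in critical_components L r ->
  C \in components L.
Proof. by rewrite inE => /andP[]. Qed.

Lemma mincrit_critical C : C \in mincrit -> C \in critical_components L r.
Proof. by rewrite inE => /andP[]. Qed.

Lemma mincrit_component C : C \in mincrit -> C \in components L.
Proof. by move/mincrit_critical/critical_component. Qed.

Lemma mincrit_min C D : C \in mincrit -> D \in critical_components L r ->
  linked D C -> D = C.
Proof.
rewrite inE => /andP[_ /forallP/(_ D) h] Dc DC; apply/eqP.
by move: h; rewrite Dc DC.
Qed.

Lemma mincritP x : reflect (exists2 C, C \in mincrit & x \in C) (x \in G).
Proof. exact: bigcupP. Qed.

(** Among the critical components linked to [C], take one with the fewest critical components below
    it. By antisymmetry a critical component strictly below it would have fewer. *)
Lemma exists_mincrit C : C \in critical_components L r ->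
  exists2 D, D \in mincrit & linked D C.
Proof.
move=> Cc; have cC := critical_component Cc.
pose below D := [set F in critical_components L r | linked F D].
pose P D := (D \in critical_components L r) && linked D C.
have PC : P C by rewrite /P Cc linked_refl.
case: (arg_minnP (fun D => #|below D|) PC) => D /andP[Dc DC] Dmin.
exists D => //; rewrite inE Dc; apply/forallP => F; apply/implyP => Fc;
  apply/implyP => FD.
have cD := critical_component Dc; have cF := critical_component Fc.
apply/contraT => FneD.
have : P F by rewrite /P Fc (linked_trans cF cD cC).
move=> /Dmin; rewrite leqNgt => /negP; case; apply: proper_card.
apply/properP; split.
  apply/fintype.subsetP => E; rewrite [_ \in below F]inE [_ \in below D]inE.
  by move=> /andP[Ec EF];
    rewrite Ec (linked_trans (critical_component Ec) cF cD).
exists D; first by rewrite inE Dc linked_refl.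
rewrite inE Dc /=; apply: contra FneD => DF; apply/eqP.
exact: linked_antisym cF cD FD DF.
Qed.

(** If [C] reached another minimal critical [D], the minimality of [D] would be violated by [C],
    which is critical. *)
Lemma mincrit_reach C v w : C \in mincrit -> v \in C -> lk v w ->
  w \in H \/ w \in C.
Proof.
move=> Cm vC vw; have vG : v \in G by apply/mincritP; exists C.
have [wG|wG] := boolP (w \in G); last first.
  by left; rewrite inE wG; apply/hereditary_closureP; exists v.
right; have /mincritP[D Dm wD] := wG.
suff -> : C = D by [].
apply: mincrit_min Dm (mincrit_critical Cm) _.
by apply/linked_lkP; exists v, w.
Qed.

Lemma hereditary_H : hereditary H.
Proof.
apply/hereditaryP => l; rewrite inE => /andP[vG /hereditary_closureP[g gG gv]].
have gw := lk_trans gv (lk_mor l).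
have /mincritP[C Cm gC] := gG.
have [//|wC] := mincrit_reach Cm gC gw.
(* A path from [H] back into [C] would put its range on a cycle through [C], hence into [C] and so
   into [G]. *)
exfalso; move/negP : vG; apply; apply/mincritP; exists C => //.
have cC := mincrit_component Cm.
by rewrite (component_scc cC gC) mem_scc gv (lk_trans (lk_mor l)) //
  (component_lk cC).
Qed.

Lemma mincrit_notin C v : C \in mincrit -> v \in C -> v \notin H.
Proof. by move=> Cm vC; rewrite inE negb_and negbK; apply/orP; left;
  apply/mincritP; exists C. Qed.

Lemma mincrit_closed C v w : C \in mincrit -> v \in C -> lk v w ->
  w \notin H -> w \in C.
Proof. by move=> Cm vC vw; case: (mincrit_reach Cm vC vw) => // ->. Qed.

Local Notation LH := (kgraph_remove hereditary_H).

(** The spectral radius for the smaller graph lies between that of the block and that of the whole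
    graph, whose logarithms agree. *)
Lemma mincrit_remove_critical (D : {set vtx LH}) :
  up D \in mincrit -> D \in critical_components LH r.
Proof.
move=> Dm; have cD := mincrit_component Dm.
rewrite inE -up_components cD /=; apply/asboolP.
have : is_critical r (up D) by move: (mincrit_critical Dm);
  rewrite inE => /andP[_ /asboolP].
move=> [j []]; rewrite rad_vertex_mx rad_vertex_block => rj e irr.
exists j; rewrite rad_remove_mx // rad_remove_block //.
have le1 : rad (a j) (up D) <= rad (a j) (~: H).
  apply: rad_hereditary_le => //.
    by apply/fintype.subsetP => v vD; rewrite inE; exact: mincrit_notin Dm vD.
  by move=> v w vD; exact: mincrit_closed Dm vD.
have le2 := rad_remove_le R hereditary_H fL j.
(* [ln] is [0] on nonpositive numbers and monotone only on positive ones; [r j > 0] rules the former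
   out. *)
have pos : 0 < rad (a j) (up D).
  by rewrite ltNge; apply/negP => /ln0 e0; have := r_gt0 j;
    rewrite rj e e0 ltxx.
have pos2 := lt_le_trans pos le1; have pos3 := lt_le_trans pos2 le2.
have l1 : ln (rad (a j) (up D)) <= ln (rad (a j) (~: H)) by rewrite ler_ln.
have l2 : ln (rad (a j) (~: H)) <= ln (rad (a j) [set: vtx L]) by rewrite
  ler_ln.
split; last by apply/irreducible_remove.
- by apply/eqP; rewrite eq_le {1}rj {1}e l1 rj l2.
- by apply/eqP; rewrite eq_le l1 andbT -e.
Qed.

(** Since [r j] bounds the logarithm for the whole graph and equals the one for the smaller graph,
    [up D] is critical in [L]. A minimal critical [E] linked to it reaches vertices outside [H],
    which must lie in [E]; so [up D = E]. *)
Lemma remove_critical_mincrit (D : {set vtx LH}) :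
  D \in critical_components LH r -> up D \in mincrit.
Proof.
rewrite inE => /andP[cD /asboolP[j []]].
rewrite -up_components in cD.
rewrite rad_remove_mx // rad_remove_block // => rj e /irreducible_remove irr.
have le2 := rad_remove_le R hereditary_H fL j.
have pos : 0 < rad (a j) (~: H).
  by rewrite ltNge; apply/negP => /ln0 e0; have := r_gt0 j; rewrite rj e0 ltxx.
have l2 : ln (rad (a j) (~: H)) <= ln (rad (a j) [set: vtx L]).
  by rewrite ler_ln // posrE (lt_le_trans pos).
have lr := ln_rho_le j.
have rj' : r j = ln (rad (a j) [set: vtx L]).
  by apply/eqP; rewrite eq_le lr andbT {1}rj.
have Dc : up D \in critical_components L r.
  rewrite inE cD; apply/asboolP; exists j;
    rewrite rad_vertex_mx rad_vertex_block.
  by split; [exact: rj'|rewrite -[LHS]rj' rj|exact: irr].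
have [E Em ED] := exists_mincrit Dc.
have [x xD] := component_neq0 cD;
  have [y yE] := component_neq0 (mincrit_component Em).
have yx := linked_component (mincrit_component Em) cD ED yE xD.
have xE : x \in E := mincrit_closed Em yE yx (up_notin xD).
by rewrite (component_eq cD (mincrit_component Em) xD xE).
Qed.

Lemma mincrit_remove : mincrit = [set [set val v | v in (D : {set vtx LH})]%SET
                  | D in critical_components LH r]%SET.
Proof.
apply/setP => C; apply/idP/imsetP => [Cm|[D Dc ->]];
  last exact: remove_critical_mincrit.
have CE : up ([set v | val v \in C] : {set vtx LH}) = C.
  by apply: up_preim => x; exact: mincrit_notin.
exists ([set v | val v \in C] : {set vtx LH}); last by rewrite -[LHS]CE.
by apply: mincrit_remove_critical; rewrite CE.
Qed.

Lemma mincrit_hereditary C : C \in mincrit ->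
  hereditary ([set v | val v \in C]%SET : {set vtx LH}).
Proof.
move=> Cm; apply/hereditaryP => l; rewrite !inE => lC.
apply: mincrit_closed Cm lC _ (valP (src l : vtx LH)).
by have := lk_mor l; rewrite lk_remove.
Qed.

End MinimalCritical.

(** * The subinvariant vector of a KMS state *)

Section Subinvariance.
Variables (R : realType) (k : nat) (L : kgraph k) (r : 'I_k -> R).
Variables (A : cstarAlgType R) (t : mor L -> A) (alpha : R -> A -> A).
Hypotheses (TCK : is_TCK_family t) (gen : generates t).
Hypothesis dyn : is_toeplitz_dynamics t r alpha.
Hypothesis fL : finite_kgraph L.
Variable phi : A -> R[i].
Hypothesis kms : is_KMS_state alpha 1 phi.
Implicit Types (v w : vtx L) (l : mor L).

Let phiD a b : phi (a + b) = phi a + phi b. Proof. by case: kms => -[]. Qed.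
Let phiZ (z : R[i]) a : phi (z *: a) = z * phi a. Proof. by case: kms =>
  -[]. Qed.
Let phi_ge0 a : 0 <= phi (a^# ** a). Proof. by case: kms => -[]. Qed.
Let Tvs v : (t (idp v))^# = t (idp v). Proof. by case: TCK => _ []. Qed.
Let Tvi v : t (idp v) ** t (idp v) = t (idp v). Proof. by case: TCK =>
  _ []. Qed.

Definition mass v : R := complex.Re (phi (t (idp v))).

Lemma massE v : phi (t (idp v)) = ((mass v)%:C)%C.
Proof.
have := phi_ge0 (t (idp v)); rewrite Tvs Tvi => /complex_ge0P[m _ e].
by rewrite /mass e.
Qed.

Lemma mass_ge0 v : 0 <= mass v.
Proof. by have := phi_ge0 (t (idp v)); rewrite Tvs Tvi massE lecR. Qed.

Lemma phi_range l : phi (range_proj t l) =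
  ((expR (- freq r l) * mass (src l))%:C)%C.
Proof. by rewrite (kms_range_proj TCK gen dyn l kms) massE rmorphM. Qed.

(** [range_proj t l] lies under the projection at [v], so [phi] vanishes on it too; but its value is
    a positive multiple of the mass at [src l]. *)
Lemma mass_hereditary v w : lk v w -> mass v = 0 -> mass w = 0.
Proof.
move=> /linkedP[l [lv <-]] mv.
have : phi (range_proj t l) = 0.
  have -> : range_proj t l = range_proj t l ** t (idp v).
    have := congr1 (@adj R A) (range_proj_rng TCK l).
    by rewrite adjM range_proj_adj Tvs lv.
  by apply: (functional_null_proj phiD phiZ phi_ge0); rewrite ?massE ?mv.
rewrite phi_range => /complexI/eqP;
  rewrite mulf_eq0 gt_eqF ?expR_gt0 //= => /eqP //.
Qed.

Lemma freq_egen l i : deg l = egen i -> freq r l = r i.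
Proof.
move=> dl; rewrite /freq (bigD1 i) //= dl ffunE eqxx mulr1 big1 ?addr0 // =>
  j ji.
by rewrite ffunE (negPf ji) mulr0.
Qed.

Definition edges v (i : 'I_k) : {fset mor L} :=
  fset_set [set l : mor L | rng l = v /\ deg l = egen i]%classic.

Lemma edgesP v i l : (l \in edges v i) = (rng l == v) && (deg l == egen i).
Proof.
rewrite in_fset_set; last by apply: sub_finite_set (fL (egen i)) => l' /= [].
by apply/idP/andP => [|[/eqP h1 /eqP h2]]; rewrite inE /= => // -[-> ->].
Qed.

Lemma sum_ecount (F : vtx L -> R) v i :
  \sum_w ecount R i v w * F w = \sum_(l <- edges v i) F (src l).
Proof.
rewrite (partition_big (fun l => src l) xpredT) //=; apply: eq_bigr => w _.
rewrite [RHS](eq_bigr (fun=> F w)); last by move=> l /eqP ->.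
rewrite big_const_seq iter_addr_0 mulr_natl; congr (_ *+ _).
rewrite -size_filter; apply: perm_size; apply: uniq_perm.
- exact: fset_uniq.
- by rewrite filter_uniq // fset_uniq.
move=> l; rewrite mem_filter edgesP in_fset_set; last exact: finite_edges.
by apply/idP/and3P => [|[/eqP h1 /eqP h2 /eqP h3]];
  rewrite inE /= => // -[-> -> ->].
Qed.

(** The range projections of the edges of colour [i] into [v] are mutually orthogonal subprojections
    of [t (idp v)]; so [t (idp v) - p] is a projection, and [phi] is nonnegative on it. *)
Lemma mass_subinvariant v i : \sum_w ecount R i v w * mass w <= expR (r i) *
  mass v.
Proof.
rewrite sum_ecount.
pose p := \sum_(l <- edges v i) range_proj t l.
have ps : p^# = p by rewrite /p adj_sum; apply: eq_bigr => l _;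
  rewrite range_proj_adj.
have qp : t (idp v) ** p = p.
  rewrite /p amul_sumr; apply: eq_big_seq => l;
    rewrite edgesP => /andP[/eqP <- _].
  by rewrite range_proj_rng.
have pq : p ** t (idp v) = p by have := congr1 (@adj R A) qp;
  rewrite adjM ps Tvs.
have pp : p ** p = p.
  rewrite {2 3}/p amul_sumr; apply: eq_big_seq => l lE.
  rewrite /p amul_suml (bigD1_seq l) //=.
  rewrite (range_proj_idem TCK) big_seq_cond big1 ?addr0 // =>
    l' /andP[lE' ll'].
  rewrite /range_proj amulA -(amulA (t l')) (tck_orth TCK) ?amul0r ?amul0l //.
  by move: lE lE'; rewrite !edgesP => /andP[_ /eqP ->] /andP[_ /eqP ->].
have := phi_ge0 (t (idp v) - p).
rewrite adjB ps Tvs amulBl !amulBr Tvi qp pq pp subrr subr0 (functionalB phiD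
  phiZ) massE.
have -> : phi p = ((expR (- r i) * \sum_(l <- edges v i) mass (src l))%:C)%C.
  rewrite mulr_sumr rmorph_sum /= /p (big_morph phi phiD (functional0 phiZ)).
  apply: eq_big_seq => l; rewrite edgesP => /andP[_ /eqP dl].
  by rewrite phi_range (freq_egen dl).
rewrite -rmorphB lecR subr_ge0 => h.
have := ler_wpM2l (expR_ge0 (r i)) h.
by rewrite mulrA -expRD subrr expR0 mul1r.
Qed.

End Subinvariance.

(** * Vanishing beyond a critical component *)

Section Vanish.
Variables (R : realType) (k : nat) (L : kgraph k) (r : 'I_k -> R).
Hypotheses (fL : finite_kgraph L) (r_gt0 : forall i, 0 < r i).
Hypothesis L_cover : (\bigcup_(C in components L) C)%SET = [set: vtx L]%SET.
Hypothesis L_link : forall C D, C \in components L -> D \in components L ->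
      (exists j, linked_in j C D) -> forall i, linked_in i C D.
Variable m : vtx L -> R.
Hypothesis m_ge0 : forall v, 0 <= m v.
Hypothesis m_her : forall v w, lk v w -> m v = 0 -> m w = 0.
Hypothesis m_sub : forall v i, \sum_w ecount R i v w * m w <= expR (r i) * m v.
Implicit Types (v w : vtx L) (l : mor L).

Lemma critical_edge_vanish C j :
  r j = ln (spectral_radius (vertex_mx R L j)) ->
  ln (spectral_radius (vertex_mx R L j)) =
    ln (spectral_radius (vertex_block R C j)) ->
  irreducible_mx (vertex_block R C j) ->
  forall v w, v \in C -> w \notin C -> ecount R j v w != 0 -> m w = 0.
Proof.
move=> rj e irr v w vC wC avw.
set rho := spectral_radius (vertex_block R C j) in e.
have rho0 : 0 < rho.
  by rewrite ltNge; apply/negP => /ln0 e0; have := r_gt0 j;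
    rewrite rj e e0 ltxx.
have erho : expR (r j) = rho by rewrite rj e lnK.
pose x : 'cV[R]_#|C| := \col_i m (enum_val i).
have xE i : (vertex_block R C j *m x) i 0 =
  \sum_(w' in C) ecount R j (enum_val i) w' * m w'.
  rewrite mxE (sum_indexes _ (indexes_enum_val C)); apply: eq_bigr => i' _.
  by rewrite vertex_blockE [x _ _]mxE.
have split_sum v' : \sum_w' ecount R j v' w' * m w' =
    \sum_(w' in C) ecount R j v' w' * m w' + \sum_(w' | w' \notin C) ecount R j
      v' w' * m w'.
  by rewrite (bigID (mem C)).
have term_ge0 v' w' : 0 <= ecount R j v' w' * m w' by rewrite mulr_ge0 //
  ecount_ge0.
have rest_ge0 v' : 0 <= \sum_(w' | w' \notin C) ecount R j v' w' * m w'.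
  by apply: sumr_ge0.
have := @subinvariant_eq R _ (vertex_block R C j) x _ irr rho0 _ _
  (enum_rank_in vC v).
rewrite xE [x _ _]mxE enum_rankK_in // => eqv.
have {}eqv : \sum_(w' in C) ecount R j v w' * m w' = rho * m v.
  apply: eqv => [i1 i2|i|i].
  - by rewrite vertex_blockE ecount_ge0.
  - by rewrite mxE.
  - rewrite xE [x _ _]mxE -/rho -erho.
    by apply: le_trans (m_sub _ _); rewrite split_sum lerDl.
(* The block alone already exhausts the bound [rho * m v], so the nonnegative terms from outside [C]
   must be zero. *)
have := m_sub v j; rewrite split_sum eqv erho gerDl => rest_le0.
have rest0 : \sum_(w' | w' \notin C) ecount R j v w' * m w' = 0.
  by apply/eqP; rewrite eq_le rest_le0 rest_ge0.
have := psumr_eq0P (fun w' _ => term_ge0 v w') rest0 wC.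
by move=> /eqP; rewrite mulf_eq0 (negPf avw) => /eqP.
Qed.

Lemma deg_split l i : (0 < deg l i)%N -> exists l1 l2,
  [/\ deg l1 = egen i, src l1 = rng l2,
    l = compose l1 l2 & deg l = egen i + deg l2].
Proof.
move=> li; pose n := [ffun i' => (deg l i' - egen i i')%N].
have e : deg l = egen i + n.
  apply/ffunP => i'; rewrite !ffunE; case: eqVneq => [->|_] /=.
    by rewrite [RHS]subnKC.
  by rewrite subn0 [RHS]add0n.
have [[l1 l2] [[/= d1 d2 s12 lE] _]] := factorization e.
by exists l1, l2; rewrite d2.
Qed.

Lemma critical_vanish C v w : C \in components L -> is_critical r C ->
  v \in C -> w \notin C -> lk v w -> m w = 0.
Proof.
move=> cC [j [rj e irr]] vC wC vw.
have edge := critical_edge_vanish rj e irr.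
have path_j n : forall l, deg l = egen j *+ n -> rng l \in C ->
  src l \notin C -> m (src l) = 0.
  elim: n => [|n IH] l.
    by rewrite mulr0n => /deg0_idp ->; rewrite rng_idp src_idp => ->.
  move=> dl lC lC'.
  have [|l1 [l2 [d1 s12 lE dE]]] := @deg_split l j.
    by rewrite dl mulrS !ffunE eqxx.
  have d2 : deg l2 = egen j *+ n.
    by apply: (@ffun_nat_addI _ (egen j)); rewrite -dE dl mulrS.
  have r1 : rng l1 = rng l by rewrite lE rng_comp.
  have s2 : src l2 = src l by rewrite lE src_comp.
  have [l1C|l1C] := boolP (src l1 \in C).
    by rewrite -s2; apply: IH; rewrite -?s12 ?s2.
  apply: (m_her (v := src l1)); first by rewrite s12 -s2 lk_mor.
  apply: (edge (rng l1)) => //; first by rewrite r1.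
  by apply/ecount_neq0 => //; exists l1.
have path_all n : forall l, (\sum_i deg l i)%N = n -> rng l \in C ->
  src l \notin C -> m (src l) = 0.
  elim: n => [|n IH] l dl lC lC'.
    have d0 : deg l = 0.
      apply/ffunP => i; rewrite ffunE; apply/eqP.
      by move/eqP: dl; rewrite sum_nat_eq0 => /forallP/(_ i).
    by move: lC lC'; rewrite (deg0_idp d0) rng_idp src_idp => ->.
  have [i li] : exists i, (0 < deg l i)%N.
    apply/existsP; apply/contraT; rewrite negb_exists => /forallP H.
    by move: dl; rewrite big1 // => i _; apply/eqP; have := H i;
      rewrite -eqn0Ngt.
  have [l1 [l2 [d1 s12 lE dE]]] := deg_split li.
  have r1 : rng l1 = rng l by rewrite lE rng_comp.
  have s2 : src l2 = src l by rewrite lE src_comp.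
  have [l1C|l1C] := boolP (src l1 \in C).
    rewrite -s2; apply: IH; rewrite -?s12 ?s2 //.
    apply: succn_inj; rewrite -dl -add1n.
    rewrite dE; under [in RHS]eq_bigr do rewrite ffunE.
    rewrite big_split /=; congr addn.
    rewrite (bigD1 i) //= ffunE eqxx big1 // => i' ii'.
    by rewrite ffunE (negPf ii').
  (* The edge [l1] leaves [C] with an arbitrary colour [i]. By [L_cover] it lands in a component
     [D], and [L_link] provides a path of colour [j] from [C] to [D], to which [path_j] applies; [m]
     then vanishes on all of [D]. *)
  have : src l1 \in [set: vtx L]%SET by rewrite inE.
  rewrite -L_cover => /bigcupP[D cD l1D].
  have CD : exists i, linked_in i C D.
    by exists i, l1, 1%N; split=> //; rewrite r1.
  have [l3 [n3 [l3C l3D d3]]] := L_link cC cD CD j.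
  have m3 : m (src l3) = 0.
    apply: (path_j n3) => //; apply: contra l1C => l3C'.
    by rewrite (component_eq cC cD l3C' l3D).
  apply: (m_her (v := src l3)) => //.
  apply: lk_trans (component_lk cD l3D l1D) _.
  by rewrite s12 -s2 lk_mor.
by move: vw => /linkedP[l [lv lw]]; rewrite -lw; apply: path_all;
  rewrite ?lv ?lw.
Qed.

End Vanish.

Theorem proposition3p4 (R : realType) (k : nat) (L : kgraph k) (r : 'I_k -> R)
  (L_finite : finite_kgraph L) (L_no_sources : no_sources L)
  (L_no_sinks : no_sinks L) (r_gt0 : forall i, 0 < r i)
  (r_max : \big[Num.max/0]_(i < k)
      ((r i)^-1 * ln (spectral_radius (vertex_mx R L i))) = 1)
  (L_cover : (\bigcup_(C in components L) C)%SET = [set: vtx L]%SET)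
  (L_irr : forall C, C \in components L -> coordinatewise_irreducible R C)
  (L_link : forall C D, C \in components L -> D \in components L ->
      (exists j, linked_in j C D) -> forall i, linked_in i C D) :
  let mincrit := min_critical_components L r in
  let G := (\bigcup_(C in mincrit) C)%SET in
  let H := (hereditary_closure G :\: G)%SET in
  exists hH : hereditary H,
  let LH := kgraph_remove hH in
  [/\ mincrit = [set [set val v | v in (D : {set vtx LH})]%SET
                  | D in critical_components LH r]%SET,
      forall C, C \in mincrit ->
        hereditary ([set v | val v \in C]%SET : {set vtx LH})
    & forall (A B : cstarAlgType R) (t : mor L -> A) (u : mor LH -> B)
        (alpha : R -> A -> A) (alphaH : R -> B -> B) (q : A -> B),
        is_toeplitz_algebra t -> is_toeplitz_algebra u ->
        is_toeplitz_dynamics t r alpha -> is_toeplitz_dynamics u r alphaH ->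
        is_toeplitz_quotient t u q ->
        forall phi : A -> R[i], is_KMS_state alpha 1 phi ->
        exists psi : B -> R[i], is_KMS_state alphaH 1 psi /\
          phi = (psi \o q)%FUN].
Proof.
move=> mincrit G H; exists (hereditary_H L r) => LH; split.
- exact: mincrit_remove.
- by move=> C Cm; exact: mincrit_hereditary.
move=> A B t u alpha alphaH q tA uB dynA dynB qP phi kms.
have [TCK gen _] := tA; have [TCKu genu _] := uB.
have [qhom qsurj qt _] := qP; have [phis _] := kms.
have e1 := tck_unitP TCK gen.
have phiH l : src l \in H -> phi (range_proj t l) = 0.
  rewrite inE => /andP[lG /hereditary_closureP[g gG gl]].
  have [C Cm gC] := mincritP _ _ gG.
  have lC : src l \notin C by apply: contra lG => lC; apply/mincritP; exists C.
  have Cc : is_critical r C.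
    by have := mincrit_critical Cm; rewrite inE => /andP[_ /asboolP].
  rewrite (phi_range TCK gen dynA kms).
  suff -> : mass t phi (src l) = 0 by rewrite mulr0.
  apply: (critical_vanish L_finite r_gt0 L_cover L_link _ _ _
    (mincrit_component Cm) Cc gC lC gl).
  - exact: (mass_ge0 TCK kms).
  - exact: (mass_hereditary TCK gen dynA kms).
  - exact: (mass_subinvariant TCK gen dynA L_finite kms).
have ker a : q a = 0 -> phi a = 0.
  move=> /(toeplitz_quotient_ker L_finite tA uB qP).
  exact: (state_hnull0 TCK gen phis).
have [psi psis psiE] := factor_state e1 qhom qsurj phis ker.
exists psi; split; last by apply/funext => a; rewrite /= psiE.
apply: (kms_of_homogeneous TCKu genu dynB psis) => l m b.
have [a <-] := qsurj b.
have [_ _ qM qA] := qhom.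
(* The elements [u l ** (u m)^#] lift to homogeneous elements of the same frequency, so the identity
   for [psi] is that for [phi] read through [q]. *)
rewrite -!qt -qA -!qM !psiE.
exact: (kms_homogeneous TCK gen dynA kms
  (homogeneous_span dynA (val l) (val m))).
Qed.
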